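(* Let $\tilde y\in E$ be a fixed element. Let Assumptions (A) and (B) of the context hold, and suppose that $\mathbb{E}\,d^\theta(\tilde y,f(\tilde y,X_0,\varepsilon_1))<\infty$ for some $0<\theta\le1$. Let $Y_{n+1}=f(Y_n,X_n,\varepsilon_{n+1})$ with an initialization $Y_0$ satisfying $\mathbb{E}[d(\tilde y,Y_0)^\theta]<\infty$, which is either independent of the process $((X_t,\varepsilon_{t+1}))_{t\ge0}$ or equal to $Y_0^*$, the stationary initialization of the chain. Then the following mixing properties hold. (i) If $\alpha_X(n)=O(\lambda^n)$ for some $\lambda\in(0,1)$, then $\alpha_{X,Y}(n)=O\left(\kappa^{\,n/[\log(n)\log\log(n)]}\right)$ for some $\kappa\in(0,1)$. (ii) If $\alpha_X(n)=O(e^{-cn^\gamma})$ for some $c>0$ and $0<\gamma<1$, then $\alpha_{X,Y}(n)=O(e^{-c'n^\gamma})$ for some $c'>0$. (iii) If $\alpha_X(n)=O(n^{-\gamma})$ for some $\gamma>0$, then $\alpha_{X,Y}(n)=O\left(\frac{\log^\gamma(n)}{n^\gamma}\right)$.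
   Context: Setting. $E,F$ are Polish spaces with Borel sigma-fields $\mathcal{B}(E),\mathcal{B}(F)$; $d(\cdot,\cdot)$ denotes the metric on $E$. $X=(X_n)_{n\in\mathbb{Z}}$ is a strongly (strictly) stationary $F$-valued process. $(\varepsilon_n)$ is an i.i.d. sequence of $\mathbb{R}^d$-valued random variables ($d\ge1$ an integer), independent of $X$, indexed by $\mathbb{N}$, and extended to an i.i.d. sequence indexed by $\mathbb{Z}$ independent of $X$ when two-sided processes are considered. $f:E\times F\times\mathbb{R}^d\to E$ is measurable. Assumption (A) (contractivity modulo a constant). There exist $R>0$ and $\rho\in(0,1)$ such that $d(f(y_1,x,e),f(y_2,x,e))\le\rho\,d(y_1,y_2)+R$ for all $y_1,y_2\in E$, $x\in F$, $e\in\mathbb{R}^d$. Assumption (B) (minorization within bounded distance), with $R,\rho$ the constants of (A). Let $B_\delta(y)=\{z\in E: d(y,z)\le\delta\}$. There are a probability kernel $\nu:F\times E^2\times\mathcal{B}(E)\to[0,1]$, a measurable function $\eta:F\to(0,1]$ and a constant $K>0$ such that, for all $y_1,y_2\in E$ with $0<d(y_1,y_2)\le 2R/(1-\rho)$, all $x\in F$ and all $A\in\mathcal{B}(E)$, $\mathbb{P}(f(y_i,x,\varepsilon_0)\in A)\ge\eta(x)\nu(x,y_1,y_2,A)$ for $i=1,2$, and $\nu(x,y_1,y_2,B_K(y_i))=1$ for $i=1,2$. Stationary solution. $((X_t,Y^*_t))_{t\in\mathbb{Z}}$ is a stationary process with $Y^*_t=f(Y^*_{t-1},X_{t-1},\varepsilon_t)$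 a.s. for all $t\in\mathbb{Z}$, where for each $t$ the sequence $(\varepsilon_s)_{s>t}$ is independent of $((X_s)_{s\in\mathbb{Z}},(Y^*_s)_{s\le t})$. Under the hypotheses of the claim such a process exists and its law is unique. Mixing coefficients. For a process $Z=(Z_t)_{t\in I}$, $I=\mathbb{N}$ or $\mathbb{Z}$, $\alpha_Z(n)=\sup_{j\ge0}\sup\{|\mathbb{P}(A\cap B)-\mathbb{P}(A)\mathbb{P}(B)|: A\in\sigma(Z_s:s\le j),\ B\in\sigma(Z_s:s\ge n+j)\}$. $\alpha_{X,Y}$ denotes the sequence of $\alpha$-mixing coefficients of $((X_t,Y_t))_{t\in I}$, where $I=\mathbb{Z}$ is considered only for the stationary version $Y_t=Y_t^*$ and $I=\mathbb{N}$ otherwise. $\log$ is the logarithm of base $2$; all $O(\cdot)$ are as $n\to\infty$. *)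

(* Defs.v *)
From HB Require Import structures.
From mathcomp Require Import all_boot all_order all_algebra.
From mathcomp Require Import all_classical all_reals all_analysis.

Set Implicit Arguments.
Unset Strict Implicit.
Unset Printing Implicit Defensive.

Import Order.TTheory GRing.Theory Num.Theory.
Import numFieldNormedType.Exports.

Local Open Scope classical_set_scope.
Local Open Scope ring_scope.

HB.mixin Record isSeparable T & Topological T := {
  separable : exists2 D : set T, countable D & dense D
}.

#[short(type="polishType")]
HB.structure Definition Polish (R : numDomainType) :=
  {T of CompletePseudoMetric R T & Metric R T & isSeparable T}.

(** Borel spaces. On products the product sigma-field is used; by separability
    it is the Borel sigma-field of the product. *)
Notation borel T := (g_sigma_algebraType (@open T)).

Section sigma_fields_and_independence.
Context {d d' : measure_display} {T : measurableType d}
  {U : measurableType d'} {R : realType} (P : probability T R).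

(** sigma(Z_i : i in J) *)
Definition sigma_of {I : Type} (Z : I -> T -> U) (J : set I) : set_system T :=
  <<s \bigcup_(i in J) g_sigma_algebra_preimage (Z i) >>.

Definition independent_systems (G H : set_system T) : Prop :=
  forall A B, G A -> H B -> P (A `&` B) = (P A * P B)%E.

Definition mutually_independent {I : eqType} (Z : I -> T -> U) : Prop :=
  forall s : seq I, uniq s ->
  forall A : I -> set U, (forall i, measurable (A i)) ->
    P (\bigcap_(i in [set` s]) Z i @^-1` A i)
    = (\prod_(i <- s) P (Z i @^-1` A i))%E.

Definition identically_distributed {I : Type} (Z : I -> T -> U) : Prop :=
  forall i j (A : set U), measurable A -> P (Z i @^-1` A) = P (Z j @^-1` A).

Definition iid {I : eqType} (Z : I -> T -> U) : Prop :=
  mutually_independent Z /\ identically_distributed Z.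

(** Strict stationarity: the finite-dimensional laws, as measures on the
    product space [U ^ k], are invariant under time shifts. *)
Definition strictly_stationary (Z : int -> T -> U) : Prop :=
  forall (k : nat) (t : 'I_k -> int) (h : int) (B : set (k.-tuple U)),
    measurable B ->
    P [set w | B [tuple Z (t i + h) w | i < k]]
    = P [set w | B [tuple Z (t i) w | i < k]].

End sigma_fields_and_independence.

Section mixing.
Context {d d' : measure_display} {T : measurableType d}
  {U : measurableType d'} {R : realType} (P : probability T R).

Definition alpha_dependence (G H : set_system T) : R :=
  sup [set `|fine (P (A `&` B)) - fine (P A) * fine (P B)|
      | A in G & B in H].

(** Both index sets are handled at once: [I] is [nat] or [int], and [inj]
    embeds the nonnegative times [j] into [I]. *)
Definition alpha_coef {disp : Order.disp_t} {I : porderType disp}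
    (inj : nat -> I) (Z : I -> T -> U) (n : nat) : R :=
  sup [set alpha_dependence (sigma_of Z [set s | (s <= inj j)%O])
                            (sigma_of Z [set s | (inj (n + j)%N <= s)%O])
      | j in [set: nat]].

Definition alphaN (Z : nat -> T -> U) : nat -> R := alpha_coef id Z.
Definition alphaZ (Z : int -> T -> U) : nat -> R := alpha_coef Posz Z.

End mixing.

Section model.
Context {d : measure_display} {T : measurableType d} {R : realType}
  (P : probability T R) {E F : polishType R} {p : nat}.
Implicit Types (f : borel E * borel F * borel 'rV[R]_p -> borel E).

Definition closed_dball (y : E) (r : R) : set E := [set z | mdist y z <= r].

Definition contractive_modulo_constant f (rho r : R) : Prop :=
  forall (y1 y2 : E) (x : F) (e : 'rV[R]_p),
    mdist (f (y1, x, e) : E) (f (y2, x, e) : E) <= rho * mdist y1 y2 + r.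

Definition minorized_within_bounded_distance f (rho r : R)
    (eps0 : T -> borel 'rV[R]_p)
    (nu : R.-pker (borel F * (borel E * borel E)) ~> borel E)
    (eta : borel F -> R) (K : R) : Prop :=
  forall y1 y2 : E, 0 < mdist y1 y2 <= 2 * r / (1 - rho) ->
  forall x : F,
    (forall A : set (borel E), measurable A ->
      ((eta x)%:E * nu (x, (y1, y2)) A <= P [set w | A (f (y1, x, eps0 w))])%E
      /\
      ((eta x)%:E * nu (x, (y1, y2)) A <= P [set w | A (f (y2, x, eps0 w))])%E)
    /\ nu (x, (y1, y2)) (closed_dball y1 K) = 1%E
    /\ nu (x, (y1, y2)) (closed_dball y2 K) = 1%E.

(** E [d(y, Z)^theta] *)
Definition dist_moment (theta : R) (y : E) (Z : T -> E) : \bar R :=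
  (\int[P]_w ((mdist y (Z w)) `^ theta)%:E)%E.

Definition joint {I : Type} (X : I -> T -> borel F) (Y : I -> T -> borel E)
    (t : I) (w : T) : borel F * borel E :=
  (X t w, Y t w).

Record stationary_solution f (X : int -> {RV P >-> borel F})
    (eps : int -> {RV P >-> borel 'rV[R]_p})
    (Y : int -> {RV P >-> borel E}) : Prop := {
  solution_stationary : strictly_stationary P (joint X Y) ;
  solution_recursion : forall t : int,
    {ae P, forall w, Y t w = f (Y (t - 1) w, X (t - 1) w, eps t w)} ;
  solution_nonanticipative : forall t : int,
    independent_systems P (sigma_of eps [set s | t < s])
      <<s sigma_of X [set: int] `|` sigma_of Y [set s | s <= t] >>
}.

End model.

Definition log2 {R : realType} (x : R) : R := ln x / ln 2.

(** How the decay of [aX] is inherited by [aXY], in the exponential,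
    subexponential and polynomial regimes. *)
Definition inherits_mixing_rates {R : realType} (aX aXY : nat -> R) : Prop :=
  [/\ (exists2 lambda : R, 0 < lambda < 1 &
        aX =O_\oo (fun n => lambda ^+ n)) ->
      exists2 kappa : R, 0 < kappa < 1 &
        aXY =O_\oo
          (fun n => kappa `^ (n%:R / (log2 n%:R * log2 (log2 n%:R)))),
      forall c gamma : R, 0 < c -> 0 < gamma < 1 ->
        aX =O_\oo (fun n => expR (- c * n%:R `^ gamma)) ->
        exists2 c' : R, 0 < c' &
          aXY =O_\oo (fun n => expR (- c' * n%:R `^ gamma))
    & forall gamma : R, 0 < gamma ->
        aX =O_\oo (fun n => n%:R `^ (- gamma)) ->
        aXY =O_\oo (fun n => log2 n%:R `^ gamma / n%:R `^ gamma)].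

(* Main.v *)
From HB Require Import structures.
Require Import Defs.
From mathcomp Require Import all_boot all_order all_algebra.
From mathcomp Require Import all_classical all_reals all_analysis.
From mathcomp Require Import measurable_realfun.
From mathcomp Require Import ring lra zify.

Set Implicit Arguments.
Unset Strict Implicit.
Unset Printing Implicit Defensive.

Import Order.TTheory GRing.Theory Num.Theory.
Import numFieldNormedType.Exports.

Local Open Scope classical_set_scope.
Local Open Scope ring_scope.

(** The chain remembers its past only through its current value and through the
    environment [X], and its current value is forgotten by coupling. The coupling
    is carried out on test functions instead of trajectories. Freeze the
    environment, fix a set [S] of paths and let phi y be the probability that the
    future of the chain after time N lies in [S] when the chain starts from [y].
    Moving two points with the same noise contracts their distance towards
    q = r / (1 - rho), and one step in the environment [x] multiplies by
    1 - eta x the oscillation of a test function over pairs at bounded distance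
    ([attempt_oscillation]). After a failed attempt the two points are still
    within [failure_radius] of each other, so that a fixed number [stride] of
    common moves makes a new attempt possible. Hence
    |phi y - phi y0| is at most the product of 1 - eta over the environments met
    by the attempts, as soon as [y] and [y0] are at distance at most q / rho ^ n0,
    [n0] being the length of the burn-in ([loss_of_memory]).

    So, up to an error [miss_prob], the future of the chain may be restarted from
    the fixed point [y0], and it is then a function of the environment after the
    present time; its dependence on the past is bounded by the mixing of the
    environment ([dependence_of_future]), provided that the past of the chain and
    the future of the environment are themselves weakly dependent. If the initial
    value is independent, the past of the chain is made of the past of the
    environment and of independent randomness, which creates no dependence
    ([dependence_enlarge]). If the chain is stationary, its past is reached by
    windows of finite length ([dependence_increasing]); each window is the future
    of a chain started long before it, and the same argument applies with the
    roles of past and future exchanged. With q about n / (stride + 3) this gives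

      alpha_XY n <= alpha_X q + C (b ^ q + pi q),   b = rho ^ theta,

    where b ^ q comes from Markov's inequality for the moments of order [theta]
    ([bounded_moments], [far_prob_le]), and pi J, called [survival], is the
    expectation of the product of 1 - eta over [J] attempts.

    It remains to see how fast pi decreases. Stationarity and mixing give
    pi (a + q + b) <= pi a * pi b + alpha_X q and pi 1 < 1 ([survival_decouple],
    [survival1_lt1]), and the rest is a statement on real sequences
    ([inherits_mixing_rates_of_bound]). Lengths l (k + 1) = 2 l k + q k, with gaps
    q k that keep alpha_X (q k) below a geometric function of 2 ^ k, give
    pi (l k) <= delta ^ (2 ^ k). If alpha_X is geometric, q k may be taken of
    order 2 ^ k, so that l k is of order k 2 ^ k and pi n is at most
    exp (- c n / log n), which is even better than the rate to be proved. If
    alpha_X n is exp (- c n ^ gamma), q k of order 2 ^ (k / gamma) dominates l k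
    and pi inherits the rate. If alpha_X n is n ^ (- gamma), of order log n blocks
    of length of order n / log n give (log n / n) ^ gamma. *)

(** * Decay of sequences that are submultiplicative up to a mixing error *)

Section bigO_sequences.
Context {R : realType}.
Implicit Types u g : nat -> R.

Lemma bigO_natP u g : u =O_\oo g <->
  exists C : R, exists N : nat, 0 < C /\
    forall n, (N <= n)%N -> `|u n| <= C * `|g n|.
Proof.
split.
  by move=> /eqO_exP[C C0 [N _ hN]]; exists C, N; split.
move=> [C [N [C0 hN]]]; apply/eqO_exP; exists C => //.
by exists N => // n Nn; exact: hN.
Qed.

Lemma expr_eventually_le (lam e : R) : 0 <= lam < 1 -> 0 < e ->
  exists N : nat, forall n, (N <= n)%N -> lam ^+ n <= e.
Proof.
move=> /andP[l0 l1] e0.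
have /cvgrPdist_le /(_ _ e0) [N _ hN] :
    (fun n : nat => lam ^+ n) @ \oo --> (0 : R).
  by apply: cvg_expr; rewrite ger0_norm.
exists N => n Nn; have := hN n Nn.
by rewrite sub0r normrN ger0_norm // exprn_ge0.
Qed.

Lemma log2_ge (n k : nat) : (2 ^ k <= n)%N -> k%:R <= log2 n%:R :> R.
Proof.
move=> kn; have l2 : 0 < ln 2 :> R by rewrite ln_gt0 // ltr1n.
rewrite /log2 ler_pdivlMr // mulr_natl -lnXn // ler_ln ?posrE ?exprn_gt0 //.
  by rewrite -natrX ler_nat.
by rewrite ltr0n (leq_trans _ kn) // expn_gt0.
Qed.

Lemma leq_double_divn (n s : nat) : (0 < s <= n)%N -> (n <= 2 * s * (n %/ s))%N.
Proof.
move=> /andP[s0 sn]; have := ltn_ceil n s0.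
have : (s <= n %/ s * s)%N by rewrite leq_pmull // divn_gt0.
by rewrite mulSn -mulnA [(s * _)%N]mulnC; lia.
Qed.

(** The inequality ln y <= y at y = sqrt n shows that log n is of order at most
    sqrt n. *)
Lemma div_log2_unbounded (D : R) (M : nat) : 0 < D ->
  exists N : nat, forall n, (N <= n)%N -> M%:R <= n%:R / (D * log2 n%:R).
Proof.
move=> D0; have l2 : 0 < ln 2 :> R by rewrite ln_gt0 // ltr1n.
pose B := M%:R * D * 2 / ln 2.
have B0 : 0 <= B by rewrite divr_ge0 ?(ltW l2) // !mulr_ge0 // ltW.
exists (maxn 2 (Num.truncn (B ^+ 2)).+1) => n.
rewrite geq_max => /andP[n2 Bn].
have L1 : 1 <= log2 n%:R :> R by apply: (@log2_ge n 1).
have L0 : 0 < log2 n%:R :> R by apply: lt_le_trans L1.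
have n0 : 0 < n%:R :> R by rewrite ltr0n ltnW.
have s0 : 0 < Num.sqrt n%:R :> R by rewrite sqrtr_gt0.
have Bs : B <= Num.sqrt n%:R.
  rewrite -[B]ger0_norm // -sqrtr_sqr ler_wsqrtr //.
  by apply: (le_trans (ltW (truncnS_gt _))); rewrite ler_nat.
have lns : ln (Num.sqrt n%:R) <= Num.sqrt n%:R :> R.
  by apply: (le_trans (ltW (ln_sublinear s0))).
rewrite ler_pdivlMr; last by rewrite mulr_gt0.
rewrite mulrA.
rewrite /log2 -[X in ln X](@sqr_sqrtr _ n%:R) ?(ltW n0) // lnXn //.
rewrite -[leRHS](@sqr_sqrtr _ n%:R) ?(ltW n0) // expr2.
have E : M%:R * D * (ln (Num.sqrt n%:R) *+ 2 / ln 2) = B * ln (Num.sqrt n%:R).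
  by rewrite /B -mulr_natl; field; rewrite gt_eqF.
rewrite E; apply: (@le_trans _ _ (B * Num.sqrt n%:R)).
  by rewrite ler_wpM2l.
by rewrite ler_wpM2r // ltW.
Qed.

End bigO_sequences.
Section submultiplicative_up_to_mixing.
Context {R : realType}.
Variables aX surv : nat -> R.
Hypothesis aX_ge0 : forall n, 0 <= aX n.
Hypothesis surv_ge0 : forall n, 0 <= surv n.
Hypothesis surv_le1 : forall n, surv n <= 1.
Hypothesis surv_noninc : forall m n, (m <= n)%N -> surv n <= surv m.
Hypothesis surv_decouple :
  forall a q b, surv (a + q + b)%N <= surv a * surv b + aX q.
Hypothesis surv1 : surv 1%N < 1.

(** Each block costs a factor [surv 1] and an error; the errors add up to a
    geometric series. *)
Lemma surv_blocks N q : surv (N * q.+1)%N <= surv 1%N ^+ N + aX q / (1 - surv 1%N).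
Proof.
have p1 : 0 < 1 - surv 1%N by rewrite subr_gt0.
elim: N => [|N IH]; first by rewrite mul0n expr0 ler_wpDr // divr_ge0 // ltW.
rewrite mulSn -add1n.
apply: (le_trans (surv_decouple _ _ _)).
apply: (@le_trans _ _ (surv 1%N * (surv 1%N ^+ N + aX q / (1 - surv 1%N)) + aX q)).
  by rewrite lerD2r ler_wpM2l.
rewrite mulrDr -exprS -addrA lerD2l.
rewrite -[X in _ + X](@divfK _ (1 - surv 1%N)) ?gt_eqF //.
by rewrite le_eqVlt; apply/orP; left; apply/eqP; ring.
Qed.

(** The spare factor [delta] in the bound makes room for the mixing error:
    (delta x) ^ 2 + (delta - delta ^ 2) x ^ 2 = delta x ^ 2 for x = delta ^ 2 ^ k. *)
Lemma surv_doubling (delta : R) (l q : nat -> nat) :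
  0 < delta -> surv 1%N <= delta ^+ 2 -> l 0%N = 1%N ->
  (forall k, l k.+1 = (l k + q k.+1 + l k)%N) ->
  (forall k, aX (q k.+1) <= (delta - delta ^+ 2) * delta ^+ (2 ^ k.+1)) ->
  forall k, surv (l k) <= delta * delta ^+ (2 ^ k).
Proof.
move=> d0 p1d l0 lS hq; elim=> [|k IH].
  by rewrite l0 expn0 expr1 -expr2.
rewrite lS; apply: (le_trans (surv_decouple _ _ _)).
apply: (@le_trans _ _ ((delta * delta ^+ (2 ^ k)) ^+ 2
    + (delta - delta ^+ 2) * delta ^+ (2 ^ k.+1))).
  by rewrite lerD // expr2 ler_pM.
by rewrite exprMn -exprM -expnSr mulrBl addrC subrK.
Qed.

(** The arithmetic mean of [surv 1] and 1 exceeds their geometric mean, so that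
    the doubling can start from a single attempt. *)
Let delta := (1 + surv 1%N) / 2.

Lemma delta_gt0 : 0 < delta.
Proof. by rewrite /delta divr_gt0 // ltr_pwDl. Qed.

Lemma delta_lt1 : delta < 1.
Proof. by rewrite /delta; move: surv1; lra. Qed.

Lemma surv1_le_delta2 : surv 1%N <= delta ^+ 2.
Proof.
rewrite /delta -subr_ge0.
have -> : ((1 + surv 1%N) / 2) ^+ 2 - surv 1%N = ((1 - surv 1%N) / 2) ^+ 2 by field.
exact: sqr_ge0.
Qed.

(** From a schedule of gaps [q] to a rate: [n] lies between two consecutive
    lengths [l K] and [l K.+1], and only [2 ^ K] has to be compared with [n]. *)
Lemma surv_scales (C eps : R) (l q : nat -> nat) :
  0 < C -> 0 <= eps -> eps <= delta -> C * eps <= (delta - delta ^+ 2) * delta ->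
  l 0%N = 1%N -> (forall k, l k.+1 = (l k + q k.+1 + l k)%N) ->
  (forall k, aX (q k.+1) <= C * eps ^+ (2 ^ k.+1)) ->
  forall n, (0 < n)%N ->
  exists2 K, (l K <= n < l K.+1)%N & surv n <= delta ^+ (2 ^ K).
Proof.
move=> C0 e0 ed Ce l0 lS hq n n0.
have l_gt k : (k < l k)%N.
  by elim: k => [|k IH]; rewrite ?l0 // lS; lia.
have hl := surv_doubling delta_gt0 surv1_le_delta2 l0 lS.
have exK : exists K, (l K <= n)%N by exists 0%N; rewrite l0.
have bK K : (l K <= n)%N -> (K <= n)%N by move=> h; have := l_gt K; lia.
case: (ex_maxnP exK bK) => K lK maxK; exists K.
  rewrite lK /= ltnNge; apply/negP => /maxK; lia.
apply: (le_trans (surv_noninc lK)); apply: (le_trans (hl _ K)).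
  move=> k; apply: (le_trans (hq k)).
  have -> : (2 ^ k.+1 = (2 ^ k.+1).-1.+1)%N by rewrite prednK // expn_gt0.
  rewrite exprS mulrA (exprS delta (_.-1)) [leRHS]mulrA.
  apply: ler_pM => //; first by rewrite mulr_ge0 // ltW.
    by rewrite exprn_ge0.
  by apply: lerXn2r; rewrite ?nnegrE // ltW // delta_gt0.
by rewrite ler_piMl ?ltW ?delta_lt1 // exprn_gt0 // delta_gt0.
Qed.

Lemma geometric_scale_constant (C : R) : 0 < C ->
  exists2 eps : R, 0 < eps &
    eps <= delta /\ C * eps <= (delta - delta ^+ 2) * delta.
Proof.
move=> C0; have d0 := delta_gt0; have d1 := delta_lt1.
have dd : 0 < (delta - delta ^+ 2) * delta.
  by rewrite mulr_gt0 // subr_gt0 expr2 gtr_pMl.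
exists (Num.min delta ((delta - delta ^+ 2) * delta / C)).
  by rewrite lt_min d0 divr_gt0.
split; first by rewrite ge_min lexx.
by rewrite mulrC -ler_pdivlMr // ge_min lexx orbT.
Qed.

(** Gaps proportional to 2 ^ k have a mixing error geometric in 2 ^ k; the
    lengths are then of order k 2 ^ k, and 2 ^ K is of order n / log n. *)
Lemma surv_rate_exponential (lam C : R) (N0 : nat) : 0 < lam < 1 -> 0 < C ->
  (forall n, (N0 <= n)%N -> aX n <= C * lam ^+ n) ->
  exists2 c : R, 0 < c & forall n, (2 <= n)%N ->
    surv n <= expR (- c * (n%:R / log2 n%:R)).
Proof.
move=> /andP[l0 l1] C0 haX; have d0 := delta_gt0; have d1 := delta_lt1.
have [eps e0 [ed Ce]] := geometric_scale_constant C0.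
have [|N1 hN1] := expr_eventually_le _ e0 (lam := lam).
  by rewrite l1 ltW.
pose c' := (maxn N0 N1).+1.
pose q k := (c' * 2 ^ k)%N.
pose l k := (2 ^ k * (1 + c' * k))%N.
have hq k : aX (q k.+1) <= C * eps ^+ (2 ^ k.+1).
  apply: (le_trans (haX _ _)).
    rewrite /q (leq_trans (leq_maxl N0 N1)) // (leq_trans (leqnSn _)) //.
    by rewrite leq_pmulr // expn_gt0.
  rewrite ler_pM2l // /q exprM lerXn2r ?nnegrE ?exprn_ge0 ?(ltW l0) ?(ltW e0) //.
  by apply: hN1; rewrite /c' (leq_trans (leq_maxr N0 N1)).
have lS k : l k.+1 = (l k + q k.+1 + l k)%N.
  by rewrite /l /q expnS; ring.
have l00 : l 0%N = 1%N by rewrite /l; lia.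
have lnd : ln delta < 0 by rewrite ln_lt0 // d0.
exists (- ln delta / (2 * (1 + 2 * c'%:R))).
  by rewrite divr_gt0 ?oppr_gt0 // mulr_gt0 // ltr_pwDl // mulr_ge0.
move=> n n2.
have [K /andP[lK Kl] hpi] := surv_scales C0 (ltW e0) ed Ce l00 lS hq (ltnW n2).
apply: (le_trans hpi).
rewrite -[delta in leLHS]lnK ?posrE // -expRM_natl ler_expR.
have L1 : 1 <= log2 n%:R :> R by apply: (@log2_ge R n 1).
have L0 : 0 < log2 n%:R :> R by apply: lt_le_trans L1.
have KL : K%:R <= log2 n%:R :> R.
  apply: log2_ge; apply: leq_trans lK; rewrite /l leq_pmulr //.
have D0 : 0 < 2 * (1 + 2 * c'%:R) :> R.
  by rewrite mulr_gt0 // ltr_pwDl // mulr_ge0.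
have key : n%:R / (2 * (1 + 2 * c'%:R)) / log2 n%:R <= (2 ^ K)%:R :> R.
  rewrite ler_pdivrMr // ler_pdivrMr //.
  apply: (@le_trans _ _ (l K.+1)%:R); first by rewrite ler_nat ltnW.
  have -> : (l K.+1)%:R = (2 ^ K)%:R * (2 * (1 + c'%:R * (K%:R + 1))) :> R.
    by rewrite /l expnS natrM natrM natrD natrM -(addn1 K) natrD; ring.
  rewrite -mulrA ler_wpM2l // mulrCA ler_wpM2l //.
  have c0 : 0 <= c'%:R :> R by [].
  have k0 : 0 <= K%:R :> R by [].
  by nra.
have -> : - (- ln delta / (2 * (1 + 2 * c'%:R))) * (n%:R / log2 n%:R)
    = n%:R / (2 * (1 + 2 * c'%:R)) / log2 n%:R * ln delta.
  by field; rewrite !gt_eqF //= pmulr_rgt0 // in D0 *.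
by rewrite ler_nM2r.
Qed.

(** Gaps of order h ^ k with h = 2 ^ (1 / gamma) have a mixing error geometric in
    2 ^ k. As h > 2, the doubling is dominated by the gaps, the lengths are also of
    order h ^ k, and 2 ^ K is of order n ^ gamma. *)
Lemma surv_rate_subexponential (c gamma C : R) (N0 : nat) :
  0 < c -> 0 < gamma < 1 -> 0 < C ->
  (forall n, (N0 <= n)%N -> aX n <= C * expR (- c * n%:R `^ gamma)) ->
  exists2 c' : R, 0 < c' & forall n, (0 < n)%N ->
    surv n <= expR (- c' * n%:R `^ gamma).
Proof.
move=> c0 /andP[g0 g1] C0 haX; have d0 := delta_gt0; have d1 := delta_lt1.
have [eps e0 [ed Ce]] := geometric_scale_constant C0.
have eps1 : eps < 1 by apply: le_lt_trans ed d1.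
pose h : R := 2 `^ gamma^-1.
have hg k : (h ^+ k) `^ gamma = 2 ^+ k.
  rewrite -powR_mulrn ?powR_ge0 // /h -!powRrM mulrCA mulVf ?gt_eqF //.
  by rewrite mulr1 powR_mulrn.
have h2 : 2 < h.
  rewrite /h -[ltLHS]powRr1 // -subr_gt0 subr_gt0 /powR pnatr_eq0 /= ltr_expR.
  by rewrite ltr_pM2r ?ln_gt0 ?ltr1n // invf_gt1.
have h0 : 0 < h by apply: lt_trans h2.
have h1 : 1 <= h by apply: ltW; apply: lt_trans h2; rewrite ltr1n.
have hk1 k : 1 <= h ^+ k by rewrite exprn_ege1.
pose A := (- ln eps / c) `^ gamma^-1.
pose c' : R := 1 + N0%:R + A.
have A0 : 0 <= A by exact: powR_ge0.
have c'1 : 1 <= c' by rewrite /c' -addrA lerDl addr_ge0.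
pose q k := (Num.truncn (c' * h ^+ k)).+1.
have q_ge k : c' * h ^+ k <= (q k)%:R by rewrite /q ltW // truncnS_gt.
have q_le k : (q k)%:R <= 2 * c' * h ^+ k.
  have ch : 1 <= c' * h ^+ k by rewrite mulr_ege1.
  have ch0 : 0 <= c' * h ^+ k by apply: le_trans ch.
  rewrite /q -addn1 natrD; have := truncn_le (c' * h ^+ k); rewrite ch0.
  by lra.
pose l := fix l k := if k is k'.+1 then (l k' + q k + l k')%N else 1%N.
have l_le k : (l k)%:R <= (2 * c' * h / (h - 2) + 1) * h ^+ k.
  have hh : 0 < h - 2 by rewrite subr_gt0.
  have D0 : 0 <= 2 * c' * h / (h - 2).
    by rewrite divr_ge0 ?(ltW hh) // !mulr_ge0 // ?(ltW h0) //; lra.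
  elim: k => [|k IH].
    by rewrite /= expr0 mulr1 lerDr.
  have -> : (l k.+1)%:R = (l k)%:R + (q k.+1)%:R + (l k)%:R :> R.
    by rewrite /= !natrD.
  apply: (@le_trans _ _ (2 * ((2 * c' * h / (h - 2) + 1) * h ^+ k)
       + 2 * c' * h ^+ k.+1)).
    by have := q_le k.+1; lra.
  rewrite exprS.
  have E : 2 * c' * h = 2 * c' * h / (h - 2) * (h - 2).
    by rewrite divfK // gt_eqF.
  rewrite (_ : 2 * c' * (h * h ^+ k) = 2 * c' * h * h ^+ k); last by ring.
  move: E D0 {IH}; set D := 2 * c' * h / (h - 2) => -> _.
  have : 2 * h ^+ k <= h * h ^+ k by rewrite ler_pM2r ?exprn_gt0 // ltW.
  by lra.
have hq k : aX (q k.+1) <= C * eps ^+ (2 ^ k.+1).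
  apply: (le_trans (haX _ _)).
    rewrite -(ler_nat R); apply: le_trans (q_ge _).
    apply: (@le_trans _ _ c'); first by rewrite /c'; lra.
    by rewrite ler_peMr // (le_trans _ c'1).
  rewrite ler_pM2l //.
  rewrite -[eps]lnK ?posrE // -expRM_natl ler_expR.
  have le0 : 0 <= - ln eps / c.
    by rewrite divr_ge0 ?(ltW c0) // oppr_ge0 ltW // ln_lt0 // e0.
  have c'0 : 0 <= c' by rewrite (le_trans _ c'1).
  have c'g : - ln eps <= c * c' `^ gamma.
    rewrite mulrC -ler_pdivrMr //; apply: (@le_trans _ _ (A `^ gamma)).
      by rewrite /A -powRrM mulVf ?gt_eqF // powRr1.
    by rewrite ge0_ler_powR ?nnegrE ?(ltW g0) // /c' ler_wpDl // addr_ge0.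
  have qg : c' `^ gamma * (2 ^ k.+1)%:R <= (q k.+1)%:R `^ gamma.
    rewrite natrX -hg -powRM ?exprn_ge0 ?(ltW h0) //.
    by rewrite ge0_ler_powR ?nnegrE ?(ltW g0) ?mulr_ge0 ?exprn_ge0 ?(ltW h0).
  rewrite mulNr lerNl -mulrN; apply: (@le_trans _ _ (c * (c' `^ gamma * (2 ^ k.+1)%:R))).
    by rewrite mulrC mulrA ler_wpM2r.
  by rewrite ler_pM2l.
have [D D0 {}l_le] : exists2 D : R, 0 < D & forall k, (l k)%:R <= D * h ^+ k.
  exists (2 * c' * h / (h - 2) + 1) => //.
  rewrite ltr_wpDl // divr_ge0 ?subr_ge0 ?(ltW h2) // !mulr_ge0 ?(ltW h0) //.
  by rewrite (le_trans _ c'1).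
have Dg : 0 < D `^ gamma by rewrite powR_gt0.
have lS k : l k.+1 = (l k + q k.+1 + l k)%N by [].
have lnd : ln delta < 0 by rewrite ln_lt0 // d0.
exists (- ln delta / (2 * D `^ gamma)).
  by rewrite divr_gt0 ?oppr_gt0 // mulr_gt0.
move=> n n0.
have [K /andP[lK Kl] hpi] := surv_scales C0 (ltW e0) ed Ce
  (erefl : l 0%N = 1%N) lS hq n0.
apply: (le_trans hpi).
rewrite -[delta in leLHS]lnK ?posrE // -expRM_natl ler_expR.
have key : n%:R `^ gamma / (2 * D `^ gamma) <= (2 ^ K)%:R :> R.
  rewrite ler_pdivrMr ?mulr_gt0 // mulrA -natrM -expnSr mulrC.
  rewrite natrX -hg -powRM ?exprn_ge0 ?(ltW h0) ?(ltW D0) //.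
  rewrite ge0_ler_powR ?nnegrE ?(ltW g0) ?mulr_ge0 ?exprn_ge0 ?(ltW h0) ?(ltW D0) //.
  by apply: le_trans (l_le _); rewrite ler_nat ltnW.
have -> : - (- ln delta / (2 * D `^ gamma)) * n%:R `^ gamma
    = n%:R `^ gamma / (2 * D `^ gamma) * ln delta.
  by field; rewrite gt_eqF.
by rewrite ler_nM2r.
Qed.

(** Doubling would need gaps exponential in 2 ^ k. With A log n blocks instead,
    the product over the blocks is n ^ (- gamma) for a suitable A, and the gaps of
    length of order n / log n have a mixing error (log n / n) ^ gamma. *)
Lemma surv_rate_polynomial (gamma C b : R) (N0 s : nat) :
  0 < gamma -> 0 < C -> 0 < b < 1 -> (0 < s)%N ->
  (forall n, (N0 <= n)%N -> aX n <= C * n%:R `^ (- gamma)) ->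
  exists C' : R, exists N : nat, 0 < C' /\ forall n, (N <= n)%N ->
    b ^+ (n %/ s) + surv (n %/ s)%N <= C' * (log2 n%:R `^ gamma / n%:R `^ gamma).
Proof.
move=> g0 C0 /andP[b0 b1] s0 haX.
have d0 := delta_gt0; have d1 := delta_lt1.
have l2 : 0 < ln 2 :> R by rewrite ln_gt0 // ltr1n.
have p1d : surv 1%N <= delta.
  apply: (le_trans surv1_le_delta2); rewrite expr2 ler_piMl // ltW //.
pose beta := Num.max b delta.
have be0 : 0 < beta by rewrite lt_max b0.
have be1 : beta < 1 by rewrite gt_max b1.
have lnb : ln beta < 0 by rewrite ln_lt0 // be0.
(* Then beta ^ (A log2 n) = n ^ (- gamma). *)
pose A := gamma * ln 2 / - ln beta.
have A0 : 0 < A by rewrite divr_gt0 ?mulr_gt0 // oppr_gt0.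
pose N n := (Num.truncn (A * log2 n%:R)).+1.
pose D : R := 2 * s%:R * (A + 1).
have s0' : 0 < s%:R :> R by rewrite ltr0n.
have D0 : 0 < D by rewrite /D !mulr_gt0 // addr_gt0.
have [N1 hN1] := div_log2_unbounded (2 * (N0 + 2)) D0.
have p10 : 0 < 1 - surv 1%N by rewrite subr_gt0.
pose C' : R := 2 + C * (2 * D) `^ gamma / (1 - surv 1%N).
exists C', (maxn 2 (maxn N1 s)); split.
  by rewrite /C' addr_gt0 // divr_gt0 // mulr_gt0 // powR_gt0 // mulr_gt0.
move=> n; rewrite !geq_max => /andP[n2 /andP[nN1 ns]].
have L1 : 1 <= log2 n%:R :> R by apply: (@log2_ge R n 1).
have L0 : 0 < log2 n%:R :> R by apply: lt_le_trans L1.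
have n0 : 0 < n%:R :> R by rewrite ltr0n ltnW.
have AL : 0 <= A * log2 n%:R by rewrite mulr_ge0 ?ltW.
set q := (n %/ s)%N; set w := (q %/ N n)%N.
have N0' : 0 < (N n)%:R :> R by rewrite ltr0n.
have Nle : (N n)%:R <= (A + 1) * log2 n%:R.
  rewrite /N -addn1 natrD; have := truncn_le (A * log2 n%:R); rewrite AL.
  by lra.
have q1 : (0 < q)%N by rewrite divn_gt0.
have nq : n%:R <= 2 * s%:R * q%:R :> R.
  by rewrite -!natrM ler_nat leq_double_divn ?s0.
have wlt : n%:R / (D * log2 n%:R) < w%:R + 1.
  rewrite ltr_pdivrMr; last by rewrite mulr_gt0.
  have qw : q%:R < (w%:R + 1) * (N n)%:R :> R.
    by rewrite natr1 -natrM ltr_nat; exact: ltn_ceil.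
  apply: (le_lt_trans nq).
  have -> : (w%:R + 1) * (D * log2 n%:R)
    = 2 * s%:R * ((w%:R + 1) * ((A + 1) * log2 n%:R)) by rewrite /D; ring.
  rewrite ltr_pM2l ?mulr_gt0 //; apply: (lt_le_trans qw).
  by rewrite ler_wpM2l.
have big := hN1 n nN1.
have w_ge : (2 * N0 + 3 < w.+1)%N.
  rewrite -(ltr_nat R) -(natr1 w); apply: le_lt_trans wlt.
  by apply: le_trans big; rewrite ler_nat; clear; lia.
have wS : w = w.-1.+1 by move: (w) w_ge; clear => -[|?] //; lia.
have N0w : (N0 <= w.-1)%N.
  by move: w_ge; rewrite {1}wS; move: (w.-1); clear; lia.
have w1 : n%:R / (2 * D * log2 n%:R) <= (w.-1)%:R.
  have -> : n%:R / (2 * D * log2 n%:R) = n%:R / (D * log2 n%:R) / 2.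
    by field; rewrite ?gt_eqF.
  move: big wlt; rewrite {1}wS -natr1; set y := n%:R / _.
  rewrite natrM natrD; have : 0 <= N0%:R :> R by []; lra.
pose G : R := log2 n%:R `^ gamma / n%:R `^ gamma.
have ng : n%:R `^ (- gamma) <= G.
  rewrite powRN /G ler_peMl ?invr_ge0 ?powR_ge0 //.
  apply: (@le_trans _ _ (1 `^ gamma)); first by rewrite powR1.
  by rewrite ge0_ler_powR ?nnegrE ?(ltW L0) // ltW.
have beN : beta ^+ N n <= G.
  apply: le_trans ng; rewrite -powR_mulrn ?(ltW be0) //.
  apply: (@le_trans _ _ (beta `^ (A * log2 n%:R))).
    by rewrite ger_powR ?be0 ?(ltW be1) // ltW // truncnS_gt.
  rewrite /powR !gt_eqF // ler_expR /A /log2.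
  rewrite le_eqVlt; apply/orP; left; apply/eqP; field.
  by rewrite (gt_eqF l2) (lt_eqF lnb).
have Nq : (N n * w <= q)%N by rewrite mulnC leq_divM.
have bq : b ^+ q <= G.
  apply: le_trans beN; apply: (@le_trans _ _ (b ^+ N n)).
    rewrite ler_wiXn2l // ?ltW //; apply: leq_trans Nq; rewrite leq_pmulr //.
    by rewrite wS.
  by rewrite lerXn2r ?nnegrE ?(ltW b0) ?(ltW be0) // le_max lexx.
have pq : surv q <= G + C * (2 * D) `^ gamma / (1 - surv 1%N) * G.
  apply: (le_trans (surv_noninc Nq)); rewrite wS.
  apply: (le_trans (surv_blocks _ _)); apply: lerD.
    apply: le_trans beN; rewrite lerXn2r ?nnegrE ?(ltW be0) //.
    by rewrite le_max p1d orbT.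
  rewrite mulrAC ler_pM2r ?invr_gt0 //.
  apply: (le_trans (haX _ _)); first by [].
  rewrite -mulrA ler_pM2l //.
  have y0 : 0 < n%:R / (2 * D * log2 n%:R).
    by rewrite divr_gt0 // mulr_gt0 // mulr_gt0.
  apply: (@le_trans _ _ ((n%:R / (2 * D * log2 n%:R)) `^ (- gamma))).
    rewrite !powRN lef_pV2 ?posrE ?powR_gt0 //; last by rewrite (lt_le_trans y0).
    by rewrite ge0_ler_powR ?nnegrE ?(ltW g0) ?(ltW y0) // (le_trans (ltW y0)).
  have D2 : 0 < 2 * D by rewrite mulr_gt0.
  have nE : n%:R `^ gamma = (n%:R / (2 * D * log2 n%:R)) `^ gamma
      * ((2 * D) `^ gamma * log2 n%:R `^ gamma).
    rewrite -powRM ?(ltW D2) ?(ltW L0) // -powRM ?(ltW y0) //; last first.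
      by rewrite mulr_ge0 // ltW.
    by rewrite divfK // gt_eqF // mulr_gt0.
  rewrite powRN /G nE; move: (powR_gt0 gamma y0) (powR_gt0 gamma D2).
  move: (powR_gt0 gamma L0) => ? ? ?.
  rewrite le_eqVlt; apply/orP; left; apply/eqP; field.
  by rewrite !gt_eqF.
rewrite -/G; apply: (le_trans (lerD bq pq)).
rewrite /C'; move: (C * _ / _) => y.
by rewrite le_eqVlt; apply/orP; left; apply/eqP; ring.
Qed.

End submultiplicative_up_to_mixing.

Section inherited_rates.
Context {R : realType}.
Variables (aX aXY surv : nat -> R) (C b : R) (s : nat).
Hypothesis aX_ge0 : forall n, 0 <= aX n.
Hypothesis surv_ge0 : forall n, 0 <= surv n.
Hypothesis surv_le1 : forall n, surv n <= 1.
Hypothesis surv_noninc : forall m n, (m <= n)%N -> surv n <= surv m.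
Hypothesis surv_decouple :
  forall a q b, surv (a + q + b)%N <= surv a * surv b + aX q.
Hypothesis surv1 : surv 1%N < 1.
Hypothesis aXY_ge0 : forall n, 0 <= aXY n.
Hypothesis C_gt0 : 0 < C.
Hypothesis b01 : 0 < b < 1.
Hypothesis s_gt0 : (0 < s)%N.
Hypothesis aXY_le : forall n,
  aXY n <= aX (n %/ s)%N + C * (b ^+ (n %/ s) + surv (n %/ s)%N).

Lemma le_divn_natr (n : nat) : (s <= n)%N ->
  n%:R / (2 * s%:R) <= (n %/ s)%:R :> R.
Proof.
move=> sn; rewrite ler_pdivrMr ?mulr_gt0 ?ltr0n // mulrC.
by rewrite -!natrM ler_nat leq_double_divn // s_gt0.
Qed.

(** Rates of the form exp(- c v n) absorb each other once the constants [c] are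
    allowed to shrink. *)
Lemma bigO_expR_min (v : nat -> R) (C1 c1 c2 c3 : R) (N : nat) :
  0 < C1 -> 0 < c1 -> 0 < c2 -> 0 < c3 ->
  (forall n, (N <= n)%N -> [/\ 0 <= v n, aX (n %/ s)%N <= C1 * expR (- c1 * v n),
     b ^+ (n %/ s) <= expR (- c2 * v n) &
     surv (n %/ s)%N <= expR (- c3 * v n)]) ->
  exists2 c : R, 0 < c & aXY =O_\oo (fun n => expR (- c * v n)).
Proof.
move=> C10 c10 c20 c30 h.
pose c := Num.min c1 (Num.min c2 c3).
exists c; first by rewrite !lt_min c10 c20 c30.
apply/bigO_natP; exists (C1 + 2 * C), N; split.
  by rewrite addr_gt0 // mulr_gt0.
move=> n /h [v0 h1 h2 h3].
rewrite !ger0_norm ?expR_ge0 //; apply: (le_trans (aXY_le n)).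
have mon c' : c <= c' -> expR (- c' * v n) <= expR (- c * v n).
  by move=> cc'; rewrite ler_expR !mulNr lerN2 ler_wpM2r.
rewrite mulrDl; apply: lerD.
  by apply: (le_trans h1); rewrite ler_pM2l // mon // ge_min lexx.
rewrite [2 * C]mulrC -mulrA ler_pM2l // mulr_natl mulr2n; apply: lerD.
  by apply: (le_trans h2); rewrite mon // !ge_min lexx orbT.
by apply: (le_trans h3); rewrite mon // !ge_min lexx !orbT.
Qed.

Lemma expr_divn_le (a v : R) (n : nat) : 0 < a < 1 -> 0 <= v -> (s <= n)%N ->
  v <= n%:R -> a ^+ (n %/ s) <= expR (- (- ln a / (2 * s%:R)) * v).
Proof.
move=> /andP[a0 a1] v0 sn vn.
rewrite -[a in leLHS]lnK ?posrE // -expRM_natl ler_expR.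
have lna : ln a < 0 by rewrite ln_lt0 // a0.
have ss : 0 < 2 * s%:R :> R by rewrite mulr_gt0 // ltr0n.
have -> : - (- ln a / (2 * s%:R)) * v = v / (2 * s%:R) * ln a.
  by field; rewrite pnatr_eq0 -lt0n.
rewrite ler_nM2r //; apply: le_trans (le_divn_natr sn).
by rewrite ler_pM2r // invr_gt0.
Qed.

(** The geometric term never matters; [surv] decides in the first regime, and
    loses a logarithm in the last one. *)
Theorem inherits_mixing_rates_of_bound : inherits_mixing_rates aX aXY.
Proof.
have [b0 b1] := andP b01.
have lnb : ln b < 0 by rewrite ln_lt0.
have ss : 0 < 2 * s%:R :> R by rewrite mulr_gt0 // ltr0n.
split.
- move=> [lam l01 /bigO_natP[C1 [N0 [C10 haX]]]].
  have [l0 l1] := andP l01.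
  have haX' n : (N0 <= n)%N -> aX n <= C1 * lam ^+ n.
    by move=> /haX; rewrite !ger0_norm // exprn_ge0 // ltW.
  have [c3 c30 h3] := surv_rate_exponential surv_ge0
    surv_noninc surv_decouple surv1 l01 C10 haX'.
  pose v n : R := n%:R / (log2 n%:R * log2 (log2 n%:R)).
  have [||||c c0 hO] := @bigO_expR_min v C1 (- ln lam / (2 * s%:R))
     (- ln b / (2 * s%:R)) (c3 / (2 * s%:R)) (maxn 4 (maxn (2 * s) (s * N0)))
     C10.
  + by rewrite divr_gt0 // oppr_gt0 ln_lt0.
  + by rewrite divr_gt0 // oppr_gt0.
  + by rewrite divr_gt0.
  + move=> n; rewrite !geq_max => /andP[n4 /andP[n2s nN0]].
    have sn : (s <= n)%N by apply: leq_trans n2s; rewrite leq_pmull.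
    have L2 : 2 <= log2 n%:R :> R by apply: (@log2_ge R n 2).
    have L0 : 0 < log2 n%:R :> R by apply: lt_le_trans L2.
    have LL1 : 1 <= log2 (log2 n%:R) :> R.
      rewrite {1}/log2 ler_pdivlMr ?ln_gt0 ?ltr1n // mul1r.
      by rewrite ler_ln ?posrE.
    have vn' : v n <= n%:R / log2 n%:R.
      have nL : 0 <= n%:R / log2 n%:R :> R by apply: divr_ge0 => //; exact: ltW.
      rewrite /v invfM mulrA ler_piMr //.
      by rewrite invf_le1 // (lt_le_trans _ LL1).
    have vn : v n <= n%:R.
      apply: (le_trans vn'); rewrite ler_piMr // invf_le1 //.
      by apply: le_trans L2; rewrite ler1n.
    have v0 : 0 <= v n.
      apply: divr_ge0 => //; apply: mulr_ge0; first exact: ltW.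
      exact: le_trans LL1.
    split => //.
    * apply: (le_trans (haX' _ _)); first by rewrite leq_divRL // mulnC.
      by rewrite ler_pM2l // expr_divn_le.
    * exact: expr_divn_le.
    * have q2 : (2 <= n %/ s)%N by rewrite leq_divRL.
      apply: (le_trans (h3 _ q2)); rewrite ler_expR !mulNr lerN2.
      rewrite -mulrA ler_pM2l // mulrC.
      apply: (@le_trans _ _ (n%:R / (2 * s%:R) / log2 n%:R)).
        by rewrite [leRHS]mulrAC ler_pM2r ?invr_gt0.
      have Lq : 0 < log2 (n %/ s)%:R :> R.
        by apply: lt_le_trans (@log2_ge R _ 1 _).
      apply: ler_pM; [|by rewrite invr_ge0 ltW|exact: le_divn_natr|].
        by apply: divr_ge0 => //; exact: ltW.
      rewrite lef_pV2 ?posrE // /log2 ler_pM2r ?invr_gt0 ?ln_gt0 ?ltr1n //.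
      rewrite ler_ln ?posrE ?ltr0n ?(leq_trans _ q2) ?(leq_trans _ n4) //.
      by rewrite ler_nat leq_div.
  exists (expR (- c)); first by rewrite expR_gt0 expR_lt1 oppr_lt0.
  have -> : (fun n : nat => expR (- c) `^ (n%:R / (log2 n%:R * log2 (log2 n%:R))))
    = (fun n => expR (- c * v n)) by apply/funext => n; rewrite expRM.
  exact: hO.
- move=> c gamma c0 g01 /bigO_natP[C1 [N0 [C10 haX]]].
  have [g0 g1] := andP g01.
  have haX' n : (N0 <= n)%N -> aX n <= C1 * expR (- c * n%:R `^ gamma).
    by move=> /haX; rewrite !ger0_norm // expR_ge0.
  have [c3 c30 h3] := surv_rate_subexponential surv_ge0
    surv_noninc surv_decouple surv1 c0 g01 C10 haX'.
  have sg : 0 < (2 * s%:R : R) `^ gamma by rewrite powR_gt0.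
  apply: (@bigO_expR_min (fun n => n%:R `^ gamma) C1
     (c / (2 * s%:R) `^ gamma)
     (- ln b / (2 * s%:R)) (c3 / (2 * s%:R) `^ gamma) (maxn 1 (maxn s (s * N0)))).
  + exact: C10.
  + by rewrite divr_gt0.
  + by rewrite divr_gt0 // oppr_gt0.
  + by rewrite divr_gt0.
  + move=> n; rewrite !geq_max => /andP[n1 /andP[sn nN0]].
    have vq : n%:R `^ gamma / (2 * s%:R) `^ gamma <= (n %/ s)%:R `^ gamma :> R.
      rewrite ler_pdivrMr // -powRM ?(ltW ss) //.
      rewrite ge0_ler_powR ?nnegrE ?(ltW g0) ?mulr_ge0 ?(ltW ss) //.
      by rewrite -ler_pdivrMr // le_divn_natr.
    have vn : n%:R `^ gamma <= n%:R :> R.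
      by rewrite ler1_powR ?ler1n // ltW.
    split => //.
    * apply: (le_trans (haX' _ _)); first by rewrite leq_divRL // mulnC.
      by rewrite ler_pM2l // ler_expR !mulNr lerN2 mulrAC -mulrA ler_pM2l.
    * by apply: expr_divn_le => //; exact: powR_ge0.
    * apply: (le_trans (h3 _ _)); first by rewrite divn_gt0.
      by rewrite ler_expR !mulNr lerN2 mulrAC -mulrA ler_pM2l.
- move=> gamma g0 /bigO_natP[C1 [N0 [C10 haX]]].
  have haX' n : (N0 <= n)%N -> aX n <= C1 * n%:R `^ (- gamma).
    by move=> /haX; rewrite !ger0_norm // powR_ge0.
  have [C' [N [C'0 h]]] := surv_rate_polynomial aX_ge0 surv_ge0 surv_le1
    surv_noninc surv_decouple surv1 g0 C10 b01 s_gt0 haX'.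
  have sg : 0 < (2 * s%:R : R) `^ gamma by rewrite powR_gt0.
  apply/bigO_natP; exists (C1 * (2 * s%:R) `^ gamma + C * C').
  exists (maxn N (maxn 2 (maxn s (s * N0)))); split.
    by rewrite addr_gt0 ?mulr_gt0.
  move=> n; rewrite !geq_max => /andP[nN /andP[n2 /andP[sn nN0]]].
  have L1 : 1 <= log2 n%:R :> R by apply: (@log2_ge R n 1).
  have n0 : 0 < n%:R :> R by rewrite ltr0n ltnW.
  rewrite !ger0_norm ?divr_ge0 ?powR_ge0 //.
  apply: (le_trans (aXY_le n)); rewrite mulrDl; apply: lerD; last first.
    by rewrite -mulrA ler_pM2l //; exact: h.
  apply: (le_trans (haX' _ _)); first by rewrite leq_divRL // mulnC.
  rewrite -mulrA ler_pM2l //.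
  have q0 : 0 < (n %/ s)%:R :> R by rewrite ltr0n divn_gt0.
  apply: (@le_trans _ _ ((2 * s%:R) `^ gamma / n%:R `^ gamma)).
    rewrite powRN -[leRHS]invrK lef_pV2 ?posrE ?invr_gt0 ?divr_gt0 ?powR_gt0 //.
    rewrite invfM invrK mulrC ler_pdivrMr // -powRM ?(ltW ss) //.
    rewrite ge0_ler_powR ?nnegrE ?(ltW g0) ?mulr_ge0 ?(ltW ss) ?(ltW n0) //.
    by rewrite -ler_pdivrMr // le_divn_natr.
  rewrite ler_pM2l // ler_peMl ?invr_ge0 ?powR_ge0 //.
  apply: (@le_trans _ _ (1 `^ gamma)); first by rewrite powR1.
  by rewrite ge0_ler_powR ?nnegrE ?(ltW g0) // (le_trans _ L1).
Qed.

End inherited_rates.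

(** * Sigma-fields, path spaces and independence *)

Section sub_sigma_algebras.
Context {T : pointedType}.
Implicit Types G H : set_system T.

Definition measurable_wrt d' (U : measurableType d') G (f : T -> U) :=
  forall B, measurable B -> G (f @^-1` B).

Lemma measurable_wrtP d' (U : measurableType d') G (f : T -> U) :
  sigma_algebra setT G ->
  measurable_wrt G f <-> measurable_fun [set: g_sigma_algebraType G] f.
Proof.
move=> sG; split=> [h _ B mB|h B mB].
  by rewrite setTI; apply: sub_sigma_algebra; exact: h.
have := h measurableT B mB.
by rewrite setTI measurable_g_measurableTypeE.
Qed.

Lemma measurable_wrt_comp d' (U : measurableType d') d2 (V : measurableType d2)
    G (f : T -> U) (g : U -> V) :
  measurable_fun setT g -> measurable_wrt G f -> measurable_wrt G (g \o f).
Proof.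
move=> mg mf B mB; rewrite comp_preimage; apply: mf.
by rewrite -[X in measurable X]setTI; exact: mg.
Qed.

Lemma measurable_wrt_pair d' (U : measurableType d') d2 (V : measurableType d2)
    G (f : T -> U) (g : T -> V) : sigma_algebra setT G ->
  measurable_wrt G f -> measurable_wrt G g ->
  measurable_wrt G (fun w => (f w, g w)).
Proof.
move=> sG /(measurable_wrtP _ sG) mf /(measurable_wrtP _ sG) mg.
by apply/(measurable_wrtP _ sG); exact: measurable_fun_pair.
Qed.

Lemma measurable_wrtS d' (U : measurableType d') G H (f : T -> U) :
  G `<=` H -> measurable_wrt G f -> measurable_wrt H f.
Proof. by move=> GH mf B mB; apply: GH; exact: mf. Qed.

Lemma sigma_algebraT G : sigma_algebra setT G -> G setT.
Proof. by move=> [G0 GC _]; rewrite -(setD0 setT); exact: GC. Qed.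

Lemma sigma_algebraI G A B : sigma_algebra setT G -> G A -> G B -> G (A `&` B).
Proof.
move=> sG; rewrite -(measurable_g_measurableTypeE sG) => GA GB.
exact: measurableI.
Qed.

Definition sigma_join G H : set_system T := <<s G `|` H >>.

Lemma sigma_joinl G H : G `<=` sigma_join G H.
Proof. by move=> A GA; apply: sub_sigma_algebra; left. Qed.

Lemma sigma_joinr G H : H `<=` sigma_join G H.
Proof. by move=> A GA; apply: sub_sigma_algebra; right. Qed.

Lemma sigma_algebra_join G H : sigma_algebra setT (sigma_join G H).
Proof. exact: smallest_sigma_algebra. Qed.

Lemma sub_join G H K : sigma_algebra setT K ->
  G `<=` K -> H `<=` K -> sigma_join G H `<=` K.
Proof. by move=> sK GK HK; apply: smallest_sub => // A [/GK|/HK]. Qed.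

(** The intersections form a pi-system, which is what the uniqueness of measures
    asks for. *)
Lemma sigma_joinE G H : sigma_algebra setT G -> sigma_algebra setT H ->
  sigma_join G H = <<s [set A `&` B | A in G & B in H] >>.
Proof.
move=> sG sH; apply/seteqP; split.
  apply: sub_join; first exact: smallest_sigma_algebra.
    move=> A GA; apply: sub_sigma_algebra; exists A => //; exists setT.
      exact: sigma_algebraT.
    by rewrite setIT.
  move=> A GA; apply: sub_sigma_algebra; exists setT.
    exact: sigma_algebraT.
  by exists A => //; rewrite setTI.
apply: smallest_sub; first exact: sigma_algebra_join.
move=> _ [A GA [B HB <-]]; apply: (sigma_algebraI (sigma_algebra_join G H)).
- exact: sigma_joinl.
- exact: sigma_joinr.
Qed.

End sub_sigma_algebras.

Section sigma_of_theory.
Context {d d' : measure_display} {T : measurableType d} {U : measurableType d'}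
  {I : Type}.
Implicit Types (Z : I -> T -> U) (J : set I).

Lemma sigma_algebra_sigma_of Z J : sigma_algebra setT (sigma_of Z J).
Proof. exact: smallest_sigma_algebra. Qed.

Lemma sigma_of_wrt Z J i : J i -> measurable_wrt (sigma_of Z J) (Z i).
Proof.
move=> Ji B mB; apply: sub_sigma_algebra; exists i => //.
by exists B => //; rewrite setTI.
Qed.

Lemma sigma_of_sub Z J (H : set_system T) : sigma_algebra setT H ->
  (forall i, J i -> measurable_wrt H (Z i)) -> sigma_of Z J `<=` H.
Proof.
move=> sH hZ; apply: smallest_sub => // A [i Ji [B mB <-]].
by rewrite setTI; exact: hZ.
Qed.

Lemma sigma_ofS Z J J' : J `<=` J' -> sigma_of Z J `<=` sigma_of Z J'.
Proof.
move=> JJ'; apply: sigma_of_sub; first exact: sigma_algebra_sigma_of.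
by move=> i /JJ'; exact: sigma_of_wrt.
Qed.

Lemma sigma_of_measurable Z J : (forall i, measurable_fun setT (Z i)) ->
  sigma_of Z J `<=` measurable.
Proof.
move=> mZ; apply: sigma_of_sub; first exact: sigma_algebra_measurable.
by move=> i _ B mB; rewrite -[X in measurable X]setTI; exact: mZ.
Qed.

End sigma_of_theory.

Section path_space.
Context {I : Type} {d : measure_display} {U : measurableType d}.

Definition coordinate_sets : set_system (I -> U) :=
  \bigcup_i g_sigma_algebra_preimage (fun x : I -> U => x i).

(** A process is one random variable with values in its space of paths, so that
    the events of [sigma_of Z J] become preimages of sets of paths. *)
Definition pathType := g_sigma_algebraType coordinate_sets.

HB.instance Definition _ := Measurable.on pathType.

Definition coord (i : I) : pathType -> U := fun x => x i.

Lemma measurable_coord i : measurable_fun setT (coord i).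
Proof.
move=> _ B mB; rewrite setTI; apply: sub_sigma_algebra.
by exists i => //; exists B => //; rewrite setTI.
Qed.

Lemma measurable_pathP d' (T : measurableType d') (Z : T -> pathType) :
  (forall i, measurable_fun setT (fun w => Z w i)) -> measurable_fun setT Z.
Proof.
move=> mZ; apply: (@measurability _ _ T pathType setT Z coordinate_sets) => //.
move=> _ [_ [i _ [B mB <-]] <-].
by rewrite !setTI; have := mZ i measurableT B mB; rewrite setTI.
Qed.

End path_space.
Arguments pathType I {d} U.

Section path_events.
Context {d d' : measure_display} {T : measurableType d} {U : measurableType d'}
  {I : Type}.
Implicit Types (Z : I -> T -> U) (J : set I).

Definition path_of Z : T -> pathType I U := fun w i => Z i w.

Lemma sigma_of_preimage Z J A : sigma_of Z J A ->
  exists2 S, sigma_of (coord (U:=U)) J S & A = path_of Z @^-1` S.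
Proof.
suff : sigma_of Z J `<=`
    preimage_set_system setT (path_of Z) (sigma_of (coord (U:=U)) J).
  by move=> h /h[S hS <-]; exists S => //; rewrite setTI.
apply: sigma_of_sub.
  exact/sigma_algebra_preimage/sigma_algebra_sigma_of.
move=> i Ji B mB; exists (coord i @^-1` B); last by rewrite setTI.
exact: sigma_of_wrt.
Qed.

Lemma preimage_sigma_of Z J S : sigma_of (coord (U:=U)) J S ->
  sigma_of Z J (path_of Z @^-1` S).
Proof.
move: S; suff : sigma_of (coord (U:=U)) J `<=`
    image_set_system setT (path_of Z) (sigma_of Z J).
  by move=> h S /h; rewrite /image_set_system /= setTI.
apply: sigma_of_sub.
  exact/sigma_algebra_image/sigma_algebra_sigma_of.
move=> i Ji B mB; rewrite /image_set_system /= setTI.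
exact: (@sigma_of_wrt _ _ _ _ _ Z J i Ji B mB).
Qed.

Lemma sigma_of_coord_measurable J : sigma_of (coord (U:=U)) J `<=` measurable.
Proof. by apply: sigma_of_measurable => i; exact: measurable_coord. Qed.

End path_events.

Section independence.
Context {d : measure_display} {T : measurableType d} {R : realType}.
Variable P : probability T R.
Implicit Types G H K : set_system T.

Lemma independentC G H : independent_systems P G H -> independent_systems P H G.
Proof. by move=> GH A B HA GB; rewrite setIC muleC; exact: GH. Qed.

Lemma independentS G H G' H' : G' `<=` G -> H' `<=` H ->
  independent_systems P G H -> independent_systems P G' H'.
Proof. by move=> GG' HH' GH A B /GG' GA /HH' HB; exact: GH. Qed.

(** Both sides are finite measures in [A], so a pi-system suffices. *)
Lemma independent_generated (C : set_system T) H :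
  setI_closed C -> C setT -> C `<=` measurable -> H `<=` measurable ->
  independent_systems P C H -> independent_systems P <<s C >> H.
Proof.
move=> CI CT Cm Hm CH A B sA HB.
have mB : measurable B by exact: Hm.
have PB0 : 0 <= fine (P B) by rewrite fine_ge0.
pose m1 : {measure set T -> \bar R} := mrestr P mB.
pose m2 : {measure set T -> \bar R} := mscale (NngNum PB0) P.
have m2E X : m2 X = (P X * P B)%E.
  by rewrite muleC -[in RHS](fineK (fin_num_measure P B mB)).
rewrite -m2E -[LHS]/(m1 A).
apply: (@g_sigma_algebra_measure_unique _ _ _ C Cm (fun=> setT)) => //.
- by rewrite bigcup_const //; exists 0%N.
- by move=> X CX; rewrite m2E; exact: CH.
- move=> _; rewrite /m1 /= /mrestr setTI.
  by rewrite (le_lt_trans (probability_le1 _ _)) // ltry.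
Qed.

(** On an intersection of [A] in [G] and [B] in [H], factor out [A] first and then
    [B]. *)
Lemma independent_join G H K : sigma_algebra setT G -> sigma_algebra setT H ->
  G `<=` measurable -> H `<=` measurable -> K `<=` measurable ->
  independent_systems P G (sigma_join H K) -> independent_systems P H K ->
  independent_systems P (sigma_join G H) K.
Proof.
move=> sG sH Gm Hm Km GHK HK; rewrite (sigma_joinE sG sH).
apply: independent_generated => //.
- move=> _ _ [A1 GA1 [B1 HB1 <-]] [A2 GA2 [B2 HB2 <-]].
  exists (A1 `&` A2); first exact: sigma_algebraI.
  exists (B1 `&` B2); first exact: sigma_algebraI.
  by rewrite setIACA.
- exists setT; first exact: sigma_algebraT.
  by exists setT; [exact: sigma_algebraT|rewrite setIT].
- by move=> _ [A GA [B HB <-]]; apply: measurableI; [exact: Gm|exact: Hm].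
move=> _ C [A GA [B HB <-]] KC.
have AB : P (A `&` B) = (P A * P B)%E by apply: GHK => //; exact: sigma_joinl.
rewrite -setIA GHK //; last first.
  apply: (sigma_algebraI (sigma_algebra_join H K)).
    exact: sigma_joinl.
  exact: sigma_joinr.
by rewrite HK // muleA AB.
Qed.

Section families.
Context {d' : measure_display} {U : measurableType d'} {I : eqType}.
Variable Z : I -> T -> U.
Hypothesis mZ : forall i, measurable_fun setT (Z i).

Let mpre i B : measurable B -> measurable (Z i @^-1` B).
Proof. by move=> mB; rewrite -[X in measurable X]setTI; exact: mZ. Qed.

Definition cylinders (J : set I) : set_system T :=
  [set A | exists s : seq I, exists B : I -> set U,
     [/\ uniq s, (forall i, i \in s -> J i), (forall i, measurable (B i)) &
         A = \bigcap_(i in [set` s]) Z i @^-1` B i]].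

Lemma cylindersI J : setI_closed (cylinders J).
Proof.
move=> _ _ [s1 [B1 [u1 J1 m1 ->]]] [s2 [B2 [u2 J2 m2 ->]]].
pose B i := (if i \in s1 then B1 i else setT) `&`
            (if i \in s2 then B2 i else setT).
exists (undup (s1 ++ s2)), B; split.
- exact: undup_uniq.
- by move=> i; rewrite mem_undup mem_cat => /orP[/J1|/J2].
- by move=> i; apply: measurableI; case: ifP.
apply/seteqP; split=> w /=.
  move=> [h1 h2] i /=; rewrite mem_undup mem_cat /B => hi.
  by split; case: ifP => // his; [exact: h1|exact: h2].
move=> h; split=> i /= hi.
  by have := h i; rewrite /= mem_undup mem_cat hi /B hi => /(_ isT)[].
by have := h i; rewrite /= mem_undup mem_cat hi orbT /B hi => /(_ isT)[].
Qed.

Lemma cylindersT J : cylinders J setT.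
Proof.
exists [::], (fun=> setT); split => //.
by apply/seteqP; split=> w //= _ i.
Qed.

Lemma cylinders_measurable J : cylinders J `<=` measurable.
Proof.
move=> _ [s [B [us Js mB ->]]].
by apply: fin_bigcap_measurable => // i _; exact: mpre.
Qed.

Lemma sigma_of_cylinders J : sigma_of Z J `<=` <<s cylinders J >>.
Proof.
apply: sigma_of_sub; first exact: smallest_sigma_algebra.
move=> i Ji B mB; apply: sub_sigma_algebra; exists [:: i], (fun=> B).
split => //; first by move=> j; rewrite inE => /eqP ->.
by apply/seteqP; split=> [w Bw j /=|w /(_ i)]; rewrite /= inE ?eqxx; [move/eqP->|apply].
Qed.

(** Cylinders over the two index sets are pi-systems, and on cylinders the product
    rule is that of mutual independence. *)
Lemma independent_blocks J1 J2 : mutually_independent P Z ->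
  (forall i, J1 i -> ~ J2 i) ->
  independent_systems P (sigma_of Z J1) (sigma_of Z J2).
Proof.
move=> hZ dJ.
apply: (@independentS <<s cylinders J1 >> <<s cylinders J2 >>);
  [exact: sigma_of_cylinders|exact: sigma_of_cylinders|].
have cm J : <<s cylinders J >> `<=` measurable.
  apply: smallest_sub; first exact: sigma_algebra_measurable.
  exact: cylinders_measurable.
apply: independent_generated (cylindersI (J:=J1)) (cylindersT J1)
  (@cylinders_measurable J1) (cm J2) _.
apply: independentC.
apply: independent_generated (cylindersI (J:=J2)) (cylindersT J2)
  (@cylinders_measurable J2) (@cylinders_measurable J1) _.
apply: independentC.
move=> _ _ [s1 [B1 [u1 h1 m1 ->]]] [s2 [B2 [u2 h2 m2 ->]]].
have s12 i : i \in s1 -> i \in s2 -> False by move=> /h1 /dJ + /h2.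
pose B i := if i \in s1 then B1 i else B2 i.
have mB i : measurable (B i) by rewrite /B; case: ifP.
have us : uniq (s1 ++ s2).
  rewrite cat_uniq u1 u2 andbT /=; apply/hasPn => i i2.
  by apply/negP => i1; exact: (s12 i).
have -> : (\bigcap_(i in [set` s1]) Z i @^-1` B1 i) `&`
          (\bigcap_(i in [set` s2]) Z i @^-1` B2 i)
    = \bigcap_(i in [set` s1 ++ s2]) Z i @^-1` B i.
  apply/seteqP; split=> w /=.
    move=> [w1 w2] i /=; rewrite /B mem_cat; case: ifP => [i1 _|_ /= i2].
      exact: w1.
    exact: w2.
  move=> h; split=> i /= hi.
    by have := h i; rewrite /= mem_cat hi /B hi; apply.
  have := h i; rewrite /= mem_cat hi orbT /B.
  by case: ifP => [/s12/(_ hi)//|_]; apply.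
rewrite !hZ // big_cat /=; congr (_ * _)%E; apply: eq_big_seq => i hi.
  by rewrite /B hi.
by rewrite /B; case: ifP => // /s12/(_ hi).
Qed.

End families.

End independence.

(** * Freezing an independent variable; covariances under mixing *)

Section bounded_integrals.
Context {d : measure_display} {T : measurableType d} {R : realType}.
Variable P : probability T R.
Implicit Types f g : T -> R.

Lemma bounded_integrable f c : measurable_fun setT f ->
  (forall w, `|f w| <= c) -> P.-integrable setT (EFin \o f).
Proof.
move=> mf fc; apply: measurable_bounded_integrable => //.
  by rewrite (le_lt_trans (probability_le1 _ _)) // ltry.
exists c; split; first exact: num_real.
by move=> x cx w _; apply: (le_trans (fc w)); exact: ltW.
Qed.

Lemma bounded_integrable_on A f c : measurable A -> measurable_fun setT f ->
  (forall w, `|f w| <= c) -> P.-integrable A (EFin \o f).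
Proof.
move=> mA mf fc; apply: (@integrableS _ _ _ _ setT) => //.
exact: bounded_integrable fc.
Qed.

Lemma unit_norm_le1 (x : R) : 0 <= x <= 1 -> `|x| <= 1.
Proof. by move=> /andP[x0 x1]; rewrite ger0_norm. Qed.

Lemma Rintegral_indicE A : measurable A -> \int[P]_w \1_A w = fine (P A).
Proof. by move=> mA; rewrite /Rintegral integral_indic // setIT. Qed.

Lemma Rintegral_on_indic A f : measurable A -> measurable_fun setT f ->
  \int[P]_(w in A) f w = \int[P]_w (\1_A w * f w).
Proof.
move=> mA mf; rewrite Rintegral_mkcond; apply: eq_Rintegral => w _.
by rewrite patchE indicE; case: ifP => _; rewrite ?mul1r ?mul0r.
Qed.

Lemma Rintegral_prob_cst c : \int[P]_w c = c.
Proof.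
transitivity (c * fine (P setT)); first exact: Rintegral_cst.
by rewrite probability_setT mulr1.
Qed.

Lemma Rintegral_le_cst f c : measurable_fun setT f ->
  (forall w, `|f w| <= c) -> `|\int[P]_w f w| <= c.
Proof.
move=> mf fc; apply: (le_trans (le_normr_Rintegral _ _)) => //.
  exact: bounded_integrable fc.
apply: (@le_trans _ _ (\int[P]_w c)).
  apply: le_Rintegral => //.
    apply: (@bounded_integrable _ c); last by move=> w; rewrite normr_id.
    exact: measurableT_comp.
  by apply: (@bounded_integrable _ `|c|).
by rewrite Rintegral_prob_cst.
Qed.

Lemma fine_prob_unit (A : set T) : measurable A -> 0 <= fine (P A) <= 1.
Proof.
move=> mA; rewrite fine_ge0 //= -(@fine1 R) fine_le ?fin_num_measure //.
exact: probability_le1.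
Qed.

End bounded_integrals.

Section fubini_probability.
Context {d1 d2 : measure_display} {T1 : measurableType d1}
  {T2 : measurableType d2} {R : realType}.
Variables (P : probability T1 R) (Q : probability T2 R).

Lemma bounded_Fubini (F : T1 * T2 -> R) (c : R) : measurable_fun setT F ->
  (forall z, `|F z| <= c) ->
  \int[P]_x \int[Q]_y F (x, y) = \int[Q]_y \int[P]_x F (x, y).
Proof.
move=> mF Fc.
have iF : (P \x Q)%E.-integrable setT (EFin \o F).
  exact: (@bounded_integrable _ _ _ (P \x Q)%E F c).
have E1 x : (\int[Q]_y F (x, y))%:E = (\int[Q]_y (F (x, y))%:E)%E.
  rewrite /Rintegral fineK // integrable_fin_num //.
  apply: (@bounded_integrable _ _ _ Q (fun y => F (x, y)) c) => //.
  exact: measurableT_comp mF (pair1_measurable x).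
have E2 y : (\int[P]_x F (x, y))%:E = (\int[P]_x (F (x, y))%:E)%E.
  rewrite /Rintegral fineK // integrable_fin_num //.
  apply: (@bounded_integrable _ _ _ P (fun x => F (x, y)) c) => //.
  exact: measurableT_comp mF (pair2_measurable y).
rewrite {1}/Rintegral; under eq_integral do rewrite E1.
rewrite (Fubini iF) {2}/Rintegral; congr fine.
by apply: eq_integral => y _; rewrite E2.
Qed.

End fubini_probability.

Section freezing.
Context {d d1 d2 : measure_display} {T : measurableType d}
  {S1 : measurableType d1} {S2 : measurableType d2} {R : realType}.
Variable P : probability T R.

(** Independence in the form in which it is used: of two independent variables,
    one may be frozen while the other is averaged out. *)
Lemma freezing (U : T -> S1) (V : T -> S2) (S : set (S1 * S2)) :
  measurable_fun setT U -> measurable_fun setT V ->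
  (forall A B, measurable A -> measurable B ->
     P (U @^-1` A `&` V @^-1` B) = (P (U @^-1` A) * P (V @^-1` B))%E) ->
  measurable S ->
  P [set w | S (U w, V w)] = (\int[P]_w P [set w' | S (U w, V w')])%E.
Proof.
move=> mU mV UV mS.
pose U' : {mfun T >-> S1} := mfun_Sub (mem_set mU).
pose V' : {mfun T >-> S2} := mfun_Sub (mem_set mV).
have mUV : measurable_fun setT (fun w => (U w, V w)).
  exact: measurable_fun_pair.
pose UV' : {mfun T >-> (S1 * S2)%type} := mfun_Sub (mem_set mUV).
have E : (distribution P U' \x distribution P V')%E S = distribution P UV' S.
  by apply: product_measure_unique => // A B mA mB; exact: UV.
rewrite -[LHS]/(distribution P UV' S) -E.
rewrite [LHS]/product_measure1.
rewrite ge0_integral_distribution //.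
  apply: eq_integral => w _ /=.
  rewrite /distribution /pushforward /=; congr (P _).
  by apply/seteqP; split=> w' /=; rewrite /xsection /= inE.
exact: measurable_fun_xsection.
Qed.

Lemma measurable_freezing (V : T -> S2) (S : set (S1 * S2)) :
  measurable_fun setT V -> measurable S ->
  measurable_fun setT (fun x => fine (P [set w' | S (x, V w')])).
Proof.
move=> mV mS.
pose V' : {mfun T >-> S2} := mfun_Sub (mem_set mV).
pose g x : \bar R := P [set w' | S (x, V w')].
have mP : measurable_fun setT g.
  have := measurable_fun_xsection (distribution P V') mS.
  congr measurable_fun; apply/funext => x /=.
  rewrite /distribution /pushforward /=; congr (P _).
  by apply/seteqP; split=> w' /=; rewrite /xsection /= inE.
exact: (measurableT_comp (fine_measurable measurableT) mP).
Qed.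

End freezing.

Section uniform_layers.
Context {R : realType}.

(** Writing a number of the unit interval as an integral against a probability
    makes the layer-cake formula a case of the Fubini theorem. *)
Lemma uniform_layer (c : R) : 0 <= c <= 1 ->
  \int[uniform_prob (@ltr01 R)]_s \1_[set s : R | s < c] s = c.
Proof.
move=> /andP[c0 c1].
have mc : measurable [set s : R | s < c].
  by rewrite -set_itvNyo; exact: measurable_itv.
rewrite /Rintegral integral_uniform //=; last first.
  by apply/measurable_EFinP; exact: measurable_indic.
rewrite subr0 invr1 mul1e.
rewrite integral_indic //.
have -> : [set s : R | s < c] `&` [set` `[0 : R, 1]] = [set` `[0, c[].
  apply/seteqP; split=> s /=; rewrite !in_itv /=.
    by move=> [-> /andP[-> _]].
  by move=> /andP[s0 sc]; rewrite s0 sc (ltW (lt_le_trans sc c1)).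
rewrite /= lebesgue_measure_itv /= lte_fin; move: c0; rewrite le_eqVlt.
by move=> /predU1P[<-|c0]; rewrite ?ltxx // c0 /= subr0.
Qed.

End uniform_layers.

Section dependence.
Context {d : measure_display} {T : measurableType d} {R : realType}.
Variable P : probability T R.
Implicit Types G H : set_system T.

(** [G] and [H] have strong mixing coefficient at most [a]. *)
Definition dependence_le G H (a : R) := forall A B, G A -> H B ->
  `|fine (P (A `&` B)) - fine (P A) * fine (P B)| <= a.

Lemma dependence_leC G H a : dependence_le G H a -> dependence_le H G a.
Proof. by move=> GH A B HA GB; rewrite setIC mulrC; exact: GH. Qed.

Lemma dependence_leS G H G' H' a : G' `<=` G -> H' `<=` H ->
  dependence_le G H a -> dependence_le G' H' a.
Proof. by move=> GG' HH' GH A B /GG' GA /HH' HB; exact: GH. Qed.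

Lemma dependence_leW G H a b : a <= b -> dependence_le G H a -> dependence_le G H b.
Proof. by move=> ab GH A B GA HB; apply: le_trans ab; exact: GH. Qed.

Lemma measurable_wrt_measurable d' (U : measurableType d') G (f : T -> U) :
  G `<=` measurable -> measurable_wrt G f -> measurable_fun setT f.
Proof. by move=> Gm mf _ B mB; rewrite setTI; apply: Gm; exact: mf. Qed.

(** Layer-cake formula: a [0,1]-valued function is an average of the indicators
    of its superlevel sets. *)
Lemma layer_cake_bound G (h phi : T -> R) (c a : R) :
  sigma_algebra setT G -> G `<=` measurable ->
  measurable_fun setT h -> (forall w, `|h w| <= c) ->
  measurable_wrt G phi -> (forall w, 0 <= phi w <= 1) ->
  (forall A, G A -> `|\int[P]_(w in A) h w| <= a) ->
  `|\int[P]_w (h w * phi w)| <= a.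
Proof.
move=> sG Gm mh hc mphi phi01 hA.
have mphi' := measurable_wrt_measurable Gm mphi.
pose Q := uniform_prob (@ltr01 R).
pose S : set (T * R) := [set z | z.2 < phi z.1].
have mS : measurable S.
  have := @measurable_fun_ltr _ _ _ setT (fun z : T * R => z.2)
    (fun z => phi z.1) measurable_snd
    (measurableT_comp mphi' measurable_fst) measurableT [set true].
  by rewrite setTI; apply.
pose F (z : T * R) := h z.1 * \1_S z.
have mF : measurable_fun setT F.
  apply: measurable_funM; first exact: (measurableT_comp mh measurable_fst).
  exact: measurable_indic.
have Fc z : `|F z| <= c.
  rewrite /F indicE; case: (_ \in _); first by rewrite mulr1.
  by rewrite mulr0 normr0 (le_trans _ (hc z.1)).
have E1 w : \int[Q]_s F (w, s) = h w * phi w.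
  rewrite -[in RHS](uniform_layer (phi01 w)).
  rewrite -RintegralZl //.
  apply: (@bounded_integrable _ _ _ Q _ 1).
    by apply: measurable_indic; rewrite -set_itvNyo; exact: measurable_itv.
  by move=> s; rewrite indicE ger0_norm //; case: (_ \in _).
under eq_Rintegral do rewrite -E1.
rewrite (bounded_Fubini P Q mF Fc); apply: Rintegral_le_cst.
  have iF : (P \x Q)%E.-integrable setT (EFin \o F).
    exact: (@bounded_integrable _ _ _ (P \x Q)%E F c).
  have := measurable_fubini_G iF.
  by move=> mm; exact: (measurableT_comp (fine_measurable measurableT) mm).
move=> s.
have GA : G [set w | s < phi w].
  have -> : [set w | s < phi w] = phi @^-1` `]s, +oo[%classic.
    by apply/seteqP; split=> w /=; rewrite in_itv /= andbT.
  by apply: mphi; exact: measurable_itv.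
rewrite -[X in `|X|](_ : \int[P]_(w in [set w | s < phi w]) h w = _) ?hA //.
rewrite Rintegral_on_indic //; last exact: Gm.
by apply: eq_Rintegral => w _; rewrite /F mulrC /= !indicE.
Qed.

(** Layer-cake formula against the centred indicator of [C]. *)
Lemma dependence_event_function G H a (C : set T) (phi : T -> R) :
  sigma_algebra setT G -> G `<=` measurable -> H `<=` measurable ->
  dependence_le G H a -> H C ->
  measurable_wrt G phi -> (forall w, 0 <= phi w <= 1) ->
  `|\int[P]_(w in C) phi w - fine (P C) * \int[P]_w phi w| <= a.
Proof.
move=> sG Gm Hm GH HC mphi phi01.
have mC : measurable C by exact: Hm.
have mphi' := measurable_wrt_measurable Gm mphi.
have phic w : `|phi w| <= 1 by exact: unit_norm_le1.
have /andP[PC0 PC1] := fine_prob_unit P mC.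
pose h w : R := \1_C w - fine (P C).
have mh : measurable_fun setT h.
  by apply: measurable_funB => //; exact: measurable_indic.
have hc w : `|h w| <= 2.
  apply: (le_trans (ler_normB _ _)); rewrite ger0_norm // ger0_norm //.
  by rewrite -[leRHS]/(1 + 1) lerD // indicE; case: (_ \in _).
have -> : \int[P]_(w in C) phi w - fine (P C) * \int[P]_w phi w
    = \int[P]_w (h w * phi w).
  rewrite Rintegral_on_indic // -RintegralZl //; last first.
    exact: bounded_integrable phic.
  rewrite -RintegralB //; first by apply: eq_Rintegral => w _; rewrite /h mulrBl.
    apply: (@bounded_integrable _ _ _ P _ 1).
      by apply: measurable_funM => //; exact: measurable_indic.
    move=> w; rewrite normrM -[leRHS]mulr1 ler_pM // indicE.
    by case: (_ \in _); rewrite ?normr1 ?normr0.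
  apply: (@bounded_integrable _ _ _ P _ 1).
    exact: measurable_funM.
  by move=> w; rewrite normrM -[leRHS]mulr1 ler_pM // ger0_norm.
apply: (layer_cake_bound sG Gm mh hc mphi phi01) => A GA.
have mA : measurable A by exact: Gm.
rewrite Rintegral_on_indic //.
have -> : \int[P]_w (\1_A w * h w) =
    fine (P (A `&` C)) - fine (P A) * fine (P C); last exact: GH.
rewrite -Rintegral_indicE; last exact: measurableI.
rewrite -[fine (P A)]Rintegral_indicE // mulrC -RintegralZl //; last first.
  by apply: integrable_indic => //; rewrite (le_lt_trans (probability_le1 _ _)) // ltry.
rewrite -RintegralB //.
- apply: eq_Rintegral => w _; rewrite /h mulrBr [fine _ * _]mulrC; congr (_ - _).
  by rewrite indicI.
- by apply: integrable_indic => //; exact: measurableI.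
- apply: (@bounded_integrable _ _ _ P _ 1).
    by apply: measurable_funM => //; exact: measurable_indic.
  by move=> w; rewrite normrM -[leRHS]mulr1 ler_pM // ?ger0_norm // indicE.
Qed.

(** Layer-cake formula once more, now against the centred [phi]. *)
Lemma dependence_functions G H a (phi psi : T -> R) :
  sigma_algebra setT G -> sigma_algebra setT H ->
  G `<=` measurable -> H `<=` measurable -> dependence_le G H a ->
  measurable_wrt G phi -> (forall w, 0 <= phi w <= 1) ->
  measurable_wrt H psi -> (forall w, 0 <= psi w <= 1) ->
  `|\int[P]_w (phi w * psi w) - \int[P]_w phi w * \int[P]_w psi w| <= a.
Proof.
move=> sG sH Gm Hm GH mphi phi01 mpsi psi01.
have mphi' := measurable_wrt_measurable Gm mphi.
have mpsi' := measurable_wrt_measurable Hm mpsi.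
have phic w : `|phi w| <= 1 by exact: unit_norm_le1.
have psic w : `|psi w| <= 1 by exact: unit_norm_le1.
pose m := \int[P]_w phi w.
have mle : `|m| <= 1 by exact: Rintegral_le_cst.
pose h w : R := phi w - m.
have mh : measurable_fun setT h by exact: measurable_funB.
have hc w : `|h w| <= 2.
  by apply: (le_trans (ler_normB _ _)); rewrite -[leRHS]/(1 + 1) lerD.
have iphi : P.-integrable setT (EFin \o phi) by exact: bounded_integrable phic.
have ipsi : P.-integrable setT (EFin \o psi) by exact: bounded_integrable psic.
have -> : \int[P]_w (phi w * psi w) - \int[P]_w phi w * \int[P]_w psi w
    = \int[P]_w (h w * psi w).
  rewrite -RintegralZl // -RintegralB //.
  - by apply: eq_Rintegral => w _; rewrite /h mulrBl.
  - apply: (@bounded_integrable _ _ _ P _ 1); first exact: measurable_funM.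
    by move=> w; rewrite normrM -[leRHS]mulr1 ler_pM.
  - apply: (@bounded_integrable _ _ _ P _ 1); first exact: measurable_funM.
    by move=> w; rewrite normrM -[leRHS]mulr1 ler_pM.
apply: (layer_cake_bound sH Hm mh hc mpsi psi01) => C HC.
have mC : measurable C by exact: Hm.
rewrite (_ : \int[P]_(w in C) h w =
    \int[P]_(w in C) phi w - fine (P C) * \int[P]_w phi w).
  exact: (dependence_event_function sG Gm Hm GH).
rewrite /h RintegralB //.
- by rewrite Rintegral_cst // mulrC.
- exact: bounded_integrable_on phic.
- by apply: (@bounded_integrable_on _ _ _ _ _ _ 1).
Qed.

End dependence.

(** * One attempt at coupling *)

Lemma integrable_EFinB d (T : measurableType d) (R : realType)
    (m : {measure set T -> \bar R}) (f g : T -> R) :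
  m.-integrable setT (EFin \o f) -> m.-integrable setT (EFin \o g) ->
  m.-integrable setT (EFin \o (fun w => f w - g w)).
Proof. by move=> fi gi; exact: (integrableB measurableT fi gi). Qed.

Lemma full_measureI d (T : measurableType d) (R : realType)
    (m : {measure set T -> \bar R}) (A B : set T) : m setT = 1%E ->
  measurable A -> measurable B -> m A = 1%E -> m B = 1%E -> m (A `&` B) = 1%E.
Proof.
move=> mT mA mB A1 B1.
have mle C : measurable C -> (m C <= 1)%E.
  by move=> mC; rewrite -mT le_measure // inE.
have AC : m (~` A) = 0%E.
  have mTE : (m A + m (~` A))%E = 1%E.
    by rewrite -measureU ?setICr ?setUCr //; exact: measurableC.
  have : m (~` A) \is a fin_num.
    rewrite ge0_fin_numE ?measure_ge0 //.
    by apply: le_lt_trans (mle _ (measurableC mA)) _; rewrite ltry.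
  move: mTE; rewrite A1; case: (m (~` A)) => // s.
  by rewrite -EFinD => -[] /eqP; rewrite -subr_eq0 addrAC subrr add0r => /eqP ->.
have mAB : measurable (A `&` B) by exact: measurableI.
have mCB : measurable (~` A `&` B).
  by apply: measurableI => //; exact: measurableC.
have CB0 : m (~` A `&` B) = 0%E.
  apply/eqP; rewrite eq_le measure_ge0 andbT -AC le_measure ?inE //.
  exact: measurableC.
have BE : (A `&` B) `|` (~` A `&` B) = B by rewrite -setIUl setUCr setTI.
apply/eqP; rewrite eq_le mle //=.
apply: (@le_trans _ _ (m B)); first by rewrite B1.
apply: (@le_trans _ _ (m (A `&` B) + m (~` A `&` B))%E).
  by rewrite -[X in (m X <= _)%E]BE; exact: measureU2.
by rewrite CB0 adde0.
Qed.

Section metric_borel.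
Context {R : realType} {E : polishType R}.

Lemma mdist_triangle_le (y1 y2 z1 z2 : E) :
  mdist y1 y2 - mdist z1 z2 <= mdist y1 z1 + mdist y2 z2.
Proof.
rewrite lerBlDr; apply: (le_trans (metric_triangle y1 z1 y2)).
rewrite -addrA lerD2l addrC (metric_sym y2 z2).
exact: metric_triangle.
Qed.

Lemma closed_dball_closed (y : E) (K : R) : closed (closed_dball y K).
Proof.
have -> : closed_dball y K = ~` [set z | K < mdist y z].
  by apply/seteqP; split=> z /=; rewrite /closed_dball /= leNgt => /negP.
apply: open_closedC; rewrite openE => z /= Kz.
have dz : 0 < mdist y z - K by rewrite subr_gt0.
apply/nbhs_ballP; exists (mdist y z - K) => //= z'.
rewrite ballEmdist /= => zz'.
have := metric_triangle y z' z; rewrite (metric_sym z' z); lra.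
Qed.

Lemma measurable_closed_dball (y : E) (K : R) :
  measurable (closed_dball y K : set (borel E)).
Proof.
rewrite -[closed_dball y K]setCK; apply: measurableC.
by apply: sub_sigma_algebra; exact/closed_openC/closed_dball_closed.
Qed.

Lemma measurable_mdist (y : E) :
  measurable_fun setT (fun z : borel E => mdist y (z : E)).
Proof.
apply: (measurability _ (RGenOInfty.measurableE R)) => //.
move=> _ [_ [a ->] <-]; rewrite setTI.
have -> : (fun z : borel E => mdist y (z : E)) @^-1` `]a, +oo[%classic
    = ~` closed_dball y a.
  by apply/seteqP; split=> z /=; rewrite in_itv /= andbT ltNge => /negP.
by apply: measurableC; exact: measurable_closed_dball.
Qed.

End metric_borel.

Section one_step.
Context {d : measure_display} {T : measurableType d} {R : realType}
  {P : probability T R} {E F : polishType R} {p : nat}.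
Variable f : borel E * borel F * borel 'rV[R]_p -> borel E.
Hypothesis mf : measurable_fun setT f.
Variables (r rho K : R).
Hypotheses (r_gt0 : 0 < r) (rho01 : 0 < rho < 1) (K_gt0 : 0 < K).
Hypothesis hA : contractive_modulo_constant f rho r.
Variables (nu : R.-pker (borel F * (borel E * borel E)) ~> borel E)
  (eta : borel F -> R).
Hypothesis eta01 : forall x, 0 < eta x <= 1.

(** Two points can be coupled when at distance at most [capture_radius], and their
    images under a common move stay at that distance. If one of the images falls
    into the intersection of the two balls of radius [K], whose diameter is at
    most [2 * K], the outcomes to be compared are within [failure_radius] of each
    other. *)
Definition capture_radius := 2 * r / (1 - rho).
Definition failure_radius := 2 * K + 2 * capture_radius.

Lemma capture_radius_gt0 : 0 < capture_radius.
Proof.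
have /andP[_ rho1] := rho01.
by rewrite /capture_radius divr_gt0 ?mulr_gt0 // subr_gt0.
Qed.

Lemma capture_radius_le_failure_radius : capture_radius <= failure_radius.
Proof.
rewrite /failure_radius; move: K_gt0 capture_radius_gt0.
by move: capture_radius => c; lra.
Qed.

Lemma capture_radius_stable (y1 y2 : E) (x : F) (e : 'rV[R]_p) :
  mdist y1 y2 <= capture_radius ->
  mdist (f (y1, x, e) : E) (f (y2, x, e) : E) <= capture_radius.
Proof.
have /andP[rho0 rho1] := rho01.
move=> h; apply: (le_trans (hA _ _ _ _)).
have E1 : capture_radius * (1 - rho) = 2 * r.
  by rewrite /capture_radius divfK // gt_eqF // subr_gt0.
have : rho * mdist y1 y2 <= rho * capture_radius by rewrite ler_pM2l.
move: r_gt0 E1; move: capture_radius (mdist y1 y2) => c m.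
by lra.
Qed.

Section law_of_the_noise.
Variable e : T -> borel 'rV[R]_p.
Hypothesis me : measurable_fun setT e.

Lemma measurable_move (y : borel E) (x : borel F) :
  measurable_fun setT (fun w => f (y, x, e w)).
Proof.
apply: (measurableT_comp mf); apply: measurable_fun_pair => //.
Qed.

Lemma minorized_same_law (eps0 : T -> borel 'rV[R]_p) :
  (forall B, measurable B -> P (e @^-1` B) = P (eps0 @^-1` B)) ->
  minorized_within_bounded_distance P f rho r eps0 nu eta K ->
  minorized_within_bounded_distance P f rho r e nu eta K.
Proof.
move=> he hB y1 y2 y12 x; have [h1 h2] := hB y1 y2 y12 x; split=> // A mA.
have E1 (y : borel E) : P [set w | A (f (y, x, e w))]
    = P [set w | A (f (y, x, eps0 w))].
  apply: (he [set v | A (f (y, x, v))]).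
  have : measurable_fun setT (fun v : borel 'rV[R]_p => f (y, x, v)).
    by apply: (measurableT_comp mf); apply: measurable_fun_pair.
  by move=> /(_ measurableT A mA); rewrite setTI.
by rewrite !E1; exact: h1.
Qed.

Hypothesis hB : minorized_within_bounded_distance P f rho r e nu eta K.

Lemma minorized_integral (y1 y2 : E) (x : F) (u : borel E -> R) (c : R) :
  0 < mdist y1 y2 <= capture_radius ->
  measurable_fun setT u -> (forall z, 0 <= u z <= c) ->
  eta x * \int[nu (x, (y1, y2))]_z u z <= \int[P]_w u (f (y1, x, e w)) /\
  eta x * \int[nu (x, (y1, y2))]_z u z <= \int[P]_w u (f (y2, x, e w)).
Proof.
move=> y12 mu u0; have [hnu _] := hB y12 x.
have /andP[eta0 _] := eta01 x.
have uc z : `|u z| <= c by have /andP[? ?] := u0 z; rewrite ger0_norm.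
have iu : (nu (x, (y1, y2))).-integrable setT (EFin \o u).
  apply: measurable_bounded_integrable => //; first by rewrite prob_kernel ltry.
  exists c; split; first exact: num_real.
  by move=> b cb z _; apply: (le_trans (uc z)); exact: ltW.
pose g y : {mfun T >-> borel E} := mfun_Sub (mem_set (measurable_move y x)).
have dom y : (forall A, measurable A -> ((eta x)%:E * nu (x, (y1, y2)) A <=
      P [set w | A (f (y, x, e w))])%E) ->
    eta x * \int[nu (x, (y1, y2))]_z u z <= \int[P]_w u (f (y, x, e w)).
  move=> hy.
  pose m1 : {measure set (borel E) -> \bar R} :=
    mscale (NngNum (ltW eta0)) (nu (x, (y1, y2))).
  have := @ge0_le_measure_integral _ _ _ m1 (distribution P (g y)) hy
    (EFin \o u) setT measurableT.
  have u0' z : (0 <= (EFin \o u) z)%E by rewrite lee_fin; have /andP[] := u0 z.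
  have mu' : measurable_fun setT (EFin \o u) by exact/measurable_EFinP.
  move=> /(_ u0' mu').
  rewrite ge0_integral_distribution // ge0_integral_mscale //=.
  have iP : P.-integrable setT (EFin \o (fun w => u (f (y, x, e w)))).
    apply: (@bounded_integrable _ _ _ P (fun w => u (f (y, x, e w))) c) => //.
    exact: (measurableT_comp mu (measurable_move y x)).
  move=> h; rewrite -lee_fin EFinM /Rintegral !fineK //.
  - exact: integrable_fin_num.
  - exact: integrable_fin_num.
  - by move=> z _; exact: u0'.
by split; apply: dom => A mA; have [] := hnu A mA.
Qed.

(** The coupling attempt, in dual form: averaging a test function over one move
    contracts its oscillation by [1 - eta x]. On the common part [eta x * nu] of
    the two laws the test function is the same; what remains has to be compared
    within a bounded set, which is what the oscillation bound [c] controls. *)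
Lemma attempt_oscillation (y1 y2 : E) (x : F) (phi : borel E -> R) (c : R) :
  measurable_fun setT phi -> (forall z, 0 <= phi z <= 1) ->
  (forall z z' : E, mdist z z' <= failure_radius -> `|phi z - phi z'| <= c) ->
  mdist y1 y2 <= capture_radius ->
  \int[P]_w phi (f (y1, x, e w)) - \int[P]_w phi (f (y2, x, e w))
    <= (1 - eta x) * c.
Proof.
move=> mphi phi01 osc y12.
have c0 : 0 <= c.
  apply: (le_trans (normr_ge0 (phi y1 - phi y1))); apply: osc.
  rewrite mdistxx; apply: le_trans capture_radius_le_failure_radius.
  exact/ltW/capture_radius_gt0.
have /andP[eta0 eta1] := eta01 x.
have [/mdist_positivity ->|dn0] := eqVneq (mdist y1 y2) 0.
  by rewrite subrr mulr_ge0 // subr_ge0.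
have y12' : 0 < mdist y1 y2 <= capture_radius.
  by rewrite y12 andbT lt_neqAle eq_sym dn0 mdist_ge0.
have [_ [nu1 nu2]] := hB y12' x.
pose W : set (borel E) := closed_dball y1 K `&` closed_dball y2 K.
have mW : measurable W by apply: measurableI; exact: measurable_closed_dball.
have nuW : nu (x, (y1, y2)) W = 1%E.
  by apply: full_measureI => //; [exact: prob_kernel|
    exact: measurable_closed_dball|exact: measurable_closed_dball].
(* Where the images can be when one of them falls in [W]. *)
pose G : set E := [set z | exists2 u, W u & mdist z u <= capture_radius].
have cr0 := ltW capture_radius_gt0.
have diamW (u u' : E) : W u -> W u' -> mdist u u' <= 2 * K.
  move=> [Wu _] [Wu' _]; apply: (le_trans (metric_triangle u y1 u')).
  by move: Wu Wu'; rewrite /closed_dball /= (metric_sym u y1); lra.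
have diamG z z' : G z -> G z' -> mdist z z' <= failure_radius.
  move=> [u Wu zu] [u' Wu' zu'].
  have := mdist_triangle_le z z' u u'; have := diamW u u' Wu Wu'.
  move: zu zu'; rewrite /failure_radius; move: capture_radius => D.
  by move: (mdist z u) (mdist z' u') (mdist u u') (mdist z z') => *; lra.
(* On [G] the test function lies between [m] and [m + c]; [u1] and [u2] measure
   how far it is from these bounds on the part of the laws that is minorized. *)
pose m := inf [set phi z | z in G].
have mle z : G z -> m <= phi z.
  move=> Gz; apply: ge_inf; last by exists z.
  by exists 0 => _ [z' _ <-]; have /andP[] := phi01 z'.
have lem z : G z -> phi z <= m + c.
  move=> Gz; rewrite -lerBlDr; apply: lb_le_inf; first by exists (phi z), z.
  move=> _ [z' Gz' <-]; rewrite lerBlDr -lerBlDl.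
  by apply: le_trans (ler_norm _) _; exact/osc/diamG.
have WG z : W z -> G z by move=> Wz; exists z => //; rewrite mdistxx.
pose u1 z : R := \1_W z * (m + c - phi z).
pose u2 z : R := \1_W z * (phi z - m).
have u1E z : W z -> u1 z = m + c - phi z.
  by move=> Wz; rewrite /u1 indicE mem_set // mul1r.
have u2E z : W z -> u2 z = phi z - m.
  by move=> Wz; rewrite /u2 indicE mem_set // mul1r.
have u1N z : ~ W z -> u1 z = 0 by move=> Wz; rewrite /u1 indicE memNset // mul0r.
have u2N z : ~ W z -> u2 z = 0 by move=> Wz; rewrite /u2 indicE memNset // mul0r.
have u1c z : 0 <= u1 z <= c.
  have [Wz|Wz] := pselect (W z); last by rewrite u1N // lexx.
  by rewrite u1E //; have := mle _ (WG _ Wz); have := lem _ (WG _ Wz); lra.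
have u2c z : 0 <= u2 z <= c.
  have [Wz|Wz] := pselect (W z); last by rewrite u2N // lexx.
  by rewrite u2E //; have := mle _ (WG _ Wz); have := lem _ (WG _ Wz); lra.
have mu1 : measurable_fun setT u1.
  apply: measurable_funM; first exact: measurable_indic.
  exact: measurable_funB.
have mu2 : measurable_fun setT u2.
  apply: measurable_funM; first exact: measurable_indic.
  exact: measurable_funB.
have [U1 _] := minorized_integral x y12' mu1 u1c.
have [_ U2] := minorized_integral x y12' mu2 u2c.
have mm y := measurable_move y x.
have phic z : `|phi z| <= 1 by exact: unit_norm_le1.
have uc (u : borel E -> R) z : (forall z, 0 <= u z <= c) -> `|u z| <= c.
  by move=> h; have /andP[? ?] := h z; rewrite ger0_norm.
have iphi y : P.-integrable setT (EFin \o (fun w => phi (f (y, x, e w)))).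
  by apply: (@bounded_integrable _ _ _ P _ 1) => //; exact: (measurableT_comp mphi).
have iu1 : P.-integrable setT (EFin \o (fun w => u1 (f (y1, x, e w)))).
  apply: (@bounded_integrable _ _ _ P _ c); first exact: (measurableT_comp mu1).
  by move=> w; exact: uc.
have iu2 : P.-integrable setT (EFin \o (fun w => u2 (f (y2, x, e w)))).
  apply: (@bounded_integrable _ _ _ P _ c); first exact: (measurableT_comp mu2).
  by move=> w; exact: uc.
have ic : P.-integrable setT (EFin \o (fun=> c)).
  by apply: (@bounded_integrable _ _ _ P _ c) => // w; rewrite ger0_norm.
(* If neither image is in [W] the oscillation bound is used as it is. *)
have pointwise w : phi (f (y1, x, e w)) - phi (f (y2, x, e w))
    <= c - u1 (f (y1, x, e w)) - u2 (f (y2, x, e w)).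
  set z1 := f (y1, x, e w); set z2 := f (y2, x, e w).
  have z12 : mdist (z1 : E) (z2 : E) <= capture_radius.
    exact: capture_radius_stable.
  have [W1|W1] := pselect (W z1); have [W2|W2] := pselect (W z2).
  - by rewrite u1E // u2E //; lra.
  - rewrite u1E // u2N //; have := mle z2; rewrite /G /= => h.
    have : m <= phi z2 by apply: h; exists z1 => //; rewrite metric_sym.
    by lra.
  - rewrite u1N // u2E //; have := lem z1; rewrite /G /= => h.
    have : phi z1 <= m + c by apply: h; exists z2.
    by lra.
  - rewrite u1N // u2N // !subr0; apply: le_trans (ler_norm _) _.
    by apply: osc; apply: le_trans capture_radius_le_failure_radius.
have nuc : \int[nu (x, (y1, y2))]_z u1 z + \int[nu (x, (y1, y2))]_z u2 z = c.
  have iu (u : borel E -> R) : measurable_fun setT u -> (forall z, 0 <= u z <= c) ->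
      (nu (x, (y1, y2))).-integrable setT (EFin \o u).
    move=> mu hu; apply: measurable_bounded_integrable => //.
      by rewrite prob_kernel ltry.
    exists c; split; first exact: num_real.
    by move=> b cb z _; apply: (le_trans (uc u z hu)); exact: ltW.
  rewrite -RintegralD //; [|exact: iu|exact: iu].
  transitivity (\int[nu (x, (y1, y2))]_z (c * \1_W z)).
    apply: eq_Rintegral => z _.
    have [Wz|Wz] := pselect (W z).
      by rewrite u1E // u2E // indicE mem_set // mulr1; ring.
    by rewrite u1N // u2N // indicE memNset // mulr0 addr0.
  rewrite RintegralZl //; last first.
    apply: measurable_bounded_integrable => //; first by rewrite prob_kernel ltry.
    exists 1; split; first exact: num_real.
    move=> b b1 z _; apply: le_trans (ltW b1).
    by rewrite /= ger0_norm // indicE; case: (_ \in _).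
  by rewrite /Rintegral integral_indic // setIT nuW mulr1.
rewrite -RintegralB //.
apply: (@le_trans _ _ (\int[P]_w (c - u1 (f (y1, x, e w)) - u2 (f (y2, x, e w))))).
  apply: le_Rintegral => //.
    exact: integrable_EFinB.
  by apply: integrable_EFinB => //; exact: integrable_EFinB.
rewrite RintegralB // ?RintegralB // ?Rintegral_prob_cst; last first.
  exact: integrable_EFinB.
have := nuc; move: U1 U2.
set a1 := \int[nu _]_z u1 z; set a2 := \int[nu _]_z u2 z => U1 U2 a12.
rewrite mulrBl mul1r -a12 mulrDr; lra.
Qed.

End law_of_the_noise.
End one_step.

(** * Loss of memory in a frozen environment *)

Section chain.
Context {d : measure_display} {T : measurableType d} {R : realType}
  (P : probability T R) {E F : polishType R} {p : nat}.
Variable f : borel E * borel F * borel 'rV[R]_p -> borel E.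

Fixpoint traj (x : nat -> borel F) (e : nat -> borel 'rV[R]_p) (y : borel E)
    (n : nat) : borel E :=
  if n is n'.+1 then f (traj x e y n', x n', e n') else y.

Definition later {U : Type} (n : nat) (z : nat -> U) : nat -> U :=
  fun k => z (n + k)%N.

Lemma laterD {U : Type} m n (z : nat -> U) : later m (later n z) = later (n + m) z.
Proof. by apply/funext => k; rewrite /later addnA. Qed.

Lemma trajS x e y n :
  traj x e y n.+1 = traj (later 1 x) (later 1 e) (f (y, x 0%N, e 0%N)) n.
Proof. by elim: n => [//|n IH]; rewrite /= -IH. Qed.

Definition future n x e y : nat -> borel F * borel E :=
  fun k => (x (n + k)%N, traj x e y (n + k)).

Lemma futureS n x e y :
  future n.+1 x e y = future n (later 1 x) (later 1 e) (f (y, x 0%N, e 0%N)).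
Proof. by apply/funext => k; rewrite /future addSn trajS. Qed.

Variable S : set (pathType nat (borel F * borel E)%type).

(** The environment [x] and the initial value [y] are frozen; only the noise is
    random. *)
Definition future_prob (e : nat -> T -> borel 'rV[R]_p) n x y : R :=
  fine (P [set w | S (future n x (path_of e w) y)]).

Hypothesis mf : measurable_fun setT f.
Hypothesis mS : measurable S.

Lemma measurable_traj d0 (O : measurableType d0) (x : O -> nat -> borel F)
    (e : O -> nat -> borel 'rV[R]_p) (y : O -> borel E) n :
  (forall k, measurable_fun setT (fun w => x w k)) ->
  (forall k, measurable_fun setT (fun w => e w k)) -> measurable_fun setT y ->
  measurable_fun setT (fun w => traj (x w) (e w) (y w) n).
Proof.
move=> mx me my; elim: n => [//|n IH] /=.
apply: (measurableT_comp mf); apply: measurable_fun_pair => //.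
exact: measurable_fun_pair.
Qed.

Lemma measurable_future d0 (O : measurableType d0) (x : O -> nat -> borel F)
    (e : O -> nat -> borel 'rV[R]_p) (y : O -> borel E) n :
  (forall k, measurable_fun setT (fun w => x w k)) ->
  (forall k, measurable_fun setT (fun w => e w k)) -> measurable_fun setT y ->
  measurable_fun setT (fun w => future n (x w) (e w) (y w)
    : pathType nat (borel F * borel E)%type).
Proof.
move=> mx me my; apply: measurable_pathP => k; rewrite /future.
by apply: measurable_fun_pair => //; exact: measurable_traj.
Qed.

Lemma measurable_future_set d0 (O : measurableType d0) (x : O -> nat -> borel F)
    (e : O -> nat -> borel 'rV[R]_p) (y : O -> borel E) n :
  (forall k, measurable_fun setT (fun w => x w k)) ->
  (forall k, measurable_fun setT (fun w => e w k)) -> measurable_fun setT y ->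
  measurable [set w | S (future n (x w) (e w) (y w))].
Proof.
move=> mx me my; have := measurable_future n mx me my measurableT mS.
by rewrite setTI.
Qed.

Section noise.
Variable e : nat -> T -> borel 'rV[R]_p.
Hypothesis me : forall k, measurable_fun setT (e k).

Lemma measurable_noise_path : measurable_fun setT (path_of e).
Proof. exact: measurable_pathP. Qed.

Lemma measurable_future_event n x y :
  measurable [set w | S (future n x (path_of e w) y)].
Proof. exact: measurable_future_set. Qed.

Lemma future_prob01 n x y : 0 <= future_prob e n x y <= 1.
Proof. exact/fine_prob_unit/measurable_future_event. Qed.

Lemma measurable_future_prob d0 (O : measurableType d0)
    (x : O -> nat -> borel F) (y : O -> borel E) n :
  (forall k, measurable_fun setT (fun w => x w k)) -> measurable_fun setT y ->
  measurable_fun setT (fun w => future_prob e n (x w) (y w)).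
Proof.
move=> mx my; apply: (@measurable_freezing _ _ _ _ _ _ _ P (path_of e)
  [set z | S (future n (x z.1) z.2 (y z.1))]).
  exact: measurable_noise_path.
apply: measurable_future_set.
- by move=> k; exact: (measurableT_comp (mx k) measurable_fst).
- by move=> k; exact: (measurableT_comp (measurable_coord k) measurable_snd).
- exact: (measurableT_comp my measurable_fst).
Qed.

End noise.

(** Markov property at the first step: the later noise is averaged with the first
    noise frozen. *)
Lemma future_probS (e : nat -> T -> borel 'rV[R]_p) n x y :
  (forall k, measurable_fun setT (e k)) ->
  (forall A B, measurable A -> measurable B ->
    P (e 0%N @^-1` A `&` path_of (later 1 e) @^-1` B)
    = (P (e 0%N @^-1` A) * P (path_of (later 1 e) @^-1` B))%E) ->
  future_prob e n.+1 x y =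
  \int[P]_w future_prob (later 1 e) n (later 1 x) (f (y, x 0%N, e 0%N w)).
Proof.
move=> me he.
have me1 k : measurable_fun setT (later 1 e k) by exact: me.
pose S' : set (borel 'rV[R]_p * pathType nat (borel 'rV[R]_p)) :=
  [set z | S (future n (later 1 x) z.2 (f (y, x 0%N, z.1)))].
have mS' : measurable S'.
  apply: measurable_future_set.
  - by move=> k; exact: measurable_cst.
  - by move=> k; exact: (measurableT_comp (measurable_coord k) measurable_snd).
  - by apply: (measurableT_comp mf); apply: measurable_fun_pair.
have := freezing (me 0%N) (measurable_noise_path me1) he mS'.
rewrite /future_prob /Rintegral.
have -> : [set w | S (future n.+1 x (path_of e w) y)]
    = [set w | S' (e 0%N w, path_of (later 1 e) w)].
  by apply/seteqP; split=> w; rewrite /= futureS.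
move=> ->; congr fine; apply: eq_integral => w _.
by rewrite fineK // fin_num_measure //; exact: measurable_future_event.
Qed.

End chain.

Section loss_of_memory.
Context {d : measure_display} {T : measurableType d} {R : realType}
  {P : probability T R} {E F : polishType R} {p : nat}.
Variable f : borel E * borel F * borel 'rV[R]_p -> borel E.
Hypothesis mf : measurable_fun setT f.
Variables (r rho K : R).
Hypotheses (r_gt0 : 0 < r) (rho01 : 0 < rho < 1) (K_gt0 : 0 < K).
Hypothesis hA : contractive_modulo_constant f rho r.
Variables (nu : R.-pker (borel F * (borel E * borel E)) ~> borel E)
  (eta : borel F -> R).
Hypothesis eta01 : forall x, 0 < eta x <= 1.

Definition independent_of_tail (e : nat -> T -> borel 'rV[R]_p) k :=
  forall A B, measurable A -> measurable B ->
    P (e k @^-1` A `&` path_of (later k.+1 e) @^-1` B)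
    = (P (e k @^-1` A) * P (path_of (later k.+1 e) @^-1` B))%E.

Definition driving_noise (e : nat -> T -> borel 'rV[R]_p) := forall k,
  [/\ measurable_fun setT (e k), independent_of_tail e k &
      minorized_within_bounded_distance P f rho r (e k) nu eta K].

Lemma driving_noise_later e n : driving_noise e -> driving_noise (later n e).
Proof.
move=> h k; have [h1 h2 h3] := h (n + k)%N; split => //.
move=> A B mA mB; have := h2 A B mA mB.
by rewrite laterD addnS.
Qed.

Let D0 := capture_radius r rho.
Let D1 := failure_radius r rho K.
(** Fixed point of the contraction [D |-> rho * D + r] of distances. *)
Let q := r / (1 - rho).

Let D0E : D0 = 2 * q. Proof. by rewrite /D0 /capture_radius /q mulrA. Qed.

Let qE : q * (1 - rho) = r.
Proof.
by have /andP[_ rho1] := rho01; rewrite /q divfK // gt_eqF // subr_gt0.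
Qed.

Definition oscillation_le (phi : E -> R) (D c : R) :=
  forall y y', mdist y y' <= D -> `|phi y - phi y'| <= c.

Variable S : set (pathType nat (borel F * borel E)%type).
Hypothesis mS : measurable S.
Let phi e n x y := future_prob P f S e n x y.

(** Both points are moved by the same noise, so their distance contracts. *)
Lemma oscillation_common_noise e n x D c : driving_noise e ->
  oscillation_le (phi (later 1 e) n (later 1 x)) (rho * D + r) c ->
  oscillation_le (phi e n.+1 x) D c.
Proof.
move=> he osc y y' yy'.
have [me0 ind0 _] := he 0%N.
have me k : measurable_fun setT (e k) by have [] := he k.
have me1 k : measurable_fun setT (later 1 e k) by exact: me.
rewrite /phi !future_probS //.
pose g y w := phi (later 1 e) n (later 1 x) (f (y, x 0%N, e 0%N w)).
have mg z : measurable_fun setT (g z).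
  apply: (measurable_future_prob P mf mS me1) => //.
  exact: (measurable_move mf (me 0%N)).
have ig z : P.-integrable setT (EFin \o g z).
  apply: (@bounded_integrable _ _ _ P _ 1) => // w.
  by apply: unit_norm_le1; exact: future_prob01.
rewrite -RintegralB //; [|exact: ig|exact: ig].
apply: Rintegral_le_cst; first exact: (measurable_funB (mg y) (mg y')).
move=> w; apply: osc; apply: (le_trans (hA _ _ _ _)).
have /andP[rho0 _] := rho01.
by rewrite lerD2r ler_pM2l.
Qed.

Lemma oscillation_attempt e n x c : driving_noise e ->
  oscillation_le (phi (later 1 e) n (later 1 x)) D1 c ->
  oscillation_le (phi e n.+1 x) D0 ((1 - eta (x 0%N)) * c).
Proof.
move=> he osc y y' yy'.
have [me0 ind0 hB] := he 0%N.
have me k : measurable_fun setT (e k) by have [] := he k.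
have me1 k : measurable_fun setT (later 1 e k) by exact: me.
rewrite /phi !future_probS //.
pose g z := phi (later 1 e) n (later 1 x) z.
have mg : measurable_fun setT (g : borel E -> R).
  exact: (measurable_future_prob P mf mS me1).
have g01 z : 0 <= g z <= 1 by exact: future_prob01.
have half y1 y2 : mdist y1 y2 <= D0 ->
    \int[P]_w g (f (y1, x 0%N, e 0%N w)) - \int[P]_w g (f (y2, x 0%N, e 0%N w))
      <= (1 - eta (x 0%N)) * c.
  move=> y12.
  exact: (attempt_oscillation mf r_gt0 rho01 K_gt0 hA eta01 me0 hB _ mg g01 osc).
rewrite ler_norml lerNl opprB; apply/andP; split; apply: half => //.
by rewrite metric_sym.
Qed.

(** Each common move multiplies [D - q] by [rho]; once [D - q] is below [q], the
    distance is within the capture radius [2 * q]. *)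
Lemma oscillation_wait k e n x D c : driving_noise e ->
  rho ^+ k * (D - q) <= q ->
  oscillation_le (phi (later k e) n (later k x)) D0 c ->
  oscillation_le (phi e (k + n) x) D c.
Proof.
elim: k e x D => [|k IH] e x D he hD osc.
  move=> y y' yy'; apply: osc; apply: (le_trans yy').
  by move: hD; rewrite expr0 mul1r D0E; lra.
rewrite addSn; apply: oscillation_common_noise => //.
apply: IH; first exact: driving_noise_later.
  have -> : rho * D + r - q = rho * (D - q).
    by rewrite -[in LHS]qE; ring.
  by rewrite mulrA -exprSr.
by rewrite !laterD add1n.
Qed.

Variable stride : nat.
Hypothesis stride_recovers : rho ^+ stride * (D1 - q) <= q.

(** One attempt every [stride.+1] steps: the stride brings the points back from
    the failure radius to the capture radius. *)
Lemma oscillation_attempts J e x : driving_noise e ->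
  oscillation_le (phi e (J * stride.+1) x) D0
    (\prod_(i < J) (1 - eta (x (i * stride.+1)%N))).
Proof.
elim: J e x => [|J IH] e x he.
  move=> y y' _; rewrite mul0n big_ord0.
  have me k : measurable_fun setT (e k) by have [] := he k.
  have /andP[a0 a1] := future_prob01 P mf mS me 0 x y.
  have /andP[b0 b1] := future_prob01 P mf mS me 0 x y'.
  by rewrite ler_norml; apply/andP; split; rewrite /phi; lra.
rewrite mulSn addSn big_ord_recl mul0n.
apply: oscillation_attempt => //.
apply: oscillation_wait => //; first exact: driving_noise_later.
rewrite !laterD.
have -> : \prod_(i < J) (1 - eta (x (lift ord0 i * stride.+1)%N))
    = \prod_(i < J) (1 - eta (later (1 + stride) x (i * stride.+1)%N)).
  by apply: eq_bigr => i _; rewrite /later lift0 mulSn add1n.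
exact: IH (driving_noise_later _ he).
Qed.

(** The burn-in of [n0] steps brings the two points within the capture radius;
    from then on the initial value matters only if all [J] attempts fail. *)
Lemma loss_of_memory n0 J e x y y' : driving_noise e ->
  rho ^+ n0 * (mdist y y' - q) <= q ->
  `|phi e (n0 + J * stride.+1) x y - phi e (n0 + J * stride.+1) x y'|
   <= \prod_(i < J) (1 - eta (x (n0 + i * stride.+1)%N)).
Proof.
move=> he hD.
apply: (@oscillation_wait n0 e (J * stride.+1) x (mdist y y')) => //.
exact: oscillation_attempts (driving_noise_later _ he).
Qed.

End loss_of_memory.

(** * Dependence of the future of the chain on the past *)

Section path_locality.
Context {I : Type} {d' : measure_display} {U : measurableType d'}.

Lemma path_measurableE :
  (measurable : set (set (pathType I U))) = sigma_of (coord (U:=U)) setT.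
Proof. by []. Qed.

(** Sets that only depend on the coordinates in [J] form a sigma-field. *)
Lemma sigma_of_coord_local (J : set I) S : sigma_of (coord (U:=U)) J S ->
  forall z z' : pathType I U, (forall i, J i -> z i = z' i) -> S z -> S z'.
Proof.
pose H : set_system (pathType I U) := [set S | forall z z' : pathType I U,
  (forall i, J i -> z i = z' i) -> S z -> S z'].
suff : sigma_of (coord (U:=U)) J `<=` H by move=> h /h.
apply: sigma_of_sub.
  split=> [z z' _ []|A hA z z' zz' [_ nA]|F hF z z' zz' [k _ Fz]].
    by split=> // Az'; apply: nA; apply: hA Az' => i /zz' ->.
  by exists k => //; exact: hF Fz.
by move=> i Ji B mB z z' /(_ i Ji) zz'; rewrite /coord /= zz'.
Qed.

End path_locality.

Section dependence_on_the_past.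
Context {d : measure_display} {T : measurableType d} {R : realType}
  {P : probability T R} {E F : polishType R} {p : nat}.
Variable f : borel E * borel F * borel 'rV[R]_p -> borel E.
Hypothesis mf : measurable_fun setT f.
Variable S : set (pathType nat (borel F * borel E)%type).
Hypothesis mS : measurable S.

Lemma traj_local x x' (e : nat -> borel 'rV[R]_p) y n :
  (forall k, (k < n)%N -> x k = x' k) -> traj f x e y n = traj f x' e y n.
Proof.
elim: n => [//|n IH] h /=; rewrite IH; last by move=> k kn; apply: h; lia.
by rewrite h.
Qed.

Section frozen_environment.
Variable G : set_system T.
Hypotheses (sG : sigma_algebra setT G) (Gm : G `<=` measurable).
Variables (X : nat -> T -> borel F) (V : T -> borel E)
  (e : nat -> T -> borel 'rV[R]_p).
Hypothesis me : forall k, measurable_fun setT (e k).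
Hypothesis GX : forall k, measurable_wrt G (X k).
Hypothesis GV : measurable_wrt G V.
Hypothesis Ge : independent_systems P G (sigma_of e setT).

Definition future_event n := [set w |
  S (future f n (path_of X w) (path_of e w) (V w))].

Lemma measurable_wrt_future_prob n (H : set_system T) (W : T -> borel E) :
  sigma_algebra setT H -> (forall k, measurable_wrt H (X k)) ->
  measurable_wrt H W ->
  measurable_wrt H (fun w => future_prob P f S e n (path_of X w) (W w)).
Proof.
move=> sH HX HW; apply/(measurable_wrtP _ sH).
apply: (measurable_future_prob P mf mS me (O := g_sigma_algebraType H)
  (x := path_of X) (y := W)).
  by move=> k; apply/(measurable_wrtP _ sH); exact: HX.
exact/(measurable_wrtP _ sH).
Qed.

Lemma measurable_realized_future n : measurable (future_event n).
Proof.
apply: measurable_future_set => //.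
- by move=> k; apply: (measurable_wrt_measurable Gm); exact: GX.
- exact: (measurable_wrt_measurable Gm).
Qed.

(** Given [G], environment and initial value are known and the noise is
    independent. *)
Lemma future_event_prob n C : G C ->
  fine (P (C `&` future_event n)) =
  \int[P]_(w in C) future_prob P f S e n (path_of X w) (V w).
Proof.
move=> GC; have mC := Gm GC.
pose T' := g_sigma_algebraType G.
pose S' : set (T' * pathType nat (borel 'rV[R]_p)) :=
  [set z | C z.1] `&` [set z | S (future f n (path_of X z.1) z.2 (V z.1))].
have mS' : measurable S'.
  apply: measurableI.
    have := @measurable_fst _ _ T' (pathType nat (borel 'rV[R]_p)) measurableT C.
    by rewrite setTI; apply; rewrite measurable_g_measurableTypeE.
  apply: measurable_future_set => //.
  - move=> k; have mX : measurable_fun setT (X k : T' -> borel F).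
      by apply/(measurable_wrtP _ sG); exact: GX.
    exact: (measurableT_comp mX measurable_fst).
  - by move=> k; exact: (measurableT_comp (measurable_coord k) measurable_snd).
  - have mV : measurable_fun setT (V : T' -> borel E).
      by apply/(measurable_wrtP _ sG).
    exact: (measurableT_comp mV measurable_fst).
have mid : measurable_fun setT (id : T -> T').
  move=> _ B; rewrite measurable_g_measurableTypeE // => GB.
  by rewrite setTI; exact: Gm.
have ind A B : measurable A -> measurable B ->
   P ((id : T -> T') @^-1` A `&` path_of e @^-1` B)
   = (P ((id : T -> T') @^-1` A) * P (path_of e @^-1` B))%E.
  rewrite measurable_g_measurableTypeE // => GA.
  rewrite path_measurableE => mB.
  by apply: Ge => //; exact: preimage_sigma_of.
have := freezing mid (measurable_noise_path me) ind mS'.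
have -> : [set w | S' (id w, path_of e w)] = C `&` future_event n by [].
move=> ->; rewrite /Rintegral; congr fine.
rewrite [RHS]integral_mkcond; apply: eq_integral => w _.
rewrite patchE; case: ifPn => [/set_mem Cw|/negP nC].
  have -> : [set w' | S' (id w, path_of e w')]
      = [set w' | S (future f n (path_of X w) (path_of e w') (V w))].
    by apply/seteqP; split=> w' /=; rewrite /S' /= => // -[].
  by rewrite fineK // fin_num_measure //; exact: measurable_future_event.
rewrite (_ : [set w' | _] = set0) ?measure0 //.
by apply/seteqP; split=> w' //= [Cw _]; apply: nC; rewrite inE.
Qed.

Variables (r rho K : R).
Hypotheses (r_gt0 : 0 < r) (rho01 : 0 < rho < 1) (K_gt0 : 0 < K).
Hypothesis hA : contractive_modulo_constant f rho r.
Variables (nu : R.-pker (borel F * (borel E * borel E)) ~> borel E)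
  (eta : borel F -> R).
Hypothesis eta01 : forall x, 0 < eta x <= 1.
Hypothesis meta : measurable_fun setT eta.
Hypothesis he : driving_noise (P:=P) f r rho K nu eta e.
Variable stride : nat.
Hypothesis stride_recovers : rho ^+ stride *
  (failure_radius r rho K - r / (1 - rho)) <= r / (1 - rho).

Definition burn_in_range n0 := r / (1 - rho) / rho ^+ n0.

(** The chance that the chain started from [V] and the chain started from [y0]
    are not coupled: either [V] is too far for the burn-in or all the attempts
    fail. *)
Definition miss_prob (y0 : borel E) n0 J : R :=
  fine (P [set w | burn_in_range n0 < mdist (y0 : E) (V w)])
  + \int[P]_w \prod_(i < J) (1 - eta (X (n0 + i * stride.+1)%N w)).

Lemma prod_1B01 (t : nat -> T -> borel F) J w :
  0 <= \prod_(i < J) (1 - eta (t i w)) <= 1.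
Proof.
elim: J => [|J /andP[h0 h1]]; first by rewrite big_ord0 ler01 lexx.
rewrite big_ord_recr /=; have /andP[e0 e1] := eta01 (t J w).
by rewrite mulr_ge0 ?subr_ge0 //= mulr_ile1 // ?subr_ge0 // gerBl ltW.
Qed.

Lemma measurable_prod_1B (t : nat -> T -> borel F) J :
  (forall i, measurable_fun setT (t i)) ->
  measurable_fun setT (fun w => \prod_(i < J) (1 - eta (t i w))).
Proof.
move=> mt; elim: J => [|J IH].
  by under eq_fun do rewrite big_ord0; exact: measurable_cst.
under eq_fun do rewrite big_ord_recr /=.
apply: measurable_funM => //; apply: measurable_funB => //.
exact: (measurableT_comp meta).
Qed.

(** Either [V] is out of the range of the burn-in, or [loss_of_memory] applies. *)
Lemma forget_initial_value C (y0 : borel E) n0 J : measurable C ->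
  `|\int[P]_(w in C)
      future_prob P f S e (n0 + J * stride.+1) (path_of X w) (V w)
    - \int[P]_(w in C)
      future_prob P f S e (n0 + J * stride.+1) (path_of X w) y0|
  <= miss_prob y0 n0 J.
Proof.
move=> mC; set n := (n0 + _)%N.
have mX k : measurable_fun setT (X k).
  by apply: (measurable_wrt_measurable Gm); exact: GX.
have mV : measurable_fun setT V by exact: (measurable_wrt_measurable Gm).
pose phi y w := future_prob P f S e n (path_of X w) y.
have mphiV : measurable_fun setT (fun w => phi (V w) w).
  exact: (measurable_future_prob P mf mS me).
have mphi y : measurable_fun setT (phi y).
  by apply: (measurable_future_prob P mf mS me) => //; exact: measurable_cst.
have phi01 y w : 0 <= phi y w <= 1 by exact: future_prob01.
have phic y w : `|phi y w| <= 1 by exact: unit_norm_le1.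
pose far := [set w | burn_in_range n0 < mdist (y0 : E) (V w)].
have mfar : measurable far.
  have -> : far = V @^-1` (~` closed_dball (y0 : E) (burn_in_range n0)).
    apply/seteqP; split=> w /=; rewrite /far /closed_dball /= ltNge.
      by move/negP.
    by move=> h; apply/negP.
  rewrite -[X in measurable X]setTI; apply: mV => //.
  by apply: measurableC; exact: measurable_closed_dball.
pose missed w := \prod_(i < J) (1 - eta (X (n0 + i * stride.+1)%N w)).
have mmissed : measurable_fun setT missed.
  exact: (@measurable_prod_1B (fun i => X (n0 + i * stride.+1)%N)).
have missed01 w : 0 <= missed w <= 1.
  exact: (@prod_1B01 (fun i => X (n0 + i * stride.+1)%N)).
have /andP[rho0 rho1] := rho01.
have q0 : 0 < r / (1 - rho) by rewrite divr_gt0 // subr_gt0.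
have close w : ~ far w -> `|phi (V w) w - phi y0 w| <= missed w.
  rewrite /far /= => /negP; rewrite -leNgt => hd.
  apply: (loss_of_memory mf r_gt0 rho01 K_gt0 hA eta01 mS) => //.
  have rn : 0 < rho ^+ n0 by rewrite exprn_gt0.
  rewrite mulrBr lerBlDr; apply: (@le_trans _ _ (r / (1 - rho))).
    by rewrite mulrC -ler_pdivlMr // metric_sym.
  by rewrite lerDl mulr_ge0 // ltW.
have bound w : `|phi (V w) w - phi y0 w| <= \1_far w + missed w.
  have /andP[m0 m1] := missed01 w.
  have [fw|nfw] := pselect (far w).
    rewrite indicE mem_set // mulr1n ler_wpDr //.
    have /andP[a0 a1] := phi01 (V w) w; have /andP[b0 b1] := phi01 y0 w.
    by rewrite ler_norml; apply/andP; split; lra.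
  by rewrite indicE memNset // add0r close.
rewrite -RintegralB //; last first.
- exact: bounded_integrable_on (phic y0).
- exact: (@bounded_integrable_on _ _ _ P C (fun w => phi (V w) w) 1 mC mphiV
    (fun w => phic (V w) w)).
apply: (le_trans (le_normr_Rintegral _ _)) => //.
  apply: (@bounded_integrable_on _ _ _ P C (fun w => phi (V w) w - phi y0 w) 2)
    => //.
    exact: measurable_funB.
  by move=> w; apply: (le_trans (ler_normB _ _)); rewrite -[leRHS]/(1 + 1) lerD.
have idiff : P.-integrable setT (EFin \o (fun w => `|phi (V w) w - phi y0 w|)).
  apply: (@bounded_integrable _ _ _ _ _ 2).
    by apply: measurableT_comp => //; exact: measurable_funB.
  move=> w; rewrite normr_id.
  by apply: (le_trans (ler_normB _ _)); rewrite -[leRHS]/(1 + 1) lerD.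
have ifar : P.-integrable setT (EFin \o \1_far : T -> \bar R).
  apply: (@bounded_integrable _ _ _ _ _ 1); first exact: measurable_indic.
  by move=> w; rewrite ger0_norm // indicE; case: (_ \in _).
have imissed : P.-integrable setT (EFin \o missed).
  apply: (@bounded_integrable _ _ _ _ _ 1) => // w; exact: unit_norm_le1.
apply: (@le_trans _ _ (\int[P]_w `|phi (V w) w - phi y0 w|)).
  have mabs : measurable_fun setT (fun w => `|phi (V w) w - phi y0 w|).
    by apply: measurableT_comp => //; exact: measurable_funB.
  rewrite (Rintegral_on_indic P mC mabs); apply: le_Rintegral => //.
    apply: (@bounded_integrable _ _ _ P
      (fun w => \1_C w * `|phi (V w) w - phi y0 w|) 2).
      by apply: measurable_funM => //; exact: measurable_indic.
    move=> w; rewrite normrM normr_id -[leRHS]mul1r ler_pM //.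
      by rewrite ger0_norm // indicE; case: (_ \in _).
    by apply: (le_trans (ler_normB _ _)); rewrite -[leRHS]/(1 + 1) lerD.
  by move=> w _; rewrite indicE; case: (_ \in _); rewrite ?mul1r // mul0r.
rewrite /miss_prob -Rintegral_indicE // -RintegralD //.
apply: le_Rintegral => //.
exact: (integrableD measurableT ifar imissed).
Qed.

(** Restarting from [y0] turns the future into a function of the environment, to
    which the mixing of the environment applies. The restart is paid for twice:
    in the probability of the intersection and in the product. *)
Lemma dependence_of_future G1 H (a : R) C (y0 : borel E) n0 J :
  G1 `<=` G -> sigma_algebra setT H -> H `<=` measurable ->
  dependence_le P G1 H a -> G1 C ->
  measurable_wrt H (fun w =>
    future_prob P f S e (n0 + J * stride.+1) (path_of X w) y0) ->
  `|fine (P (C `&` future_event (n0 + J * stride.+1)))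
    - fine (P C) * fine (P (future_event (n0 + J * stride.+1)))|
  <= a + 2 * miss_prob y0 n0 J.
Proof.
move=> G1G sH Hm G1H GC Hphi; set n := (n0 + _)%N in Hphi *.
have GC' := G1G _ GC; have mC := Gm GC'.
rewrite (future_event_prob _ GC') -[future_event n]setTI.
rewrite (future_event_prob _ (sigma_algebraT sG)).
have := forget_initial_value y0 n0 J mC.
have := forget_initial_value y0 n0 J measurableT.
have := @dependence_event_function _ _ _ P H G1 a C _ sH Hm _ _ GC Hphi _.
rewrite -/n => h3 h1 h2.
have {}h3 := h3 (subset_trans G1G Gm) (dependence_leC G1H)
  (fun w => future_prob01 P mf mS me _ _ _).
have /andP[c0 c1] := fine_prob_unit P mC.
set IC := \int[P]_(w in C) _ in h2 *.
set I := \int[P]_w future_prob _ _ _ _ _ _ (V w) in h1 *.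
set IC0 := \int[P]_(w in C) _ in h2 h3.
set I0 := \int[P]_w future_prob _ _ _ _ _ _ y0 in h1 h3.
set m := miss_prob y0 n0 J in h1 h2 *.
have -> : IC - fine (P C) * I =
  (IC - IC0) + (IC0 - fine (P C) * I0) - fine (P C) * (I - I0) by ring.
have h4 : `|fine (P C) * (I - I0)| <= m.
  rewrite normrM ger0_norm //; apply: le_trans h1.
  by rewrite ler_piMl.
apply: (le_trans (ler_normB _ _)); apply: (le_trans (lerD (ler_normD _ _) h4)).
by move: h2 h3; lra.
Qed.

End frozen_environment.

(** For a future observed over a window of length [M] only, the environment after
    the window can be replaced by its last value in the window. *)
Lemma measurable_wrt_future_prob_stopped n M (H : set_system T)
    (X : nat -> T -> borel F) (e : nat -> T -> borel 'rV[R]_p) (y0 : borel E) :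
  sigma_algebra setT H -> (forall k, measurable_fun setT (e k)) ->
  (forall k, (k <= n + M)%N -> measurable_wrt H (X k)) ->
  sigma_of (coord (U := (borel F * borel E)%type)) [set k | (k <= M)%N] S ->
  measurable_wrt H (fun w => future_prob P f S e n (path_of X w) y0).
Proof.
move=> sH me HX hS.
pose X' k := X (minn k (n + M)).
have -> : (fun w => future_prob P f S e n (path_of X w) y0)
    = (fun w => future_prob P f S e n (path_of X' w) y0).
  apply/funext => w; rewrite /future_prob; congr (fine (P _)).
  have fE w' k : (k <= M)%N ->
      future f n (path_of X w) (path_of e w') y0 k =
      future f n (path_of X' w) (path_of e w') y0 k.
    move=> kM; rewrite /future /path_of /X'; congr (_, _).
      by congr (X _ w); lia.
    by apply: traj_local => i ik; congr (X _ w); lia.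
  apply/seteqP; split=> w' /=; apply: (sigma_of_coord_local hS) => k /= kM.
    exact: fE.
  by rewrite fE.
apply: measurable_wrt_future_prob => //.
  by move=> k; apply: HX; exact: geq_minr.
by move=> B mB; rewrite preimage_cst; case: ifP => _;
  [exact: sigma_algebraT|case: sH].
Qed.

End dependence_on_the_past.

(** * Mixing coefficients, stationarity and failed attempts *)

Section mixing_coefficients.
Context {d d' : measure_display} {T : measurableType d}
  {U : measurableType d'} {R : realType}.
Variable P : probability T R.

Lemma dependence_le1 (G H : set_system T) : G `<=` measurable ->
  H `<=` measurable -> dependence_le P G H 1.
Proof.
move=> Gm Hm A B /Gm mA /Hm mB.
have /andP[a0 a1] := fine_prob_unit P mA.
have /andP[b0 b1] := fine_prob_unit P mB.
have /andP[c0 c1] := fine_prob_unit P (measurableI _ _ mA mB).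
have ab1 : fine (P A) * fine (P B) <= 1 by rewrite mulr_ile1.
have ab0 : 0 <= fine (P A) * fine (P B) by rewrite mulr_ge0.
by rewrite ler_norml; apply/andP; split; lra.
Qed.

Lemma alpha_dependence_le (G H : set_system T) (a : R) : G set0 -> H set0 ->
  dependence_le P G H a -> alpha_dependence P G H <= a.
Proof.
move=> G0 H0 GH; apply: ge_sup; first by eexists; exists set0 => //; exists set0.
by move=> _ [A GA [B HB <-]]; exact: GH.
Qed.

Lemma dependence_alpha (G H : set_system T) : G `<=` measurable ->
  H `<=` measurable -> dependence_le P G H (alpha_dependence P G H).
Proof.
move=> Gm Hm A B GA HB; apply: ub_le_sup.
  by exists 1 => _ [A' GA' [B' HB' <-]]; exact: (dependence_le1 Gm Hm).
by exists A => //; exists B.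
Qed.

Section index.
Context {disp : Order.disp_t} {I : porderType disp} (inj : nat -> I).
Variable Z : I -> T -> U.
Hypothesis mZ : forall i, measurable_fun setT (Z i).

Lemma alpha_coef_dependence n j :
  dependence_le P (sigma_of Z [set s | (s <= inj j)%O])
    (sigma_of Z [set s | (inj (n + j)%N <= s)%O]) (alpha_coef P inj Z n).
Proof.
have sm J := sigma_of_measurable (J:=J) mZ.
have s0 J : sigma_of Z J set0 by case: (sigma_algebra_sigma_of Z J).
apply: dependence_leW (dependence_alpha (@sm _) (@sm _)).
apply: ub_le_sup; last by exists j.
exists 1 => _ [j' _ <-]; apply: alpha_dependence_le => //.
exact: dependence_le1.
Qed.

Lemma alpha_coef_le n a :
  (forall j, dependence_le P (sigma_of Z [set s | (s <= inj j)%O])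
    (sigma_of Z [set s | (inj (n + j)%N <= s)%O]) a) ->
  alpha_coef P inj Z n <= a.
Proof.
move=> h; have s0 J : sigma_of Z J set0.
  by case: (sigma_algebra_sigma_of Z J).
apply: ge_sup; first by eexists; exists 0%N.
by move=> _ [j _ <-]; apply: alpha_dependence_le => //; exact: h.
Qed.

Lemma alpha_coef_ge0 n : 0 <= alpha_coef P inj Z n.
Proof.
have s0 J : sigma_of Z J set0 by case: (sigma_algebra_sigma_of Z J).
apply: le_trans (alpha_coef_dependence (n:=n) (j:=0%N) (s0 _) (s0 _)).
exact: normr_ge0.
Qed.

End index.

End mixing_coefficients.

Section stationarity.
Context {d d' : measure_display} {T : measurableType d}
  {U : measurableType d'} {R : realType}.
Variable P : probability T R.
Variable Z : int -> T -> U.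
Hypothesis mZ : forall i, measurable_fun setT (Z i).
Hypothesis hZ : strictly_stationary P Z.

Lemma stationary_integral k (t : 'I_k -> int) (h : int)
    (g : k.-tuple U -> \bar R) :
  measurable_fun setT g -> (forall u, (0 <= g u)%E) ->
  (\int[P]_w g [tuple Z (t i + h) w | i < k]
   = \int[P]_w g [tuple Z (t i) w | i < k])%E.
Proof.
move=> mg g0.
have mt (t' : 'I_k -> int) :
    measurable_fun setT (fun w => [tuple Z (t' i) w | i < k]).
  apply/measurable_fun_tnthP => i.
  by apply: eq_measurable_fun (mZ (t' i)) => w _; rewrite /= tnth_mktuple.
pose D t' : {mfun T >-> k.-tuple U} := mfun_Sub (mem_set (mt t')).
have E t' : (\int[P]_w g [tuple Z (t' i) w | i < k]
    = \int[distribution P (D t')]_u g u)%E.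
  by rewrite ge0_integral_distribution.
rewrite !E; apply: eq_measure_integral => B mB _.
exact: hZ.
Qed.

Lemma stationary_integral1 (s t : int) (g : U -> \bar R) :
  measurable_fun setT g -> (forall u, (0 <= g u)%E) ->
  (\int[P]_w g (Z s w) = \int[P]_w g (Z t w))%E.
Proof.
move=> mg g0.
pose g' (u : 1.-tuple U) := g (tnth u ord0).
have mg' : measurable_fun setT g'.
  exact: (measurableT_comp mg (measurable_tnth _)).
have := @stationary_integral 1 (fun=> t) (s - t) g' mg' (fun u => g0 _).
rewrite /g'; under eq_integral do rewrite tnth_mktuple addrC subrK.
by move=> ->; apply: eq_integral => w _; rewrite tnth_mktuple.
Qed.

End stationarity.

Section survival.
Context {d d' : measure_display} {T : measurableType d}
  {U : measurableType d'} {R : realType}.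
Variable P : probability T R.
Variable X : int -> T -> U.
Hypothesis mX : forall i, measurable_fun setT (X i).
Hypothesis hX : strictly_stationary P X.
Variables (eta : U -> R) (s : nat).
Hypothesis meta : measurable_fun setT eta.
Hypothesis eta01 : forall x, 0 < eta x <= 1.

(** Probability that [J] attempts, made every [s.+1] steps, all fail. *)
Definition survival J : R :=
  \int[P]_w \prod_(i < J) (1 - eta (X (Posz (i * s.+1)%N) w)).

Let fail01 x : 0 <= 1 - eta x <= 1.
Proof. by have := eta01 x; lra. Qed.

Lemma prod_fail01 (t : nat -> int) J w :
  0 <= \prod_(i < J) (1 - eta (X (t i) w)) <= 1.
Proof.
elim: J => [|J /andP[h0 h1]]; first by rewrite big_ord0 ler01 lexx.
rewrite big_ord_recr /=; have /andP[f0 f1] := fail01 (X (t J) w).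
by rewrite mulr_ge0 //= mulr_ile1.
Qed.

Lemma measurable_wrt_prod_fail (H : set_system T) (t : nat -> int) J :
  sigma_algebra setT H ->
  (forall i, (i < J)%N -> measurable_wrt H (X (t i))) ->
  measurable_wrt H (fun w => \prod_(i < J) (1 - eta (X (t i) w))).
Proof.
move=> sH; elim: J => [|J IH] hX'.
  apply/(measurable_wrtP _ sH).
  by under eq_fun do rewrite big_ord0; exact: measurable_cst.
apply/(measurable_wrtP _ sH); under eq_fun do rewrite big_ord_recr /=.
apply: measurable_funM.
  by apply/(measurable_wrtP _ sH); apply: IH => i iJ; apply: hX'; lia.
apply: measurable_funB => //.
have /(measurable_wrtP _ sH) mXJ := hX' J (leqnn _).
exact: (measurableT_comp meta mXJ).
Qed.

Lemma measurable_prod_fail (t : nat -> int) J :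
  measurable_fun setT (fun w => \prod_(i < J) (1 - eta (X (t i) w))).
Proof.
apply: (@measurable_wrt_measurable _ _ _ _ measurable) => //.
apply: measurable_wrt_prod_fail; first exact: sigma_algebra_measurable.
by move=> i _ B mB; rewrite -[X in measurable X]setTI; exact: mX.
Qed.

Lemma integrable_prod_fail (t : nat -> int) J :
  P.-integrable setT (EFin \o (fun w => \prod_(i < J) (1 - eta (X (t i) w)))).
Proof.
apply: (@bounded_integrable _ _ _ P _ 1); first exact: measurable_prod_fail.
by move=> w; apply: unit_norm_le1; exact: prod_fail01.
Qed.

Lemma survival_shift (t : int) J :
  \int[P]_w \prod_(i < J) (1 - eta (X (Posz (i * s.+1)%N + t) w)) = survival J.
Proof.
pose g (u : J.-tuple U) : \bar R := (\prod_(i < J) (1 - eta (tnth u i)))%:E.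
have mg : measurable_fun setT g.
  apply/measurable_EFinP.
  apply: (@measurable_prod _ _ _ _ _ _ (fun (i : 'I_J) u => 1 - eta (tnth u i))).
  move=> i _; apply: measurable_funB => //.
  exact: (measurableT_comp meta (measurable_tnth _)).
have g0 u : (0 <= g u)%E.
  by rewrite lee_fin prodr_ge0 // => i _; have /andP[] := fail01 (tnth u i).
have := stationary_integral mX hX (fun i : 'I_J => Posz (i * s.+1)%N) t mg g0.
rewrite /survival /Rintegral => h; congr fine; move: h.
have E (t' : 'I_J -> int) w : g [tuple X (t' i) w | i < J]
    = (\prod_(i < J) (1 - eta (X (t' i) w)))%:E.
  by rewrite /g; congr (_%:E); apply: eq_bigr => i _; rewrite tnth_mktuple.
move=> h; transitivity
    (\int[P]_w g [tuple X (Posz (i * s.+1)%N + t) w | i < J])%E.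
  by apply: eq_integral => w _;
    rewrite (E (fun i : 'I_J => Posz (i * s.+1)%N + t)).
by rewrite h; apply: eq_integral => w _; exact: E.
Qed.

Lemma survival_ge0 J : 0 <= survival J.
Proof.
apply: Rintegral_ge0 => w _.
by have /andP[] := prod_fail01 (fun i => Posz (i * s.+1)) J w.
Qed.

Lemma survival_le1 J : survival J <= 1.
Proof.
rewrite -[leRHS](Rintegral_prob_cst P 1); apply: le_Rintegral => //.
- exact: (integrable_prod_fail (fun i => Posz (i * s.+1))).
- by apply: (@bounded_integrable _ _ _ P _ 1) => // w; rewrite normr1.
- by move=> w _; have /andP[] := prod_fail01 (fun i => Posz (i * s.+1)) J w.
Qed.

Lemma survival_noninc m n : (m <= n)%N -> survival n <= survival m.
Proof.
move=> /subnK <-; elim: (n - m)%N => [//|k IH].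
apply: le_trans IH; apply: le_Rintegral => //.
- exact: (integrable_prod_fail (fun i => Posz (i * s.+1))).
- exact: (integrable_prod_fail (fun i => Posz (i * s.+1))).
- move=> w _; rewrite addSn big_ord_recr /=.
  have /andP[h0 _] := prod_fail01 (fun i => Posz (i * s.+1)) (k + m) w.
  by rewrite ler_piMr //; have /andP[] := fail01 (X (Posz ((k + m) * s.+1)) w).
Qed.

(** A positive variable has a positive expectation. *)
Lemma survival1_lt1 : survival 1 < 1.
Proof.
pose u w := eta (X (Posz 0) w).
have mu : measurable_fun setT u by exact: (measurableT_comp meta (mX _)).
have iu : P.-integrable setT (EFin \o u).
  apply: (@bounded_integrable _ _ _ P _ 1) => // w.
  by apply: unit_norm_le1; have := eta01 (X (Posz 0) w); rewrite /u; lra.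
have i1 : P.-integrable setT (EFin \o (fun=> 1 : R)).
  by apply: (@bounded_integrable _ _ _ P _ 1) => // w; rewrite normr1.
have -> : survival 1 = 1 - \int[P]_w u w.
  rewrite -[X in X - _](Rintegral_prob_cst P 1) -RintegralB //.
  by apply: eq_Rintegral => w _; rewrite big_ord_recr big_ord0 /= mul1r.
rewrite ltrBlDr ltrDl lt_neqAle Rintegral_ge0 ?andbT; last first.
  by move=> w _; have /andP[/ltW] := eta01 (X (Posz 0) w).
apply/eqP => /esym h0.
have : (\int[P]_w `|(u w)%:E| = 0)%E.
  transitivity (\int[P]_w (u w)%:E)%E.
    apply: eq_integral => w _; rewrite gee0_abs // lee_fin.
    by have /andP[/ltW] := eta01 (X (Posz 0) w).
  by rewrite -[LHS]fineK ?integrable_fin_num //; congr EFin.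
have mu' : measurable_fun setT (EFin \o u) by exact/measurable_EFinP.
move=> /(ae_eq_integral_abs P measurableT mu').1 [N [mN N0 hN]].
have NT : N = setT.
  apply/seteqP; split=> // w _; apply: hN => /= /(_ Logic.I) [] /eqP.
  by rewrite gt_eqF //; have /andP[] := eta01 (X (Posz 0) w).
have P1 : P N = 1%E by rewrite NT; exact: probability_setT.
have P0 : P N = 0%E by exact: N0.
by move: P0; rewrite P1 => -[] /eqP; rewrite oner_eq0.
Qed.

(** Forget the [q] attempts in the middle: what remains are two products at least
    [q] time units apart. *)
Lemma survival_decouple a q b :
  survival (a + q + b) <= survival a * survival b + alphaZ P X q.
Proof.
pose t1 (i : nat) := Posz (i * s.+1).
pose t2 (i : nat) := Posz (i * s.+1) + Posz ((a + q) * s.+1).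
pose phi w := \prod_(i < a) (1 - eta (X (t1 i) w)).
pose psi w := \prod_(i < b) (1 - eta (X (t2 i) w)).
have phi01 w : 0 <= phi w <= 1 by exact: prod_fail01.
have psi01 w : 0 <= psi w <= 1 by exact: prod_fail01.
pose j := (a * s.+1)%N.
pose G := sigma_of X [set i | (i <= Posz j)%O].
pose H := sigma_of X [set i | (Posz (q + j)%N <= i)%O].
have sG : sigma_algebra setT G by exact: sigma_algebra_sigma_of.
have sH : sigma_algebra setT H by exact: sigma_algebra_sigma_of.
have dep : dependence_le P G H (alphaZ P X q) by exact: alpha_coef_dependence.
have Gphi : measurable_wrt G phi.
  apply: measurable_wrt_prod_fail => // i ia; apply: sigma_of_wrt.
  by rewrite /= /t1 lez_nat leq_mul2r ltnW ?orbT.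
have Hpsi : measurable_wrt H psi.
  apply: measurable_wrt_prod_fail => // i ib; apply: sigma_of_wrt.
  rewrite /= /t2 -PoszD lez_nat /j mulnDl addnC.
  rewrite (leq_trans _ (leq_addl _ _)) // leq_add2l.
  by rewrite leq_pmulr.
have h := @dependence_functions _ _ _ P G H _ phi psi sG sH
  (sigma_of_measurable mX) (sigma_of_measurable mX) dep Gphi phi01 Hpsi psi01.
have -> : survival b = \int[P]_w psi w.
  by rewrite -(survival_shift (Posz ((a + q) * s.+1)%N) b).
apply: (@le_trans _ _ (\int[P]_w (phi w * psi w))); last first.
  by rewrite addrC -lerBlDr; apply: le_trans (ler_norm _) h.
apply: le_Rintegral => //.
- exact: (integrable_prod_fail (fun i => Posz (i * s.+1))).
- apply: (@bounded_integrable _ _ _ P _ 1).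
    by apply: measurable_funM; exact: measurable_prod_fail.
  by move=> w; rewrite normrM mulr_ile1 // unit_norm_le1.
- move=> w _; rewrite !big_split_ord /=.
  set mid := (\prod_(i < q) _); set last := (\prod_(i < b) _).
  have -> : last = psi w.
    apply: eq_bigr => i _; congr (1 - eta (X _ w)).
    by rewrite /t2 -PoszD mulnDl addnC.
  have -> : \prod_(i < a) (1 - eta (X (Posz (i * s.+1)) w)) = phi w by [].
  have /andP[p0 p1] := phi01 w; have /andP[q0 q1] := psi01 w.
  have /andP[m0 m1] : 0 <= mid <= 1.
    exact: (@prod_fail01 (fun i => Posz ((a + i) * s.+1)%N) q w).
  by rewrite ler_pM // ?mulr_ge0 // ler_piMr.
Qed.

End survival.

(** * Moments of the distance to a fixed point *)

Lemma powR_subadditive (R : realType) (theta a b : R) : 0 < theta <= 1 ->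
  0 <= a -> 0 <= b -> (a + b) `^ theta <= a `^ theta + b `^ theta.
Proof.
move=> /andP[t0 t1] a0 b0.
have [ab0|abn] := eqVneq (a + b) 0.
  by rewrite ab0 powR0 ?gt_eqF // addr_ge0 // powR_ge0.
have ab : 0 < a + b by rewrite lt_neqAle eq_sym abn addr_ge0.
have h x : 0 <= x -> x <= a + b ->
    (a + b) `^ theta * (x / (a + b)) <= x `^ theta.
  move=> x0 xab; have [->|xn] := eqVneq x 0.
    by rewrite mul0r mulr0 powR_ge0.
  rewrite -[in leRHS](@divfK _ (a + b) _ x) // powRM ?(ltW ab) //; last first.
    by rewrite divr_ge0 // ltW.
  rewrite mulrC ler_pM2r ?powR_gt0 // ger1_powR //.
  have x1 : 0 < x by rewrite lt_neqAle eq_sym xn.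
  by rewrite divr_gt0 //= ler_pdivrMr // mul1r.
have := lerD (h a a0 _) (h b b0 _); rewrite lerDl lerDr => /(_ b0 a0).
by rewrite -mulrDr -mulrDl divff // mulr1.
Qed.

Section moments.
Context {d : measure_display} {T : measurableType d} {R : realType}
  (P : probability T R) {E F : polishType R} {p : nat}.
Variables (theta : R) (y0 : E).
Hypothesis theta01 : 0 < theta <= 1.

Lemma measurable_dist_power (V : T -> borel E) : measurable_fun setT V ->
  measurable_fun setT (fun w => (mdist y0 (V w : E) `^ theta)).
Proof.
move=> mV; exact: (measurableT_comp (measurable_powR theta)
  (measurableT_comp (measurable_mdist y0) mV)).
Qed.

Lemma far_prob_le (V : T -> borel E) (L M : R) : measurable_fun setT V ->
  (dist_moment P theta y0 V <= M%:E)%E -> 0 < L ->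
  fine (P [set w | L < mdist y0 (V w : E)]) <= M / L `^ theta.
Proof.
move=> mV hM L0; have /andP[t0 _] := theta01.
set far := [set w | _].
have mfar : measurable far.
  have -> : far = (fun w => mdist y0 (V w : E)) @^-1` `]L, +oo[%classic.
    by apply/seteqP; split=> w /=; rewrite in_itv /= andbT.
  have := measurableT_comp (measurable_mdist y0) mV.
  move=> /(_ measurableT `]L, +oo[%classic).
  by rewrite setTI; apply; exact: measurable_itv.
have Lt : 0 < L `^ theta by rewrite powR_gt0.
rewrite ler_pdivlMr // -lee_fin; apply: le_trans hM.
rewrite mulrC EFinM fineK ?fin_num_measure //.
rewrite -(setIT far) -integral_indic // -ge0_integralZl //; last first.
- by rewrite lee_fin ltW.
- by apply/measurable_EFinP; exact: measurable_indic.
apply: ge0_le_integral => //.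
- by move=> w _; rewrite -EFinM lee_fin mulr_ge0 // ltW.
- by apply/measurable_EFinP; apply: measurable_funM.
- by apply/measurable_EFinP; exact: measurable_dist_power.
move=> w _; rewrite -EFinM lee_fin indicE.
case: (boolP (w \in far)) => [/set_mem fw|_]; last by rewrite mulr0 powR_ge0.
rewrite mulr1 ge0_ler_powR ?nnegrE ?(ltW t0) ?(ltW L0) ?mdist_ge0 //.
exact: ltW.
Qed.

Variable f : borel E * borel F * borel 'rV[R]_p -> borel E.
Hypothesis mf : measurable_fun setT f.
Variables (r rho : R).
Hypotheses (r_gt0 : 0 < r) (rho01 : 0 < rho < 1).
Hypothesis hA : contractive_modulo_constant f rho r.
Variable X : int -> T -> borel F.
Hypothesis mX : forall i, measurable_fun setT (X i).
Hypothesis hX : strictly_stationary P X.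
Variable eps : nat -> T -> borel 'rV[R]_p.
Hypothesis meps : forall i, measurable_fun setT (eps i).
Hypothesis heps : identically_distributed P eps.
Hypothesis hepsX : independent_systems P (sigma_of eps setT) (sigma_of X setT).

(** The noise is independent of the environment, and both have laws that do not
    change with time. *)
Lemma environment_noise_law t (A : set (borel F * borel 'rV[R]_p)) :
  measurable A -> P [set w | A (X (Posz t) w, eps t.+1 w)]
    = P [set w | A (X (Posz 0) w, eps 1%N w)].
Proof.
move=> mA.
have ind s n B C : measurable B -> measurable C ->
    P (X s @^-1` B `&` eps n @^-1` C) = (P (X s @^-1` B) * P (eps n @^-1` C))%E.
  move=> mB mC; apply: (independentC hepsX).
    exact: (@sigma_of_wrt _ _ _ _ _ X setT s Logic.I).
  exact: (@sigma_of_wrt _ _ _ _ _ eps setT n Logic.I).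
rewrite (freezing (mX (Posz t)) (meps t.+1) (ind _ _) mA).
rewrite (freezing (mX (Posz 0)) (meps 1%N) (ind _ _) mA).
pose g x : \bar R := P [set w' | A (x, eps 1%N w')].
have gE n x : P [set w' | A (x, eps n w')] = g x.
  have := @heps n 1%N (xsection A x) (measurable_xsection x mA).
  have E' m : [set w' | A (x, eps m w')] = eps m @^-1` xsection A x.
    by apply/seteqP; split=> w' /=; rewrite /xsection /= inE.
  by rewrite /g !E'.
under eq_integral do rewrite gE; under [in RHS]eq_integral do rewrite gE.
apply: (stationary_integral1 mX hX) => [|x]; last exact: measure_ge0.
pose e1 : {mfun T >-> borel 'rV[R]_p} := mfun_Sub (mem_set (meps 1%N)).
have := measurable_fun_xsection (distribution P e1) mA.
congr measurable_fun; apply/funext => x /=.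
rewrite /distribution /pushforward /g /=; congr (P _).
by apply/seteqP; split=> w' /=; rewrite /xsection /= inE.
Qed.

Lemma innovation_moment t :
  dist_moment P theta y0 (fun w => f (y0, X (Posz t) w, eps t.+1 w)) =
  dist_moment P theta y0 (fun w => f (y0, X (Posz 0) w, eps 1%N w)).
Proof.
pose Z n w := (X (Posz n) w, eps n.+1 w).
have mZ n : measurable_fun setT (Z n) by exact: measurable_fun_pair.
pose D n : {mfun T >-> (borel F * borel 'rV[R]_p)%type} :=
  mfun_Sub (mem_set (mZ n)).
pose g (z : borel F * borel 'rV[R]_p) : \bar R :=
  ((mdist y0 (f (y0, z.1, z.2) : E)) `^ theta)%:E.
have mg : measurable_fun setT g.
  apply/measurable_EFinP.
  have m1 : measurable_fun setT
      (fun z : borel F * borel 'rV[R]_p => (y0 : borel E, z.1, z.2)).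
    by apply: measurable_fun_pair => //; exact: measurable_fun_pair.
  exact: (measurableT_comp (measurable_powR theta)
    (measurableT_comp (measurable_mdist y0) (measurableT_comp mf m1))).
have g0 z : (0 <= g z)%E by rewrite lee_fin powR_ge0.
have E' n : dist_moment P theta y0 (fun w => f (y0, X (Posz n) w, eps n.+1 w))
    = (\int[distribution P (D n)]_z g z)%E.
  by rewrite ge0_integral_distribution.
rewrite !E'; apply: eq_measure_integral => B mB _.
exact: environment_noise_law.
Qed.

Hypothesis innovation_finite :
  (dist_moment P theta y0 (fun w => f (y0, X (Posz 0) w, eps 1%N w)) < +oo)%E.
Variable Y : nat -> T -> borel E.
Hypothesis mY : forall i, measurable_fun setT (Y i).
Hypothesis hY : forall n w, Y n.+1 w = f (Y n w, X (Posz n) w, eps n.+1 w).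
Hypothesis Y0_finite : (dist_moment P theta y0 (Y 0%N) < +oo)%E.

Lemma dist_moment_ge0 V : (0 <= dist_moment P theta y0 V)%E.
Proof. by apply: integral_ge0 => w _; rewrite lee_fin powR_ge0. Qed.

Lemma finite_moment V : (dist_moment P theta y0 V < +oo)%E ->
  exists B : R, dist_moment P theta y0 V = B%:E.
Proof.
have := dist_moment_ge0 V; case: (dist_moment P theta y0 V) => // B _ _.
by exists B.
Qed.

(** As powers of exponent at most 1 are subadditive, the moments satisfy a linear
    recursion with ratio [rho `^ theta < 1]. *)
Lemma bounded_moments : exists M : R, 0 <= M /\
  forall n, (dist_moment P theta y0 (Y n) <= M%:E)%E.
Proof.
have /andP[t0 t1] := theta01; have /andP[rho0 rho1] := rho01.
have [B BE] := finite_moment innovation_finite.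
have [M0 M0E] := finite_moment Y0_finite.
have B0 : 0 <= B by rewrite -lee_fin -BE dist_moment_ge0.
have M00 : 0 <= M0 by rewrite -lee_fin -M0E dist_moment_ge0.
pose b := rho `^ theta.
have b0 : 0 <= b by exact: powR_ge0.
have b1 : b < 1.
  apply: (@lt_le_trans _ _ (1 `^ theta)); last by rewrite powR1.
  by rewrite gt0_ltr_powR ?nnegrE // ltW.
have rt0 : 0 <= r `^ theta by exact: powR_ge0.
pose C := (B + r `^ theta) / (1 - b).
have b1' : 0 < 1 - b by rewrite subr_gt0.
have C0 : 0 <= C.
  by apply: divr_ge0; [exact: addr_ge0|exact: ltW].
have CE : C * (1 - b) = B + r `^ theta by rewrite /C divfK // gt_eqF.
exists (M0 + C); split; first exact: addr_ge0.
elim=> [|n IH]; first by rewrite M0E lee_fin lerDl.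
pose Z w := f (y0, X (Posz n) w, eps n.+1 w).
have mZ : measurable_fun setT Z.
  by apply: (measurableT_comp mf); apply: measurable_fun_pair => //;
    exact: measurable_fun_pair.
have step w : mdist y0 (Y n.+1 w : E) `^ theta <=
    mdist y0 (Z w : E) `^ theta + b * mdist y0 (Y n w : E) `^ theta + r `^ theta.
  have h : mdist y0 (Y n.+1 w : E)
      <= mdist y0 (Z w : E) + (rho * mdist y0 (Y n w : E) + r).
    apply: le_trans (metric_triangle _ (Z w : E) _) _; rewrite lerD2l hY.
    exact: hA.
  have c0 : 0 <= rho * mdist y0 (Y n w : E).
    by rewrite mulr_ge0 ?mdist_ge0 // ltW.
  have c1 : 0 <= rho * mdist y0 (Y n w : E) + r by rewrite addr_ge0 // ltW.
  apply: (@le_trans _ _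
    ((mdist y0 (Z w : E) + (rho * mdist y0 (Y n w : E) + r)) `^ theta)).
    apply: ge0_ler_powR; rewrite ?nnegrE ?mdist_ge0 //; first exact: ltW.
    by apply: addr_ge0; first exact: mdist_ge0.
  apply: le_trans (powR_subadditive theta01 (mdist_ge0 _ _) c1) _.
  rewrite -addrA lerD2l.
  apply: le_trans (powR_subadditive theta01 c0 (ltW r_gt0)) _.
  by rewrite lerD2r powRM ?mdist_ge0 // ltW.
have m1 := measurable_dist_power (mY n.+1).
have m2 := measurable_dist_power mZ.
have m3 := measurable_dist_power (mY n).
apply: (@le_trans _ _ (\int[P]_w ((mdist y0 (Z w : E) `^ theta)%:E
   + b%:E * (mdist y0 (Y n w : E) `^ theta)%:E + (r `^ theta)%:E))%E).
  apply: ge0_le_integral => //.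
  - by move=> w _; rewrite lee_fin powR_ge0.
  - exact/measurable_EFinP.
  - apply/measurable_EFinP; apply: measurable_funD => //.
    by apply: measurable_funD => //; exact: measurable_funM.
  - by move=> w _; rewrite -EFinM -!EFinD lee_fin.
rewrite ge0_integralD //; last 2 first.
- by move=> w _; rewrite -EFinM -EFinD lee_fin addr_ge0 ?mulr_ge0 ?powR_ge0.
- apply/measurable_EFinP; apply: measurable_funD => //.
  exact: measurable_funM.
rewrite ge0_integralD //; last 4 first.
- by move=> w _; rewrite lee_fin powR_ge0.
- exact/measurable_EFinP.
- by move=> w _; rewrite -EFinM lee_fin mulr_ge0 ?powR_ge0.
- by apply/measurable_EFinP; exact: measurable_funM.
rewrite ge0_integralZl //; last 2 first.
- exact/measurable_EFinP.
- by move=> w _; rewrite lee_fin powR_ge0.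
have -> : (\int[P]__ (r `^ theta)%:E = (r `^ theta)%:E)%E.
  transitivity ((r `^ theta)%:E * P setT)%E; first exact: integral_cst.
  by rewrite probability_setT mule1.
have -> : (\int[P]_w (mdist y0 (Z w : E) `^ theta)%:E = B%:E)%E.
  by rewrite -BE -(innovation_moment n).
apply: (@le_trans _ _ (B%:E + b%:E * (M0 + C)%:E + (r `^ theta)%:E)%E).
  by rewrite leeD2r // leeD2l // lee_pmul // integral_ge0 // => w _;
    rewrite lee_fin powR_ge0.
rewrite -EFinM -!EFinD lee_fin.
have -> : B + b * (M0 + C) + r `^ theta = b * M0 + C.
  by transitivity (C * (1 - b) + b * (M0 + C)); [rewrite CE|]; ring.
by rewrite lerD2r ler_piMl // ltW.
Qed.

End moments.

(** * Enlarging the past *)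

Section dependence_extension.
Context {d : measure_display} {T : measurableType d} {R : realType}.
Variable P : probability T R.
Implicit Types G H U : set_system T.

(** Independent randomness does not create dependence: it can be frozen, and then
    only [G] and [H] remain. *)
Lemma dependence_enlarge G H U (a : R) :
  sigma_algebra setT G -> sigma_algebra setT U ->
  G `<=` measurable -> H `<=` measurable -> U `<=` measurable ->
  independent_systems P U (sigma_join G H) ->
  dependence_le P G H a -> dependence_le P (sigma_join G U) H a.
Proof.
move=> sG sU Gm Hm Um indU GH A C GUA HC.
pose K := sigma_join G H.
have sK : sigma_algebra setT K by exact: sigma_algebra_join.
have Km : K `<=` measurable.
  by apply: sub_join => //; exact: sigma_algebra_measurable.
pose TG := g_sigma_algebraType G; pose TU := g_sigma_algebraType U.
pose TK := g_sigma_algebraType K.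
pose diag (w : T) : TG * TU := (w, w).
have [S mS AE] : exists2 S : set (TG * TU), measurable S & A = diag @^-1` S.
  suff : sigma_join G U `<=` preimage_set_system setT diag measurable.
    by move=> h; have [S mS <-] := h A GUA; exists S => //; rewrite setTI.
  apply: sub_join.
  - exact/sigma_algebra_preimage/sigma_algebra_measurable.
  - move=> B GB; exists (B `*` setT).
      by apply: measurableX => //; rewrite measurable_g_measurableTypeE.
    by apply/seteqP; split=> w //= [_ []].
  - move=> B UB; exists (setT `*` B).
      by apply: measurableX => //; rewrite measurable_g_measurableTypeE.
    by apply/seteqP; split=> w //= [_ []].
have mid V (sV : sigma_algebra setT V) : V `<=` measurable ->
    measurable_fun setT (id : T -> g_sigma_algebraType V).
  move=> Vm _ B; rewrite measurable_g_measurableTypeE // => VB.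
  by rewrite setTI; exact: Vm.
have midU := mid U sU Um; have midK := mid K sK Km.
have mKG : measurable_fun setT (id : TK -> TG).
  move=> _ B; rewrite !measurable_g_measurableTypeE // => GB.
  by rewrite setTI; exact: sigma_joinl.
pose phi w := fine (P [set w' | S (w : TG, w' : TU)]).
have Gphi : measurable_wrt G phi.
  by apply/(measurable_wrtP _ sG); exact: (measurable_freezing P midU mS).
have secU w : U [set w' | S (w : TG, w' : TU)].
  have := measurable_xsection (w : TG) mS; rewrite measurable_g_measurableTypeE //.
  by congr U; apply/seteqP; split=> w' /=; rewrite /xsection /= inE.
have phi01 w : 0 <= phi w <= 1 by apply: fine_prob_unit; exact: Um.
pose SK : set (TK * TU) := (fun z => (z.1 : TG, z.2)) @^-1` S.
have mSK : measurable SK.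
  have m1 : measurable_fun setT (fun z : TK * TU => (z.1 : TG, z.2)).
    apply: measurable_fun_pair; last exact: measurable_snd.
    exact: (measurableT_comp mKG measurable_fst).
  by have := m1 measurableT S mS; rewrite setTI.
have ind B B' : measurable B -> measurable B' ->
    P ((id : T -> TK) @^-1` B `&` (id : T -> TU) @^-1` B')
    = (P ((id : T -> TK) @^-1` B) * P ((id : T -> TU) @^-1` B'))%E.
  rewrite !measurable_g_measurableTypeE // => KB UB'.
  exact: (independentC indU).
have joint D : K D -> fine (P (A `&` D)) = \int[P]_(w in D) phi w.
  move=> KD; pose SD := SK `&` (fst @^-1` D : set (TK * TU)).
  have mSD : measurable SD.
    apply: measurableI => //.
    have := @measurable_fst _ _ TK TU measurableT D; rewrite setTI; apply.
    by rewrite measurable_g_measurableTypeE.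
  have := freezing midK midU ind mSD.
  have -> : [set w | SD ((id : T -> TK) w, (id : T -> TU) w)] = A `&` D.
    by rewrite AE.
  move=> ->; rewrite /Rintegral; congr fine.
  rewrite [RHS]integral_mkcond; apply: eq_integral => w _; rewrite patchE.
  have mw := Um _ (secU w).
  case: ifPn => [/set_mem Dw|/negP nD].
    rewrite /phi fineK ?fin_num_measure //; congr (P _).
    by apply/seteqP; split=> w' /=; rewrite /SD /SK /= => // -[].
  rewrite (_ : [set w' | _] = set0) ?measure0 //.
  by apply/seteqP; split=> w' //= -[_ /= Dw]; apply: nD; rewrite inE.
have := @dependence_event_function _ _ _ P G H a C phi sG Gm Hm GH HC Gphi phi01.
rewrite -(joint C) /=; last exact: sigma_joinr.
have := joint setT (sigma_algebraT sK); rewrite setIT => <-.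
by rewrite mulrC.
Qed.

(** Events of the infinite past are reached from those of finite pasts by monotone
    limits. *)
Lemma dependence_increasing (G : nat -> set_system T) H (a : R) :
  (forall N, sigma_algebra setT (G N)) -> (forall N, G N `<=` measurable) ->
  (forall M N, (M <= N)%N -> G M `<=` G N) -> H `<=` measurable ->
  (forall N, dependence_le P (G N) H a) ->
  dependence_le P <<s \bigcup_N G N >> H a.
Proof.
move=> sG Gm ndG Hm GH A C sA HC.
have mC := Hm _ HC.
pose D (B : set T) := `|fine (P (B `&` C)) - fine (P B) * fine (P C)|.
pose good : set_system T := [set B | measurable B /\ D B <= a].
suff : <<s \bigcup_N G N >> `<=` good by move=> /(_ A sA)[].
have limD F B : (forall i, measurable (F i)) -> measurable B ->
    (P \o F @ \oo --> P B) -> (P \o (fun i => F i `&` C) @ \oo --> P (B `&` C)) ->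
    (forall i, D (F i) <= a) -> D B <= a.
  move=> mF mB h1 h2 hF.
  have f1 : fine (P (F i)) @[i --> \oo] --> fine (P B).
    by apply: fine_cvg; rewrite fineK // fin_num_measure.
  have f2 : fine (P (F i `&` C)) @[i --> \oo] --> fine (P (B `&` C)).
    by apply: fine_cvg; rewrite fineK // fin_num_measure //; exact: measurableI.
  have f3 : D (F i) @[i --> \oo] --> D B.
    apply: cvg_norm; apply: cvgB => //; apply: cvgM => //; exact: cvg_cst.
  have -> : D B = limn (D \o F) by apply/esym/cvg_lim.
  apply: limr_le; first by apply/cvg_ex; exists (D B).
  by near=> i; exact: hF.
have mono : monotone good.
  split=> F nF gF.
    have mF i : measurable (F i) by case: (gF i).
    have mU : measurable (\bigcup_i F i) by exact: bigcupT_measurable.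
    split=> //; apply: (limD F) => //; [|rewrite setI_bigcupl|by move=> i; case: (gF i)].
      exact: nondecreasing_cvg_mu.
    apply: nondecreasing_cvg_mu.
    - by move=> i; exact: measurableI.
    - by apply: bigcupT_measurable => i; exact: measurableI.
    - by move=> m n mn; apply/subsetPset; apply: setSI; exact/subsetPset/nF.
  have mF i : measurable (F i) by case: (gF i).
  have mI : measurable (\bigcap_i F i) by exact: bigcapT_measurable.
  have fin B : measurable B -> (P B < +oo)%E.
    by move=> mB; rewrite ltey_eq fin_num_measure.
  split=> //; apply: (limD F) => //; [| |by move=> i; case: (gF i)].
    by apply: nonincreasing_cvg_mu => //; exact: fin.
  rewrite -bigcapIl //; apply: nonincreasing_cvg_mu => //.
  - by apply: fin; exact: measurableI.
  - by move=> i; exact: measurableI.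
  - by apply: bigcapT_measurable => i; exact: measurableI.
  - by move=> m n mn; apply/subsetPset; apply: setSI; exact/subsetPset/nF.
pose alg : set_system T := \bigcup_N G N.
have ralg : setring alg.
  have two B B' : alg B -> alg B' -> exists N, G N B /\ G N B'.
    move=> [M _ GB] [N _ GB']; exists (maxn M N).
    by split; [exact: ndG (leq_maxl M N) _ GB|exact: ndG (leq_maxr M N) _ GB'].
  split.
  - by exists 0%N => //; case: (sG 0%N).
  - move=> B B' /two h /h [N [GB GB']]; exists N => //.
    rewrite -(measurable_g_measurableTypeE (sG N)) in GB GB' *.
    exact: measurableU.
  - move=> B B' /two h /h [N [GB GB']]; exists N => //.
    rewrite -(measurable_g_measurableTypeE (sG N)) in GB GB' *.
    exact: measurableD.
have algT : alg setT by exists 0%N => //; exact: sigma_algebraT.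
have sub : alg `<=` good.
  by move=> B [N _ GB]; split; [exact: Gm GB|exact: GH GB HC].
apply: subset_trans (monotone_setring_sub_g_sigma_ring mono ralg sub).
apply: smallest_sub; last exact: sub_g_sigma_ring.
have [sr0 srD srU] := smallest_sigma_ring alg.
split => // B srB; apply: srD => //; exact: sub_g_sigma_ring.
Unshelve. all: by end_near.
Qed.

End dependence_extension.

Section almost_sure_copies.
Context {d d' : measure_display} {T : measurableType d}
  {U : measurableType d'} {R : realType}.
Variable P : probability T R.

Lemma ae_eq_prob (A B : set T) : measurable A -> measurable B ->
  {ae P, forall w, A w <-> B w} -> P A = P B.
Proof.
move=> mA mB AB; rewrite -(setIT A) -(setIT B).
rewrite -!integral_indic //; apply: ae_eq_integral => //.
- by apply/measurable_EFinP; exact: measurable_indic.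
- by apply/measurable_EFinP; exact: measurable_indic.
apply: filterS AB => w AB _; rewrite !indicE; congr ((nat_of_bool _)%:R%:E).
by apply/idP/idP; rewrite !inE => /AB.
Qed.

Variables (Z Z' : nat -> T -> U).
Hypotheses (mZ : forall k, measurable_fun setT (Z k))
  (mZ' : forall k, measurable_fun setT (Z' k)).
Hypothesis ZZ' : forall k, {ae P, forall w, Z k w = Z' k w}.

(** With countably many indices the whole paths of [Z] and [Z'] are almost surely
    equal. *)
Lemma ae_copy (J : set nat) A : sigma_of Z J A ->
  exists2 A', sigma_of Z' J A' & {ae P, forall w, A w <-> A' w}.
Proof.
move=> /sigma_of_preimage[S mS ->].
exists (path_of Z' @^-1` S); first exact: preimage_sigma_of.
apply: filterS (ae_foralln ZZ') => w h /=.
by rewrite (_ : path_of Z w = path_of Z' w) //; apply/funext.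
Qed.

Lemma dependence_ae_copy J J' a :
  dependence_le P (sigma_of Z' J) (sigma_of Z' J') a ->
  dependence_le P (sigma_of Z J) (sigma_of Z J') a.
Proof.
move=> h A B ZA ZB.
have [A' ZA' AA'] := ae_copy ZA; have [B' ZB' BB'] := ae_copy ZB.
have mA := sigma_of_measurable mZ ZA; have mB := sigma_of_measurable mZ ZB.
have mA' := sigma_of_measurable mZ' ZA'; have mB' := sigma_of_measurable mZ' ZB'.
have -> : P (A `&` B) = P (A' `&` B').
  apply: ae_eq_prob; [exact: measurableI|exact: measurableI|].
  by apply: filterS2 AA' BB' => w [a1 a2] [b1 b2]; split=> -[/= ? ?];
    split; auto.
by rewrite (ae_eq_prob mA mA' AA') (ae_eq_prob mB mB' BB'); exact: h.
Qed.

End almost_sure_copies.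

(** * Bounds for one restart of the chain *)

Section noise_from_iid.
Context {d : measure_display} {T : measurableType d} {R : realType}
  {P : probability T R} {E F : polishType R} {p : nat}.

Lemma sigma_of_reindex d' (U : measurableType d') (I I' : Type)
    (Z : I -> T -> U) (h : I' -> I) (J : set I') (J' : set I) :
  (forall i, J i -> J' (h i)) -> sigma_of (Z \o h) J `<=` sigma_of Z J'.
Proof.
move=> hJ; apply: sigma_of_sub; first exact: sigma_algebra_sigma_of.
by move=> i /hJ Jh B mB; exact: (@sigma_of_wrt _ _ _ _ _ Z J' (h i)).
Qed.

Variable f : borel E * borel F * borel 'rV[R]_p -> borel E.
Hypothesis mf : measurable_fun setT f.
Variables (r rho K : R)
  (nu : R.-pker (borel F * (borel E * borel E)) ~> borel E)
  (eta : borel F -> R).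

Lemma driving_noise_iid (I : eqType) (Z : I -> T -> borel 'rV[R]_p) (i0 : I)
    (h : nat -> I) :
  (forall i, measurable_fun setT (Z i)) -> iid P Z -> injective h ->
  minorized_within_bounded_distance P f rho r (Z i0) nu eta K ->
  driving_noise (P:=P) f r rho K nu eta (fun k => Z (h k)).
Proof.
move=> mZ [indZ idZ] inj hB k; split.
- exact: mZ.
- move=> A B mA; rewrite path_measurableE => mB.
  apply: (independent_blocks mZ (J1 := [set h k])
    (J2 := h @` [set j | (k < j)%N]) indZ).
  + by move=> _ -> [j /= kj /inj jk]; rewrite jk ltnn in kj.
  + exact: (@sigma_of_wrt _ _ _ _ _ Z [set h k]).
  + apply: (@sigma_of_reindex _ _ _ _ Z (fun j => h (k.+1 + j)%N) setT).
      by move=> j _; exists (k.+1 + j)%N => //=; rewrite addSn ltnS leq_addr.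
    exact: (@preimage_sigma_of _ _ _ _ _
      (fun j => Z (h (k.+1 + j)%N)) setT B mB).
- by apply: (minorized_same_law mf _ hB) => B mB; exact: idZ.
Qed.

End noise_from_iid.

(** After enough common steps a failed attempt is forgotten: the distance is
    again within reach of the minorization. *)
Lemma recovery_stride (R : realType) (r rho K : R) : 0 < r -> 0 < rho < 1 ->
  0 < K -> exists s : nat, rho ^+ s * (failure_radius r rho K - r / (1 - rho))
    <= r / (1 - rho).
Proof.
move=> r0 /andP[rho0 rho1] K0.
have q0 : 0 < r / (1 - rho) by rewrite divr_gt0 // subr_gt0.
have g0 : 0 < failure_radius r rho K - r / (1 - rho).
  rewrite /failure_radius /capture_radius -mulrA.
  by move: q0; move: (r / (1 - rho)) => q q0; lra.
have [|s hs] := @expr_eventually_le R rho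
  (r / (1 - rho) / (failure_radius r rho K - r / (1 - rho))) _ (divr_gt0 q0 g0).
  by rewrite ltW.
by exists s; rewrite -ler_pdivlMr //; exact: hs.
Qed.

Section mixing_bounds.
Context {d : measure_display} {T : measurableType d} {R : realType}
  {P : probability T R} {E F : polishType R} {p : nat}.
Variable f : borel E * borel F * borel 'rV[R]_p -> borel E.
Hypothesis mf : measurable_fun setT f.
Variables (r rho K : R).
Hypotheses (r_gt0 : 0 < r) (rho01 : 0 < rho < 1) (K_gt0 : 0 < K).
Hypothesis hA : contractive_modulo_constant f rho r.
Variables (nu : R.-pker (borel F * (borel E * borel E)) ~> borel E)
  (eta : borel F -> R).
Hypothesis eta01 : forall x, 0 < eta x <= 1.
Hypothesis meta : measurable_fun setT eta.
Variable stride : nat.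
Hypothesis stride_recovers : rho ^+ stride *
  (failure_radius r rho K - r / (1 - rho)) <= r / (1 - rho).

Section one_start.
Variables (G : set_system T) (X : nat -> T -> borel F)
  (W : nat -> T -> borel E) (e : nat -> T -> borel 'rV[R]_p).
Hypotheses (sG : sigma_algebra setT G) (Gm : G `<=` measurable).
Hypothesis he : driving_noise (P:=P) f r rho K nu eta e.
Hypothesis GX : forall k, measurable_wrt G (X k).
Hypothesis GW : measurable_wrt G (W 0%N).
Hypothesis Ge : independent_systems P G (sigma_of e setT).
Hypothesis mW : forall k, measurable_fun setT (W k).
Hypothesis WS : forall k, {ae P, forall w, W k.+1 w = f (W k w, X k w, e k w)}.

(** The recursion is only assumed almost surely, as in the stationary case; an
    event of the chain is then replaced by its copy for the exact trajectory. *)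
Lemma dependence_of_chain G1 H (a : R) (J : set nat) (y0 : borel E) n0 m :
  let N := (n0 + m * stride.+1)%N in
  G1 `<=` G -> sigma_algebra setT H -> H `<=` measurable ->
  dependence_le P G1 H a ->
  (forall S, sigma_of (coord (U := (borel F * borel E)%type)) J S ->
    measurable_wrt H (fun w => future_prob P f S e N (path_of X w) y0)) ->
  dependence_le P G1
    (sigma_of (fun k w => (X (N + k)%N w, W (N + k)%N w)) J)
    (a + 2 * miss_prob (P:=P) X (W 0%N) r rho eta stride y0 n0 m).
Proof.
move=> N G1G sH Hm dep Hphi C B GC hB.
have [S hS BS] := sigma_of_preimage hB.
have mS := sigma_of_coord_measurable hS.
have mX k : measurable_fun setT (X k).
  by apply: (measurable_wrt_measurable Gm); exact: GX.
have me k : measurable_fun setT (e k) by case: (he k).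
have mB : measurable B.
  by apply: (sigma_of_measurable _ hB) => k; exact: measurable_fun_pair.
pose B' := future_event f S X (W 0%N) e N.
have mB' : measurable B' by exact: (measurable_realized_future mf mS Gm me GX GW).
have BB' : {ae P, forall w, B w <-> B' w}.
  apply: filterS (ae_foralln WS) => w h.
  have trE k : W k w = traj f (path_of X w) (path_of e w) (W 0%N w) k.
    by elim: k => [//|k IH]; rewrite h /= -IH.
  rewrite BS /B' /future_event /= (_ : path_of _ w
    = future f N (path_of X w) (path_of e w) (W 0%N w)) //.
  by apply/funext => k; rewrite /path_of /future -trE.
have mC := Gm (G1G _ GC).
rewrite (ae_eq_prob mB mB' BB') (ae_eq_prob (A := C `&` B) (B := C `&` B')).
- exact: (dependence_of_future mf mS sG Gm me GX GW Ge r_gt0 rho01 K_gt0 hA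
    eta01 meta he stride_recovers G1G sH Hm dep GC (Hphi S hS)).
- exact: measurableI.
- exact: measurableI.
by apply: filterS BB' => w [b1 b2]; split=> -[/= ? ?]; split; auto.
Qed.

End one_start.

Variables (theta : R) (y0 : E).
Hypothesis theta01 : 0 < theta <= 1.
Variable X : int -> T -> borel F.
Hypothesis mX : forall i, measurable_fun setT (X i).
Hypothesis hX : strictly_stationary P X.

(** Markov's inequality at the range of the burn-in, and stationarity of the
    environment for the failures. *)
Lemma miss_prob_le (t0 : int) (V : T -> borel E) (M : R) n0 m :
  measurable_fun setT V -> (dist_moment P theta y0 V <= M%:E)%E ->
  miss_prob (P:=P) (fun k => X (t0 + Posz k)) V r rho eta stride y0 n0 m <=
  M / (r / (1 - rho)) `^ theta * (rho `^ theta) ^+ n0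
  + survival P X eta stride m.
Proof.
move=> mV hM; have /andP[rho0 rho1] := rho01.
have q0 : 0 < r / (1 - rho) by rewrite divr_gt0 // subr_gt0.
have rn : 0 < rho ^+ n0 by rewrite exprn_gt0.
rewrite /miss_prob; apply: lerD.
  have L0 : 0 < burn_in_range r rho n0 by rewrite divr_gt0.
  apply: (le_trans (far_prob_le theta01 mV hM L0)).
  rewrite le_eqVlt; apply/orP; left; apply/eqP.
  rewrite /burn_in_range powRM ?(ltW q0) ?invr_ge0 ?(ltW rn) //.
  rewrite invfM mulrA; congr (_ * _).
  rewrite -powR_inv1 ?(ltW rn) // -powRrM mulN1r powRN invrK.
  rewrite -(powR_mulrn n0 (ltW rho0)) -(powR_mulrn n0 (powR_ge0 rho theta)).
  by rewrite -!powRrM mulrC.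
rewrite -(survival_shift mX hX stride meta eta01 (t0 + Posz n0) m).
rewrite le_eqVlt; apply/orP; left; apply/eqP; congr fine.
apply: eq_integral => w _; congr (_%:E); apply: eq_bigr => i _.
by congr (1 - eta (X _ w)); rewrite PoszD; ring.
Qed.

End mixing_bounds.

(** * The chain with an independent initial value *)

(** Room for a gap and a burn-in of length [q] each, and for [q] attempts that
    come every [k.+1] steps. *)
Lemma attempts_fit (q k n j : nat) : (q * k.+3 <= n)%N ->
  (q + j + (q + q * k.+1) <= n + j)%N.
Proof. rewrite !mulnS; lia. Qed.

Section rates_from_attempts.
Context {d : measure_display} {T : measurableType d} {R : realType}
  {P : probability T R} {E F : polishType R} {p : nat}.
Variable f : borel E * borel F * borel 'rV[R]_p -> borel E.
Hypothesis mf : measurable_fun setT f.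
Variables (r rho K : R).
Hypotheses (r_gt0 : 0 < r) (rho01 : 0 < rho < 1) (K_gt0 : 0 < K).
Hypothesis hA : contractive_modulo_constant f rho r.
Variables (nu : R.-pker (borel F * (borel E * borel E)) ~> borel E)
  (eta : borel F -> R).
Hypothesis eta01 : forall x, 0 < eta x <= 1.
Hypothesis meta : measurable_fun setT eta.
Variables (theta : R) (y0 : E).
Hypothesis theta01 : 0 < theta <= 1.
Variable X : int -> T -> borel F.
Hypothesis mX : forall i, measurable_fun setT (X i).
Hypothesis hX : strictly_stationary P X.

Lemma inherits_mixing_rates_of_attempts (aXY : nat -> R) (stride s : nat) (C : R) :
  (0 < s)%N -> 0 <= C -> (forall n, 0 <= aXY n) ->
  (forall n q, q = (n %/ s)%N -> aXY n <= alphaZ P X q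
      + C * ((rho `^ theta) ^+ q + survival P X eta stride q)) ->
  inherits_mixing_rates (alphaZ P X) aXY.
Proof.
move=> s0 C0 a0 h; have /andP[rho0 rho1] := rho01; have /andP[t0 t1] := theta01.
have b01 : 0 < rho `^ theta < 1.
  rewrite powR_gt0 //=; apply: (@lt_le_trans _ _ (1 `^ theta)).
    by rewrite gt0_ltr_powR ?nnegrE // ltW.
  by rewrite powR1.
apply: (@inherits_mixing_rates_of_bound R (alphaZ P X) aXY
  (survival P X eta stride) (C + 1) (rho `^ theta) s) => //.
- by move=> n; exact: alpha_coef_ge0.
- by move=> n; exact: survival_ge0.
- by move=> n; exact: survival_le1.
- by move=> m n; exact: survival_noninc.
- by move=> a q b; exact: survival_decouple.
- exact: survival1_lt1.
- by rewrite ltr_wpDl.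
move=> n; apply: (le_trans (h n _ erefl)); rewrite lerD2l ler_wpM2r ?lerDl //.
by rewrite addr_ge0 ?survival_ge0 // exprn_ge0 // ltW //; case/andP: b01.
Qed.

Section independent_start.
Variable eps : nat -> T -> borel 'rV[R]_p.
Hypothesis meps : forall i, measurable_fun setT (eps i).
Hypothesis heps : iid P eps.
Hypothesis hepsX : independent_systems P (sigma_of eps setT) (sigma_of X setT).
Hypothesis hB : minorized_within_bounded_distance P f rho r (eps 0%N) nu eta K.
Hypothesis innovation_finite :
  (dist_moment P theta y0 (fun w => f (y0, X (Posz 0) w, eps 1%N w)) < +oo)%E.
Variable Y : nat -> T -> borel E.
Hypothesis mY : forall i, measurable_fun setT (Y i).
Hypothesis hY : forall n w, Y n.+1 w = f (Y n w, X (Posz n) w, eps n.+1 w).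
Hypothesis Y0_finite : (dist_moment P theta y0 (Y 0%N) < +oo)%E.

Let XN (t : nat) := X (Posz t).
Let input (t : nat) w := (XN t w, eps t.+1 w).

Hypothesis Y0_independent : independent_systems P
  (g_sigma_algebra_preimage (Y 0%N)) (sigma_of input setT).

Let GY := g_sigma_algebra_preimage (Y 0%N).

Let sGY : sigma_algebra setT GY.
Proof. exact/sigma_algebra_preimage/sigma_algebra_measurable. Qed.

Let GYm : GY `<=` measurable.
Proof. by move=> _ [B mB <-]; exact: mY. Qed.

Lemma chain_measurable_wrt H n : sigma_algebra setT H ->
  measurable_wrt H (Y 0%N) -> (forall i, (i < n)%N -> measurable_wrt H (XN i)) ->
  (forall i, (i < n)%N -> measurable_wrt H (eps i.+1)) -> measurable_wrt H (Y n).
Proof.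
move=> sH HY; elim: n => [//|n IH] HX He.
have -> : Y n.+1 = f \o (fun w => (Y n w, X (Posz n) w, eps n.+1 w)).
  by apply/funext => w; rewrite hY.
apply: measurable_wrt_comp => //; apply: measurable_wrt_pair => //; last first.
  exact: He.
apply: measurable_wrt_pair => //; last exact: HX.
by apply: IH => i /ltnW; [exact: HX|exact: He].
Qed.

Let sigma_XN J : sigma_of XN J `<=` sigma_of input setT.
Proof.
apply: sigma_of_sub; first exact: sigma_algebra_sigma_of.
move=> i _ B mB.
apply: (@sigma_of_wrt _ _ _ _ _ input setT i Logic.I (fst @^-1` B)).
by rewrite -[X in measurable X]setTI; exact: measurable_fst.
Qed.

Let sigma_eps J : J `<=` [set i | (0 < i)%N] ->
  sigma_of eps J `<=` sigma_of input setT.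
Proof.
move=> J0; apply: sigma_of_sub; first exact: sigma_algebra_sigma_of.
move=> [|i] /J0 //= _ B mB.
apply: (@sigma_of_wrt _ _ _ _ _ input setT i Logic.I (snd @^-1` B)).
by rewrite -[X in measurable X]setTI; exact: measurable_snd.
Qed.

Let sigma_XN_X J : sigma_of XN J `<=` sigma_of X setT.
Proof. exact: sigma_of_reindex. Qed.

Let sX J : sigma_of X J `<=` measurable. Proof. exact: sigma_of_measurable. Qed.
Let sXN J : sigma_of XN J `<=` measurable.
Proof. by apply: sigma_of_measurable => i; exact: mX. Qed.
Let seps J : sigma_of eps J `<=` measurable.
Proof. exact: sigma_of_measurable. Qed.

(** The information at time [m], enlarged by the whole environment. The variable
    [eps 0] is left out: [Y 0] is independent of the inputs of the chain, which
    begin with [eps 1]. *)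
Let before m := sigma_join GY
  (sigma_join (sigma_of XN setT) (sigma_of eps [set i | (0 < i <= m)%N])).

Let before_independent m :
  independent_systems P (before m) (sigma_of eps [set i | (m < i)%N]).
Proof.
set GE := sigma_of eps [set i | (0 < i <= m)%N].
have sub0 : [set i | (0 < i <= m)%N] `<=` [set i | (0 < i)%N].
  by move=> i /andP[].
have subm : [set i | (m < i)%N] `<=` [set i | (0 < i)%N].
  by move=> i; exact: leq_trans.
apply: independent_join => //.
- exact: sigma_algebra_join.
- by apply: sub_join => //; exact: sigma_algebra_measurable.
- apply: independentS Y0_independent => //.
  apply: sub_join; first exact: sigma_algebra_sigma_of.
    apply: sub_join; first exact: sigma_algebra_sigma_of.
      exact: sigma_XN.
    exact: sigma_eps.
  exact: sigma_eps.
apply: independent_join => //; try exact: sigma_algebra_sigma_of.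
- apply: independentC; apply: independentS hepsX; last exact: sigma_XN_X.
  apply: sub_join; first exact: sigma_algebra_sigma_of.
    exact: sigma_ofS.
  exact: sigma_ofS.
- case: heps => ind _; apply: independent_blocks => // i /= /andP[_ im].
  by rewrite ltnNge im.
Qed.

(** The initial value and the noise up to time [j] add nothing to the dependence
    between the past and the future of the environment. *)
Let past_dependence j q :
  dependence_le P (sigma_of (joint XN Y) [set s | (s <= j)%N])
    (sigma_of X [set s | (Posz (q + j) <= s)%O]) (alphaZ P X q).
Proof.
set H := sigma_of X _.
pose G := sigma_of XN [set s | (s <= j)%N].
pose U := sigma_join GY (sigma_of eps [set i | (0 < i <= j)%N]).
have sG : sigma_algebra setT G by exact: sigma_algebra_sigma_of.
have sU : sigma_algebra setT U by exact: sigma_algebra_join.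
have HN : H `<=` sigma_of XN setT.
  apply: sigma_of_sub; first exact: sigma_algebra_sigma_of.
  move=> [t|t] //= _ B mB.
  exact: (@sigma_of_wrt _ _ _ _ _ XN setT t Logic.I).
have Um : U `<=` measurable.
  by apply: sub_join => //; exact: sigma_algebra_measurable.
apply: (@dependence_leS _ _ _ _ (sigma_join G U) H) => //; last first.
  apply: dependence_enlarge => //.
  - exact: sXN.
  - exact: sX.
  - apply: independent_join => //.
    + exact: sigma_algebra_sigma_of.
    + apply: sub_join; first exact: sigma_algebra_measurable.
        exact: sXN.
      exact: sX.
    + apply: independentS Y0_independent => //.
      apply: sub_join; first exact: sigma_algebra_sigma_of.
        by apply: sigma_eps => i /andP[].
      apply: sub_join; first exact: sigma_algebra_sigma_of.
        exact: sigma_XN.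
      by apply: subset_trans HN _; exact: sigma_XN.
    + apply: independentS hepsX; first exact: sigma_ofS.
      apply: sub_join; first exact: sigma_algebra_sigma_of.
        exact: sigma_XN_X.
      exact: sigma_ofS.
  - apply: dependence_leS (alpha_coef_dependence P mX (n:=q) (j:=j)) => //.
    by apply: sigma_of_reindex => i /=; rewrite lez_nat.
have sGU := sigma_algebra_join G U.
apply: sigma_of_sub => // s /= sj; apply: measurable_wrt_pair => //.
  apply: (measurable_wrtS (@sigma_joinl _ G U)).
  exact: (@sigma_of_wrt _ _ _ _ _ XN).
apply: chain_measurable_wrt => //.
- apply: (measurable_wrtS (@sigma_joinr _ G U)).
  apply: (measurable_wrtS (@sigma_joinl _ GY _)) => B mB.
  by exists B => //; rewrite setTI.
- move=> i si; apply: (measurable_wrtS (@sigma_joinl _ G U)).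
  by apply: (@sigma_of_wrt _ _ _ _ _ XN); exact: leq_trans (ltnW si) sj.
- move=> i si; apply: (measurable_wrtS (@sigma_joinr _ G U)).
  apply: (measurable_wrtS (@sigma_joinr _ GY _)).
  by apply: (@sigma_of_wrt _ _ _ _ _ eps); exact: leq_trans si sj.
Qed.

Theorem mixing_rates_independent_start :
  inherits_mixing_rates (alphaZ P X) (alphaN P (joint XN Y)).
Proof.
have [stride hs] := recovery_stride r_gt0 rho01 K_gt0.
have [M [M0 hM]] := bounded_moments theta01 mf r_gt0 rho01 hA mX hX meps
  heps.2 hepsX innovation_finite mY hY Y0_finite.
have mXY i : measurable_fun setT (joint XN Y i) by
  apply: measurable_fun_pair; [exact: mX|exact: mY].
have q0 : 0 < r / (1 - rho).
  by case/andP: rho01 => _ rho1; rewrite divr_gt0 // subr_gt0.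
pose c := M / (r / (1 - rho)) `^ theta.
have c0 : 0 <= c by rewrite divr_ge0 // powR_ge0.
apply: (@inherits_mixing_rates_of_attempts _ stride stride.+3 (2 * (c + 1))) => //.
- by rewrite mulr_ge0 // addr_ge0.
- by move=> n; exact: alpha_coef_ge0.
move=> n q qE; apply: alpha_coef_le => j.
pose m := (q + j)%N; pose N := (q + q * stride.+1)%N.
pose e k := eps (m + k).+1.
have he : driving_noise (P:=P) f r rho K nu eta e.
  apply: (driving_noise_iid mf (h := fun k => (m + k).+1) meps heps _ hB).
  by move=> k k' [] /addnI.
have sB : sigma_algebra setT (before m) by exact: sigma_algebra_join.
have Bm : before m `<=` measurable.
  apply: sub_join; [exact: sigma_algebra_measurable|exact: GYm|].
  by apply: sub_join; [exact: sigma_algebra_measurable|exact: sXN|exact: seps].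
have BX k : measurable_wrt (before m) (XN k).
  apply: (measurable_wrtS (@sigma_joinr _ GY _)).
  apply: (measurable_wrtS (@sigma_joinl _ _ _)).
  exact: (@sigma_of_wrt _ _ _ _ _ XN).
have BY k : (k <= m)%N -> measurable_wrt (before m) (Y k).
  move=> km; apply: chain_measurable_wrt => //.
    apply: (measurable_wrtS (@sigma_joinl _ GY _)) => B mB.
    by exists B => //; rewrite setTI.
  move=> i ik; apply: (measurable_wrtS (@sigma_joinr _ GY _)).
  apply: (measurable_wrtS (@sigma_joinr _ _ _)).
  by apply: (@sigma_of_wrt _ _ _ _ _ eps); exact: leq_trans ik km.
have Be : independent_systems P (before m) (sigma_of e setT).
  apply: independentS (@before_independent m) => //.
  apply: (@sigma_of_reindex _ _ _ _ _ _ eps (fun k => (m + k).+1)) => k _ /=.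
  by rewrite ltnS leq_addr.
pose X' k := X (Posz m + Posz k); pose W k := Y (m + k)%N.
have sH : sigma_algebra setT (sigma_of X [set s | (Posz m <= s)%O]).
  exact: sigma_algebra_sigma_of.
have HX k : measurable_wrt (sigma_of X [set s | (Posz m <= s)%O]) (X' k).
  by apply: (@sigma_of_wrt _ _ _ _ _ X) => /=; rewrite /= lerDl.
have me k : measurable_fun setT (e k) by exact: meps.
apply: dependence_leS (dependence_leW _ (@dependence_of_chain _ _ _ P _ _ _ f mf r rho K r_gt0
  rho01 K_gt0 hA nu eta eta01 meta stride hs (before m) X' W e sB Bm he
  (fun k => BX (m + k)%N) _ Be _ _ (sigma_of (joint XN Y) [set s | (s <= j)%N])
  (sigma_of X [set s | (Posz m <= s)%O]) (alphaZ P X q) setT y0 q q _ sH (@sX _)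
  (@past_dependence j q) _)).
- by [].
- apply: sigma_of_sub; first exact: sigma_algebra_sigma_of.
  move=> s /= ns; have -> : joint XN Y s =
      (fun w => (X' (N + (s - (m + N)))%N w, W (N + (s - (m + N)))%N w)).
    have Es : s = (m + (N + (s - (m + N))))%N.
      rewrite addnA subnKC //; apply: leq_trans ns.
      by apply: attempts_fit; rewrite qE; exact: leq_trunc_div.
    by rewrite /joint /X' /W [in LHS]Es.
  exact: (@sigma_of_wrt _ _ _ _ _ (fun k w => (X' (N + k)%N w, W (N + k)%N w))).
- rewrite lerD2l -mulrA ler_pM2l //.
  apply: (le_trans (miss_prob_le r_gt0 rho01 eta01 meta stride theta01 mX hX
    (Posz m) q q (mY _) (hM _))).
  have h1 : 0 <= (rho `^ theta) ^+ q by rewrite exprn_ge0 // powR_ge0.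
  have h2 : 0 <= survival P X eta stride q by exact: survival_ge0.
  rewrite -/c; move: h1 h2; move: (_ ^+ q) (survival _ _ _ _ _) => u v u0 v0.
  by move: c c0 => c c0; nra.
- by rewrite /W addn0; exact: BY.
- by move=> k; exact: mY.
- move=> k; apply: aeW => w.
  by rewrite /W addnS hY.
- apply: sigma_of_sub => // s /= sj; apply: measurable_wrt_pair => //.
  by apply: BY; exact: leq_trans sj (leq_addl _ _).
- move=> S hS; apply: (measurable_wrt_future_prob mf) => //.
  by move=> B mB; rewrite preimage_cst; case: ifP => _;
      [exact: sigma_algebraT|case: sH].
Qed.

End independent_start.
End rates_from_attempts.

(** * The stationary chain *)

Section stationary_start.
Context {d : measure_display} {T : measurableType d} {R : realType}
  {P : probability T R} {E F : polishType R} {p : nat}.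
Variable f : borel E * borel F * borel 'rV[R]_p -> borel E.
Hypothesis mf : measurable_fun setT f.
Variables (r rho K : R).
Hypotheses (r_gt0 : 0 < r) (rho01 : 0 < rho < 1) (K_gt0 : 0 < K).
Hypothesis hA : contractive_modulo_constant f rho r.
Variables (nu : R.-pker (borel F * (borel E * borel E)) ~> borel E)
  (eta : borel F -> R).
Hypothesis eta01 : forall x, 0 < eta x <= 1.
Hypothesis meta : measurable_fun setT eta.
Variables (theta : R) (y0 : E).
Hypothesis theta01 : 0 < theta <= 1.
Variable X : int -> T -> borel F.
Hypothesis mX : forall i, measurable_fun setT (X i).
Hypothesis hX : strictly_stationary P X.
Variable eps : int -> T -> borel 'rV[R]_p.
Hypothesis meps : forall i, measurable_fun setT (eps i).
Hypothesis heps : iid P eps.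
Hypothesis hB : minorized_within_bounded_distance P f rho r (eps 0) nu eta K.
Variable Y : int -> T -> borel E.
Hypothesis mY : forall i, measurable_fun setT (Y i).
Hypothesis hXY : strictly_stationary P (joint X Y).
Hypothesis hY : forall t : int,
  {ae P, forall w, Y t w = f (Y (t - 1) w, X (t - 1) w, eps t w)}.
Hypothesis nonanticipative : forall t : int,
  independent_systems P (sigma_of eps [set s | t < s])
    (sigma_join (sigma_of X setT) (sigma_of Y [set s | s <= t])).
Hypothesis Y0_finite : (dist_moment P theta y0 (Y 0) < +oo)%E.

Let mXY i : measurable_fun setT (joint X Y i).
Proof. by apply: measurable_fun_pair; [exact: mX|exact: mY]. Qed.

Let sX J : sigma_of X J `<=` measurable. Proof. exact: sigma_of_measurable. Qed.
Let sY J : sigma_of Y J `<=` measurable. Proof. exact: sigma_of_measurable. Qed.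

Lemma stationary_moment t : dist_moment P theta y0 (Y t) = dist_moment P theta y0 (Y 0).
Proof.
pose g (z : borel F * borel E) : \bar R := ((mdist y0 (z.2 : E)) `^ theta)%:E.
have mg : measurable_fun setT g.
  by apply/measurable_EFinP; apply: measurable_dist_power; exact: measurable_snd.
have g0 z : (0 <= g z)%E by rewrite lee_fin powR_ge0.
exact: (stationary_integral1 mXY hXY t 0 mg g0).
Qed.

Variable stride : nat.
Hypothesis stride_recovers : rho ^+ stride *
  (failure_radius r rho K - r / (1 - rho)) <= r / (1 - rho).
Variable M : R.
Hypothesis Y0_moment : (dist_moment P theta y0 (Y 0) <= M%:E)%E.

Let miss q := M / (r / (1 - rho)) `^ theta * (rho `^ theta) ^+ q
  + survival P X eta stride q.

(** The restart of the stationary chain at a time [t0]. It is applied twice: with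
    [t0] after the past to be forgotten, and with [t0] in the remote past. *)
Lemma dependence_of_stationary_chain (t0 : int) G1 H (a : R) (J : set nat) q :
  let N := (q + q * stride.+1)%N in
  G1 `<=` sigma_of X setT \/
    G1 `<=` sigma_join (sigma_of X setT) (sigma_of Y [set s | s <= t0]) ->
  sigma_algebra setT H -> H `<=` measurable -> dependence_le P G1 H a ->
  (forall S, sigma_of (coord (U := (borel F * borel E)%type)) J S ->
    measurable_wrt H (fun w => future_prob P f S (fun k => eps (t0 + Posz k.+1)) N
      (path_of (fun k => X (t0 + Posz k)) w) y0)) ->
  dependence_le P G1 (sigma_of (fun k => joint X Y (t0 + Posz (N + k)%N)) J)
    (a + 2 * miss q).
Proof.
move=> N G1G' sH Hm dep Hphi.
set G := sigma_join (sigma_of X setT) (sigma_of Y [set s | s <= t0]) in G1G'.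
have sG : sigma_algebra setT G by exact: sigma_algebra_join.
have G1G : G1 `<=` G.
  by case: G1G' => // /subset_trans; apply; exact: sigma_joinl.
have Gm : G `<=` measurable by apply: sub_join => //; exact: sigma_algebra_measurable.
pose e k := eps (t0 + Posz k.+1).
have he : driving_noise (P:=P) f r rho K nu eta e.
  apply: (driving_noise_iid mf (h := fun k => t0 + Posz k.+1) meps heps _ hB).
  by move=> k k' /addrI [].
have GX k : measurable_wrt G (X (t0 + Posz k)).
  apply: (measurable_wrtS (@sigma_joinl _ _ _)).
  exact: (@sigma_of_wrt _ _ _ _ _ X).
have GY : measurable_wrt G (Y (t0 + Posz 0)).
  apply: (measurable_wrtS (@sigma_joinr _ _ _)).
  by apply: (@sigma_of_wrt _ _ _ _ _ Y); rewrite /= addr0.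
have Ge : independent_systems P G (sigma_of e setT).
  apply: independentC.
  apply: independentS (nonanticipative (t:=t0)) => //.
  apply: (@sigma_of_reindex _ _ _ _ _ _ eps (fun k => t0 + Posz k.+1)) => k _ /=.
  by rewrite ltrDl.
have rec k : {ae P, forall w, Y (t0 + Posz k.+1) w =
    f (Y (t0 + Posz k) w, X (t0 + Posz k) w, e k w)}.
  have := hY (t0 + Posz k.+1).
  by rewrite (_ : t0 + Posz k.+1 - 1 = t0 + Posz k) // intS; ring.
apply: dependence_leW (dependence_of_chain mf r_gt0 rho01 K_gt0 hA eta01 meta
  stride_recovers sG Gm he GX (W := fun k => Y (t0 + Posz k)) GY Ge _ rec
  (J := J) (y0 := y0) (n0 := q) (m := q) G1G sH Hm dep Hphi).
  rewrite lerD2l ler_pM2l //; apply: (miss_prob_le r_gt0 rho01 eta01 meta stride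
    theta01 mX hX t0 q q (mY _)).
  by rewrite stationary_moment.
by move=> k; exact: mY.
Qed.

(** Here the roles are exchanged. The chain in the window [-L, j] is the future of
    a chain started long before time -L; restarted from [y0] at that time, it is a
    function of the environment up to time [j]. *)
Lemma dependence_on_environment_future j q :
  dependence_le P (sigma_of (joint X Y) [set s | s <= Posz j])
    (sigma_of X [set s | Posz (q + j)%N <= s]) (alphaZ P X q + 2 * miss q).
Proof.
set H := sigma_of X _; set N := (q + q * stride.+1)%N.
pose window L : set int := [set s | - Posz L <= s <= Posz j].
have sub : sigma_of (joint X Y) [set s | s <= Posz j] `<=`
    <<s \bigcup_L sigma_of (joint X Y) (window L) >>.
  apply: sigma_of_sub; first exact: smallest_sigma_algebra.
  move=> s /= sj B mB; apply: sub_sigma_algebra; exists `|s|%N => //.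
  apply: (@sigma_of_wrt _ _ _ _ _ (joint X Y)) => //.
  by rewrite /window /= sj andbT abszE lerNl -normrN ler_norm.
apply: (dependence_leS sub (@subset_refl _ H)).
apply: dependence_increasing => //.
- by move=> L; exact: sigma_algebra_sigma_of.
- by move=> L; exact: sigma_of_measurable.
- move=> L L' LL'; apply: sigma_ofS => s /= /andP[h sj].
  rewrite /window /= sj andbT.
  by apply: le_trans h; rewrite lerN2 lez_nat.
- exact: sX.
move=> L; apply: dependence_leC.
pose t0 : int := - Posz L - Posz N.
have sH' : sigma_algebra setT (sigma_of X [set s | s <= Posz j]).
  exact: sigma_algebra_sigma_of.
apply: dependence_leS (@dependence_of_stationary_chain t0 H
  (sigma_of X [set s | s <= Posz j]) (alphaZ P X q) [set k | (k <= L + j)%N] q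
  _ sH' (@sX _) _ _) => //.
- apply: sigma_of_sub; first exact: sigma_algebra_sigma_of.
  move=> s /= /andP[Ls sj].
  have -> : joint X Y s = joint X Y (t0 + Posz (N + `|(s + Posz L)%R|)%N).
    congr (joint X Y); rewrite PoszD gez0_abs; last by rewrite -lerBlDr sub0r.
    by rewrite /t0; ring.
  apply: (@sigma_of_wrt _ _ _ _ _ (fun k => joint X Y (t0 + Posz (N + k)%N))).
  rewrite /= -lez_nat gez0_abs; last by rewrite -lerBlDr sub0r.
  by rewrite PoszD addrC lerD2l.
- by left; exact: sigma_ofS.
- exact/dependence_leC/alpha_coef_dependence.
move=> S hS; apply: (measurable_wrt_future_prob_stopped mf _ y0 sH' _ _ hS).
- exact: sigma_of_coord_measurable hS.
- by move=> k; exact: meps.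
move=> k kN; apply: (@sigma_of_wrt _ _ _ _ _ X) => /=.
have {}kN : Posz k <= Posz N + (Posz L + Posz j) by rewrite -!PoszD lez_nat.
rewrite -subr_ge0 (_ : _ - _ = Posz N + (Posz L + Posz j) - Posz k).
  by rewrite subr_ge0.
by rewrite /t0; ring.
Qed.

Lemma stationary_alpha_le n q : (q * stride.+3 <= n)%N ->
  alphaZ P (joint X Y) n <= alphaZ P X q + 4 * miss q.
Proof.
move=> qn; apply: alpha_coef_le => j.
have -> : alphaZ P X q + 4 * miss q = alphaZ P X q + 2 * miss q + 2 * miss q.
  by ring.
set N := (q + q * stride.+1)%N; set t0 := Posz (q + j).
have sH : sigma_algebra setT (sigma_of X [set s | t0 <= s]).
  exact: sigma_algebra_sigma_of.
apply: dependence_leS (@dependence_of_stationary_chain t0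
  (sigma_of (joint X Y) [set s | s <= Posz j])
  (sigma_of X [set s | t0 <= s]) (alphaZ P X q + 2 * miss q) setT q
  _ sH (@sX _) (@dependence_on_environment_future j q) _) => //.
- apply: sigma_of_sub; first exact: sigma_algebra_sigma_of.
  move=> s /= ns.
  have Ns : t0 + Posz N <= s.
    by apply: le_trans ns; rewrite -PoszD lez_nat; exact: attempts_fit.
  have -> : joint X Y s = joint X Y (t0 + Posz (N + `|(s - (t0 + Posz N))%R|)%N).
    congr (joint X Y); rewrite PoszD gez0_abs ?subr_ge0 //; ring.
  exact: (@sigma_of_wrt _ _ _ _ _ (fun k => joint X Y (t0 + Posz (N + k)%N))).
- right; apply: sigma_of_sub; first exact: sigma_algebra_join.
  move=> s /= sj; apply: measurable_wrt_pair; first exact: sigma_algebra_join.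
    apply: (measurable_wrtS (@sigma_joinl _ _ _)).
    exact: (@sigma_of_wrt _ _ _ _ _ X).
  apply: (measurable_wrtS (@sigma_joinr _ _ _)).
  apply: (@sigma_of_wrt _ _ _ _ _ Y) => /=; apply: (le_trans sj).
  by rewrite /t0 lez_nat leq_addl.
move=> S hS; apply: (measurable_wrt_future_prob mf) => //.
- by move=> k; apply: (@sigma_of_wrt _ _ _ _ _ X); rewrite /= lerDl.
by move=> B mB; rewrite preimage_cst; case: ifP => _;
  [exact: sigma_algebraT|case: sH].
Qed.

End stationary_start.

Section stationary_rates.
Context {d : measure_display} {T : measurableType d} {R : realType}
  {P : probability T R} {E F : polishType R} {p : nat}.
Variable f : borel E * borel F * borel 'rV[R]_p -> borel E.
Hypothesis mf : measurable_fun setT f.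
Variables (r rho K : R).
Hypotheses (r_gt0 : 0 < r) (rho01 : 0 < rho < 1) (K_gt0 : 0 < K).
Hypothesis hA : contractive_modulo_constant f rho r.
Variables (nu : R.-pker (borel F * (borel E * borel E)) ~> borel E)
  (eta : borel F -> R).
Hypothesis eta01 : forall x, 0 < eta x <= 1.
Hypothesis meta : measurable_fun setT eta.
Variables (theta : R) (y0 : E).
Hypothesis theta01 : 0 < theta <= 1.
Variable X : int -> {RV P >-> borel F}.
Hypothesis hX : strictly_stationary P X.
Variable eps : int -> {RV P >-> borel 'rV[R]_p}.
Hypothesis heps : iid P eps.
Hypothesis hB : minorized_within_bounded_distance P f rho r (eps 0) nu eta K.
Variable Y : int -> {RV P >-> borel E}.
Hypothesis hY : stationary_solution f X eps Y.
Hypothesis Y0_finite : (dist_moment P theta y0 (Y 0) < +oo)%E.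

Let mXY i : measurable_fun setT (joint X Y i).
Proof. by apply: measurable_fun_pair. Qed.

Lemma stationary_attempts_bound : exists stride : nat, exists2 C : R, 0 <= C &
  forall n q, q = (n %/ stride.+3)%N -> alphaZ P (joint X Y) n
    <= alphaZ P X q + C * ((rho `^ theta) ^+ q + survival P X eta stride q).
Proof.
have [stride hs] := recovery_stride r_gt0 rho01 K_gt0.
have [M ME] := finite_moment Y0_finite.
have M0 : 0 <= M by rewrite -lee_fin -ME dist_moment_ge0.
have q0 : 0 < r / (1 - rho).
  by case/andP: rho01 => _ rho1; rewrite divr_gt0 // subr_gt0.
pose c := M / (r / (1 - rho)) `^ theta.
have c0 : 0 <= c by rewrite divr_ge0 // powR_ge0.
exists stride, (4 * (c + 1)); first by rewrite mulr_ge0 // addr_ge0.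
move=> n q qE; case: hY => st rec nonant.
have hM : (dist_moment P theta y0 (Y 0) <= M%:E)%E by rewrite ME.
have := @stationary_alpha_le _ _ _ P E F p f mf r rho K r_gt0 rho01 K_gt0 hA nu
  eta eta01 meta theta y0 theta01 X _ hX eps _ heps hB Y _ st rec _ stride hs M hM
  n q.
move=> h; apply: le_trans (h _ _ _ _ _) _ => //.
  by rewrite qE; exact: leq_trunc_div.
rewrite lerD2l -[leRHS]mulrA ler_pM2l //.
have h1 : 0 <= (rho `^ theta) ^+ q by rewrite exprn_ge0 // powR_ge0.
have h2 : 0 <= survival P X eta stride q by exact: survival_ge0.
rewrite -/c; move: h1 h2; move: (_ ^+ q) (survival _ _ _ _ _) => u v u0 v0.
by move: c c0 => c c0; nra.
Qed.

Theorem mixing_rates_stationary :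
  inherits_mixing_rates (alphaZ P X) (alphaZ P (joint X Y)).
Proof.
have [stride [C C0 h]] := stationary_attempts_bound.
apply: (inherits_mixing_rates_of_attempts _ _ _ _ _ _ _ C0 _ h) => //.
by move=> n; exact: alpha_coef_ge0.
Qed.

(** From time 0 on, the chain started from the stationary value is almost surely
    the stationary chain. *)
Theorem mixing_rates_stationary_start (Y' : nat -> {RV P >-> borel E}) :
  (forall w, Y' 0%N w = Y 0 w) ->
  (forall n w, Y' n.+1 w = f (Y' n w, X (Posz n) w, eps (Posz n.+1) w)) ->
  inherits_mixing_rates (alphaZ P X)
    (alphaN P (joint (fun t : nat => X (Posz t)) Y')).
Proof.
move=> Y'0 Y'S.
have mXY' i : measurable_fun setT (joint (fun t : nat => X (Posz t)) Y' i).
  by apply: measurable_fun_pair.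
have [stride [C C0 h]] := stationary_attempts_bound.
apply: (@inherits_mixing_rates_of_attempts _ _ _ P _ rho rho01 eta eta01 meta
  theta theta01 X _ hX _ stride stride.+3 C) => //.
  by move=> n; exact: alpha_coef_ge0.
move=> n q qE; apply: le_trans (h n q qE).
have YY' k : {ae P, forall w, Y' k w = Y (Posz k) w}.
  elim: k => [|k IH]; first by apply: aeW.
  have := solution_recursion hY (Posz k.+1).
  rewrite (_ : Posz k.+1 - 1 = Posz k); last by rewrite intS; ring.
  by apply: filterS2 IH => w e1 ->; rewrite Y'S e1.
apply: alpha_coef_le => j.
apply: (@dependence_ae_copy _ _ _ _ _ P _ (fun k => joint X Y (Posz k))) => //.
  by move=> k; apply: filterS (YY' k) => w e1; rewrite /joint e1.
apply: dependence_leS (alpha_coef_dependence P mXY (inj := Posz) (n:=n) (j:=j)).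
  by apply: sigma_of_reindex => i /=; rewrite lez_nat.
by apply: sigma_of_reindex => i /=; rewrite lez_nat.
Qed.

End stationary_rates.

Theorem theorem2p8 (R : realType) (E F : polishType R) (p : nat)
    (hp : (0 < p)%N)
    (d : measure_display) (T : measurableType d) (P : probability T R)
    (X : int -> {RV P >-> borel F})
    (hX : strictly_stationary P X)
    (eps : nat -> {RV P >-> borel 'rV[R]_p})
    (heps : iid P eps)
    (hepsX : independent_systems P
      (sigma_of eps [set: nat]) (sigma_of X [set: int]))
    (f : borel E * borel F * borel 'rV[R]_p -> borel E)
    (hf : measurable_fun [set: borel E * borel F * borel 'rV[R]_p] f)
    (r rho : R) (hr : 0 < r) (hrho : 0 < rho < 1)
    (hA : contractive_modulo_constant f rho r)
    (nu : R.-pker (borel F * (borel E * borel E)) ~> borel E)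
    (eta : borel F -> R) (heta_meas : measurable_fun [set: borel F] eta)
    (heta : forall x, 0 < eta x <= 1)
    (K : R) (hK : 0 < K)
    (hB : minorized_within_bounded_distance P f rho r (eps 0%N) nu eta K)
    (y0 : E) (theta : R) (htheta : 0 < theta <= 1)
    (hmoment : (dist_moment P theta y0
      (fun w => f (y0, X (Posz 0) w, eps 1%N w)) < +oo)%E)
    (Y : nat -> {RV P >-> borel E})
    (hY : forall n w, Y n.+1 w = f (Y n w, X (Posz n) w, eps n.+1 w))
    (hY0 : (dist_moment P theta y0 (Y 0%N) < +oo)%E) :
  (independent_systems P (g_sigma_algebra_preimage (Y 0%N))
     (sigma_of (fun (t : nat) w => (X (Posz t) w, eps t.+1 w)) [set: nat]) ->
   inherits_mixing_rates (alphaZ P X)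
     (alphaN P (joint (fun t : nat => X (Posz t)) Y)))
  /\
  (forall (epsZ : int -> {RV P >-> borel 'rV[R]_p})
      (Ystar : int -> {RV P >-> borel E}),
   (forall n w, epsZ (Posz n) w = eps n w) ->
   iid P epsZ ->
   independent_systems P (sigma_of epsZ [set: int]) (sigma_of X [set: int]) ->
   stationary_solution f X epsZ Ystar ->
   (forall w, Y 0%N w = Ystar (Posz 0) w) ->
   inherits_mixing_rates (alphaZ P X) (alphaZ P (joint X Ystar)) /\
   inherits_mixing_rates (alphaZ P X)
     (alphaN P (joint (fun t : nat => X (Posz t)) Y))).
Proof.
have mX i : measurable_fun setT (X i) by [].
have meps i : measurable_fun setT (eps i) by [].
have mY i : measurable_fun setT (Y i) by [].
split=> [Y0_independent|epsZ Ystar epsZE iidZ _ hYstar Y0E].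
  exact: (mixing_rates_independent_start hf hr hrho hK hA heta heta_meas htheta
    mX hX meps heps hepsX hB hmoment mY hY hY0 Y0_independent).
have hBZ : minorized_within_bounded_distance P f rho r (epsZ 0) nu eta K.
  have eps0 : (epsZ 0 : T -> borel 'rV[R]_p) = eps 0%N.
    by apply/funext => w; exact: (epsZE 0%N).
  by rewrite eps0.
have hYstar0 : (dist_moment P theta y0 (Ystar (Posz 0)) < +oo)%E.
  have YY : (Ystar 0 : T -> borel E) = Y 0%N by apply/funext => w.
  by rewrite YY.
split.
  exact: (mixing_rates_stationary hf hr hrho hK hA heta heta_meas htheta hX iidZ
    hBZ hYstar hYstar0).
apply: (mixing_rates_stationary_start hf hr hrho hK hA heta heta_meas htheta hX
  iidZ hBZ hYstar hYstar0 Y0E) => n w.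
by rewrite epsZE.
Qed.
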